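(* Let $\rho(\theta)$, $\theta\in\Theta\subseteq\mathbb R^p$, be a smooth quantum statistical model of $d\times d$ density matrices. Let $\psi:\Theta\to\mathbb R^q$ be a smooth function with $q\times p$ derivative matrix $\psi'$, $(\psi')_{ij}=\partial\psi_i/\partial\theta_j$, and let $\widetilde G(\theta)$ be a positive-definite real symmetric $q\times q$ matrix function of $\theta$. Put $G_0=\psi'^\top\widetilde G\,\psi'$, assumed positive-definite. Let $\pi$ be a smooth prior probability density on a compact subset $\Theta_0\subseteq\Theta$ such that $\Theta_0$ has a piecewise smooth boundary, on which $\pi$ is zero. Suppose moreover that the quantity $\mathcal J(\pi)$ (defined in the context) is finite. Then for every sequence, indexed by $N$, of measurements $M^{(N)}$ on $N$ copies of the system (i.e. on the state $\rho(\theta)^{\otimes N}$) and of estimators $\widehat\psi^{(N)}$ of $\psi(\theta)$ based on the outcome of $M^{(N)}$, $$\liminf_{N\to\infty} N R^{(N)}(\pi)\ \ge\ \mathbb E_\pi\,\mathcal C_{G_0},$$ where $R^{(N)}(\pi)=\mathbb E_\pi\,\mathrm{trace}\,\widetilde G V^{(N)}$ is the Bayes risk and $\mathcal C_{G_0}$ is the function $\theta\mapsto\mathcal C_{G_0(\theta)}(\theta)$ defined in the context.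
   Context: States and measurements. A $d\times d$ density matrix is a self-adjoint non-negative complex matrix of trace one. A quantum statistical model is a family $\rho(\theta)$ of $d\times d$ density matrices indexed by a real column vector $\theta\in\Theta\subseteq\mathbb R^p$. ''Smooth'' means once continuously differentiable. The joint state of $N$ copies is $\rho(\theta)^{\otimes N}$ on $(\mathbb C^d)^{\otimes N}$. A (collective) measurement $M^{(N)}$ on $N$ copies is a positive operator valued measure on a measurable space $(\mathcal X,\mathcal B)$: a sigma-additive map assigning to each $B\in\mathcal B$ a non-negative self-adjoint $d^N\times d^N$ matrix $M^{(N)}(B)$, with $M^{(N)}(\mathcal X)=\mathbf 1$. The outcome has distribution $\Pr(\text{outcome}\in B)=\mathrm{trace}(\rho(\theta)^{\otimes N}M^{(N)}(B))$. Risk. $V^{(N)}(\theta)=\mathbb E_\theta(\widehat\psi^{(N)}-\psi(\theta))(\widehat\psi^{(N)}-\psi(\theta))^\top$ is the mean square error matrix, where $\mathbb E_\theta$ is expectation over the outcome of $M^{(N)}$ for given $\theta$; $\mathbb E_\pi$ is averaging over $\theta$ with respect to the density $\pi$. Estimators are arbitrary measurable functions of the outcome. Holevo bound. For a positive-definite real symmetric $p\times p$ matrix $G$, $$\mathcal C_G(\theta)=\inf\{\mathrm{trace}(GV): V\ge Z(\vec X)\},$$ the infimum being over real symmetric $p\times p$ matrices $V$ and over $\vec X=(X_1,\dots,X_p)$, where the $X_i$ are $d\times d$ self-adjoint matrices satisfying $\frac{\partial}{\partial\theta_i}\mathrm{trace}(\rho(\theta)X_j)=\delta_{ij}$ for all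 $i,j$ (the $X_j$ held fixed in the differentiation); $Z(\vec X)$ is the $p\times p$ self-adjoint matrix with entries $\mathrm{trace}(\rho(\theta)X_iX_j)$; $\ge$ is the ordering of self-adjoint matrices. It is assumed throughout that the bound is finite, i.e. that for each $\theta$ there is some $\vec X$ satisfying the constraints. The set $\mathcal V$. For given $\theta$, $\mathcal V=\mathcal V(\theta)$ is the set of positive-definite symmetric real $p\times p$ matrices $V$ with $\mathrm{trace}(GV)\ge\mathcal C_G(\theta)$ for all positive-definite symmetric real $G$. The quantity $\mathcal J(\pi)$. For each $\theta$ let $V_0(\theta)$ be the unique element of $\mathcal V(\theta)$ achieving equality in $\mathrm{trace}(G_0V)\ge\mathcal C_{G_0}$, and let $C(\theta)=\widetilde G\,\psi' V_0$, a $q\times p$ matrix. Let $(C\pi)'$ be the column vector of length $q$ with $i$-th entry $\sum_j\frac{\partial}{\partial\theta_j}(C_{ij}\pi)$. Then $$\mathcal J(\pi)=\mathbb E_\pi\,\frac{(C\pi)'^\top\,\widetilde G^{-1}\,(C\pi)'}{\pi^2}.$$ The hypothesis that $\mathcal J(\pi)$ is finite presupposes that it is well defined, i.e. that $C\pi$ is smooth as a function of $\theta$. *)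

(* Defs.v *)
From HB Require Import structures.
From mathcomp Require Import all_boot all_order all_algebra.
From mathcomp Require Import sesquilinear spectral.
From mathcomp Require Import all_classical all_reals all_analysis.
From mathcomp.real_closed Require Import complex mxtens.

Set Implicit Arguments.
Unset Strict Implicit.
Unset Printing Implicit Defensive.

Import Order.TTheory GRing.Theory Num.Theory.
Import numFieldNormedType.Exports.

Local Open Scope classical_set_scope.
Local Open Scope ring_scope.
Local Open Scope sesquilinear_scope.

(* The sigma-algebra on column vectors generated by the coordinates, as in the
   library's instance for tuples; over a realType it is the Borel one. *)
Section measurable_cV.
Context {d : measure_display} {T : measurableType d} (n : nat).

Let coord : 'I_n -> 'cV[T]_n -> T := fun i v => v i 0.

Let cV_set0 : g_sigma_preimage coord set0.
Proof. exact: sigma_algebra0. Qed.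

Let cV_setC A : g_sigma_preimage coord A -> g_sigma_preimage coord (~` A).
Proof. exact: sigma_algebraC. Qed.

Let cV_bigcup (F : _^nat) : (forall i, g_sigma_preimage coord (F i)) ->
  g_sigma_preimage coord (\bigcup_i (F i)).
Proof. exact: sigma_algebra_bigcup. Qed.

HB.instance Definition _ := @isMeasurable.Build (measure_tuple_display d)
  'cV[T]_n (g_sigma_preimage coord) cV_set0 cV_setC cV_bigcup.

End measurable_cV.

Lemma measurable_coord d (T : measurableType d) n (i : 'I_n) :
  measurable_fun [set: 'cV[T]_n] (fun v => v i 0).
Proof.
move=> _ Y mY; rewrite setTI; apply: sub_sigma_algebra => /=.
case: n => [|n] in i *; first by case: i.
rewrite -bigcup_mkord_ord; exists i; first exact: ltn_ord.
by exists Y => //; rewrite setTI inord_val.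
Qed.

Lemma measurable_fun_cVP d d' (S : measurableType d) (T : measurableType d') n
    (f : S -> 'cV[T]_n) :
  measurable_fun [set: S] f <->
  forall i, measurable_fun [set: S] (fun x => f x i 0).
Proof.
split=> [mf i|mf].
  exact: (measurableT_comp (measurable_coord (T:=T) i) mf).
have sub : g_sigma_preimage (fun (i : 'I_n) (v : 'cV[T]_n) => v i 0) `<=`
    [set B | measurable (f @^-1` B)].
  apply: smallest_sub.
    split=> /=.
    - by rewrite preimage_set0.
    - by move=> B mB; rewrite setTD preimage_setC; exact: measurableC.
    - by move=> F mF; rewrite preimage_bigcup; exact: bigcupT_measurable.
  case: n => [|n] in f mf *; first by rewrite big_ord0.
  rewrite -bigcup_mkord_ord; apply: bigcup_sub => i Ii B [Y mY <-] /=.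
  by rewrite setTI; have := mf (inord i) measurableT Y mY; rewrite setTI.
by move=> _ A mA; rewrite setTI; exact: sub.
Qed.

Section lebesgue_measure_cV.
Context {R : realType}.

Definition cV_cons n (xv : measurableTypeR R * 'cV[R]_n) : 'cV[R]_n.+1 :=
  \col_i (if unlift 0 i is Some j then xv.2 j 0 else xv.1).

Definition cV_uncons n (v : 'cV[R]_n.+1) : measurableTypeR R * 'cV[R]_n :=
  (v 0 0, \col_i v (lift 0 i) 0).

Lemma measurable_cV_cons n : measurable_fun setT (@cV_cons n).
Proof.
apply/measurable_fun_cVP => i.
case: (unliftP 0 i) => [j ->|->].
  rewrite (_ : (fun _ => _) = (fun v : 'cV[R]_n => v j 0) \o snd); last first.
    by apply/funext => x /=; rewrite mxE liftK.
  by apply: measurableT_comp; [exact: measurable_coord|exact: measurable_snd].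
rewrite (_ : (fun _ => _) = fst); last first.
  by apply/funext => x /=; rewrite mxE unlift_none.
exact: measurable_fst.
Qed.

Lemma measurable_cV_uncons n : measurable_fun setT (@cV_uncons n).
Proof.
apply: measurable_fun_pair; first exact: measurable_coord.
apply/measurable_fun_cVP => i.
rewrite (_ : (fun _ => _) = (fun v : 'cV[R]_n.+1 => v (lift 0 i) 0)).
  exact: measurable_coord.
by apply/funext => x; rewrite mxE.
Qed.

Lemma cV_consK n : cancel (@cV_cons n) (@cV_uncons n).
Proof.
move=> [x v]; rewrite /cV_uncons /cV_cons /= mxE unlift_none; congr pair.
by apply/colP => i; rewrite !mxE liftK.
Qed.

Section step.
Variables (n : nat) (mu : {sigma_finite_measure set 'cV[R]_n -> \bar R}).

Definition lebesgue_cV_step : set 'cV[R]_n.+1 -> \bar R :=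
  pushforward (@lebesgue_measure R \x mu)%E (@cV_cons n).

Let mpre (A : set 'cV[R]_n.+1) : measurable A ->
  measurable (@cV_cons n @^-1` A).
Proof.
by move=> mA; rewrite -[X in measurable X]setTI; exact: measurable_cV_cons.
Qed.

Let step0 : lebesgue_cV_step set0 = 0%E.
Proof. by rewrite /lebesgue_cV_step /pushforward preimage_set0 measure0. Qed.

Let step_ge0 A : (0 <= lebesgue_cV_step A)%E.
Proof. by rewrite /lebesgue_cV_step /pushforward measure_ge0. Qed.

Let step_sigma_additive : semi_sigma_additive lebesgue_cV_step.
Proof.
move=> F mF tF mUF; rewrite /lebesgue_cV_step /pushforward preimage_bigcup.
apply: measure_semi_sigma_additive.
- by move=> k; exact: mpre.
- apply/trivIsetP => i j _ _ ij; rewrite -preimage_setI.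
  by move/trivIsetP : tF => /(_ _ _ _ _ ij) ->//; rewrite preimage_set0.
- by rewrite -preimage_bigcup; exact: mpre.
Qed.

HB.instance Definition _ := isMeasure.Build _ _ _ lebesgue_cV_step
  step0 step_ge0 step_sigma_additive.

Let step_sigma_finite : sigma_finite setT lebesgue_cV_step.
Proof.
have [F TF mF] : sigma_finite setT (@lebesgue_measure R \x mu)%E.
  have /sigma_finiteP[F [TF ndF Foo]] := sigma_finiteT (@lebesgue_measure R).
  have /sigma_finiteP[G [TG ndG Goo]] := sigma_finiteT mu.
  exists (fun k => F k `*` G k).
    rewrite -setXTT TF TG predeqE => -[x y]; split.
      move=> [/= [k _ Fkx] [l _ Gly]]; exists (maxn k l) => //; split.
      - by move: x Fkx; exact/subsetPset/ndF/leq_maxl.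
      - by move: y Gly; exact/subsetPset/ndG/leq_maxr.
    by move=> [k _ []/= ? ?]; split; exists k.
  move=> k; have [? ?] := Foo k; have [? ?] := Goo k.
  split; first exact: measurableX.
  by rewrite product_measure1E// lte_mul_pinfty// ge0_fin_numE.
exists (fun k => @cV_uncons n @^-1` F k).
  by rewrite -preimage_bigcup -TF preimage_setT.
move=> k; have [mFk Fk] := mF k; split.
  by rewrite -[X in measurable X]setTI; exact: measurable_cV_uncons.
rewrite /lebesgue_cV_step /pushforward -comp_preimage.
by rewrite (_ : _ \o _ = id) ?preimage_id//; apply/funext => x; exact: cV_consK.
Qed.

HB.instance Definition _ := Measure_isSigmaFinite.Build _ _ _ lebesgue_cV_step
  step_sigma_finite.

End step.
(* Lebesgue measure on R^n; on the one-point space R^0 it is the unit mass. *)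
Fixpoint lebesgue_cV (n : nat) : {sigma_finite_measure set 'cV[R]_n -> \bar R} :=
  match n with
  | 0 => @dirac _ _ (0 : 'cV[R]_0) R
  | n'.+1 => lebesgue_cV_step (lebesgue_cV n')
  end.

Lemma measurable_box n (A : 'I_n -> set (measurableTypeR R)) :
  (forall i, measurable (A i)) ->
  measurable [set v : 'cV[R]_n | forall i, A i (v i 0)].
Proof.
move=> mA.
rewrite (_ : mkset _ = \bigcap_(i in [set: 'I_n])
    ((fun v : 'cV[R]_n => v i 0) @^-1` A i)); last first.
  by apply/seteqP; split => v /= Av i => [_|]; exact: Av.
apply: fin_bigcap_measurable => // i _.
rewrite -[X in measurable X]setTI.
exact: (measurable_coord (T:=R) i measurableT (mA i)).
Qed.

Lemma lebesgue_cV_box n (A : 'I_n -> set (measurableTypeR R)) :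
  (forall i, measurable (A i)) ->
  lebesgue_cV n [set v : 'cV[R]_n | forall i, A i (v i 0)] =
  (\prod_(i < n) @lebesgue_measure R (A i))%E.
Proof.
elim: n A => [|n IHn] A mA.
  rewrite big_ord0 /= diracE.
  have -> // : (0 : 'cV[R]_0) \in [set v : 'cV[R]_0 | forall i, A i (v i 0)].
  by apply/mem_set => -[].
rewrite big_ord_recl -IHn; last by move=> i; exact: mA.
have mB := measurable_box (fun i => mA (lift 0 i)).
rewrite -(product_measure1E _ (lebesgue_cV n) (mA 0) mB).
rewrite /= /lebesgue_cV_step /pushforward.
congr (_ _); apply/seteqP; split => -[x v] /= Av.
  split => [|i]; first by have := Av 0; rewrite mxE unlift_none.
  by have := Av (lift 0 i); rewrite mxE liftK.
move=> i; rewrite mxE; case: unliftP => [j ->|->]; last by case: Av.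
by case: Av => _; exact.
Qed.

End lebesgue_measure_cV.

Section smoothness.
Context {R : realType}.

Definition partial p (j : 'I_p) (f : 'cV[R]_p -> R) : 'cV[R]_p -> R :=
  'D_(delta_mx j 0 : 'cV[R]_p) f.

Definition jacobian_cV p q (f : 'cV[R]_p -> 'cV[R]_q) (x : 'cV[R]_p) :
    'M[R]_(q, p) :=
  \matrix_(i, j) partial j (fun t => f t i 0) x.

(* f is once continuously differentiable on an open neighbourhood of A *)
Definition smooth_near p (A : set 'cV[R]_p) (f : 'cV[R]_p -> R) :=
  exists U : set 'cV[R]_p, [/\ open U, A `<=` U,
    forall x, U x -> differentiable f x &
    forall j x, U x -> {for x, continuous (partial j f)}].

(* Smoothness of a function of which only the values on A matter (A may be
   closed): it is the restriction of a C^1 function defined around A. *)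
Definition smooth_on p (A : set 'cV[R]_p) (f : 'cV[R]_p -> R) :=
  exists2 g, smooth_near A g & forall x, A x -> f x = g x.

Definition boundary p (A : set 'cV[R]_p) := closure A `\` interior A.

Definition unit_cube k : set 'cV[R]_k := [set u | forall i, 0 <= u i 0 <= 1].

Definition open_unit_cube k : set 'cV[R]_k :=
  [set u | forall i, 0 < u i 0 < 1].

(* A C^1 image of the closed (p-1)-cube; the parametrization is a regular
   (injective, full rank) one on the open cube, and may degenerate on its
   faces, as polar coordinates do. *)
Definition smooth_patch p (S : set 'cV[R]_p) :=
  exists phi : 'cV[R]_p.-1 -> 'cV[R]_p,
  [/\ forall i, smooth_near (@unit_cube p.-1) (fun u => phi u i 0),
      {in @open_unit_cube p.-1 &, injective phi},
      forall u, open_unit_cube u -> \rank (jacobian_cV phi u) = p.-1 &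
      S = phi @` @unit_cube p.-1].

Definition piecewise_smooth p (S : set 'cV[R]_p) :=
  exists m (F : 'I_m -> set 'cV[R]_p),
    (forall k, smooth_patch (F k)) /\ S = \bigcup_(k in [set: 'I_m]) F k.

End smoothness.

Section matrix_order.
Context {R : realType}.

Definition posdefmx n (A : 'M[R]_n) :=
  A^T = A /\ forall v : 'cV[R]_n, v != 0 -> 0 < (v^T *m A *m v) 0 0.

(* [0 <= z] in R[i] means that z is real and non-negative. *)
Definition psdmx n (A : 'M[R[i]]_n) :=
  A \is hermsymmx /\ forall v : 'cV[R[i]]_n, 0 <= (v^t* *m A *m v) 0 0.

Definition density_mx n (rho : 'M[R[i]]_n) := psdmx rho /\ \tr rho = 1.

End matrix_order.

Section measurements.

(* Convergence of the series in povm_additive is entrywise, for the real and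
   the imaginary parts. *)
Record povm (R : realType) d (X : measurableType d) (n : nat) := Povm {
  povm_val :> set X -> 'M[R[i]]_n ;
  povm_psd : forall B, measurable B -> psdmx (povm_val B) ;
  povm_setT : povm_val setT = 1%:M ;
  povm_additive : forall F : (set X)^nat,
    (forall k, measurable (F k)) -> trivIset setT F -> forall i j,
    (fun m => \sum_(0 <= k < m) complex.Re (povm_val (F k) i j)) @ \oo
      --> complex.Re (povm_val (\bigcup_k F k) i j) /\
    (fun m => \sum_(0 <= k < m) complex.Im (povm_val (F k) i j)) @ \oo
      --> complex.Im (povm_val (\bigcup_k F k) i j) }.

Context {R : realType} {d : measure_display} {X : measurableType d}.

(* The trace is real, and this set function is a probability measure, when
   sigma is a density matrix. *)
Definition outcome_law n (sigma : 'M[R[i]]_n) (M : povm R X n) (B : set X) :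
    \bar R :=
  (complex.Re (\tr (sigma *m M B)))%:E.

Definition mse_mx q (P : set X -> \bar R) (est : X -> 'cV[R]_q)
    (target : 'cV[R]_q) : 'M[R]_q :=
  \matrix_(i, j) fine (\int[P]_x
    (((est x - target) *m (est x - target)^T) i j)%:E).

(* trace (W V), V the mean square error matrix.  For positive-definite W this
   is +oo as soon as one of the coordinates has infinite mean square error. *)
Definition weighted_mse q (W : 'M[R]_q) (P : set X -> \bar R)
    (est : X -> 'cV[R]_q) (target : 'cV[R]_q) : \bar R :=
  if `[< forall i, (\int[P]_x (((est x - target) i 0) ^+ 2)%:E < +oo)%E >]
  then (\tr (W *m mse_mx P est target))%:E else +oo%E.

End measurements.

Section holevo.
Context {R : realType} {d p : nat}.
Variables (rho : 'cV[R]_p -> 'M[R[i]]_d).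

Definition smooth_model (Theta : set 'cV[R]_p) :=
  (forall theta, Theta theta -> density_mx (rho theta)) /\
  forall k l, smooth_near Theta (fun t => complex.Re (rho t k l)) /\
              smooth_near Theta (fun t => complex.Im (rho t k l)).

(* For self-adjoint rho t and X j the trace is real. *)
Definition locally_unbiased (X : 'I_p -> 'M[R[i]]_d) (theta : 'cV[R]_p) :=
  (forall j, X j \is hermsymmx) /\
  forall i j,
    partial i (fun t => complex.Re (\tr (rho t *m X j))) theta = (i == j)%:R.

Definition holevo_Z (X : 'I_p -> 'M[R[i]]_d) (theta : 'cV[R]_p) :
    'M[R[i]]_p :=
  \matrix_(i, j) \tr (rho theta *m X i *m X j).

Definition holevo_bound (G : 'M[R]_p) (theta : 'cV[R]_p) : \bar R :=
  ereal_inf [set c | exists X (V : 'M[R]_p),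
    [/\ locally_unbiased X theta, V^T = V,
        psdmx (map_mx (real_complex R) V - holevo_Z X theta) &
        c = (\tr (G *m V))%:E]].

Definition holevo_set (theta : 'cV[R]_p) : set 'M[R]_p :=
  [set V | posdefmx V /\
     forall G, posdefmx G -> (holevo_bound G theta <= (\tr (G *m V))%:E)%E].

(* "The" element of holevo_set achieving equality in direction G. *)
Definition holevo_argmin (G : 'M[R]_p) (theta : 'cV[R]_p) : 'M[R]_p :=
  get [set V | holevo_set theta V /\ (\tr (G *m V))%:E = holevo_bound G theta].

End holevo.

Section bayes.
Context {R : realType} {d p q : nat}.
Variables (Theta0 : set 'cV[R]_p) (prior : 'cV[R]_p -> R).

Definition prior_mean (f : 'cV[R]_p -> \bar R) : \bar R :=
  (\int[lebesgue_cV p]_(theta in Theta0) (f theta * (prior theta)%:E))%E.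

Definition smooth_prior :=
  [/\ smooth_on Theta0 prior, forall theta, Theta0 theta -> 0 <= prior theta,
      prior_mean (fun=> 1%E) = 1%E &
      forall theta, boundary Theta0 theta -> prior theta = 0].

Variables (rho : 'cV[R]_p -> 'M[R[i]]_d) (psi : 'cV[R]_p -> 'cV[R]_q).
Variable Gt : 'cV[R]_p -> 'M[R]_q.

Definition G0 (theta : 'cV[R]_p) : 'M[R]_p :=
  (jacobian_cV psi theta)^T *m Gt theta *m jacobian_cV psi theta.

Definition Cmx (theta : 'cV[R]_p) : 'M[R]_(q, p) :=
  Gt theta *m jacobian_cV psi theta *m holevo_argmin rho (G0 theta) theta.

Definition div_Cprior (theta : 'cV[R]_p) : 'cV[R]_q :=
  \col_i \sum_j partial j (fun t => Cmx t i j * prior t) theta.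

(* Only points of Theta0 with prior > 0 contribute.  When the prior is zero on
   the boundary these lie in the interior of Theta0, so that neither the values
   outside Theta0 nor those where x / 0 = 0 play a role. *)
Definition J_prior : \bar R :=
  prior_mean (fun theta =>
    (((div_Cprior theta)^T *m invmx (Gt theta) *m div_Cprior theta) 0 0
       / prior theta ^+ 2)%:E).

Definition bayes_risk n disp (X : measurableType disp) (M : povm R X (d ^ n))
    (est : X -> 'cV[R]_q) : \bar R :=
  prior_mean (fun theta =>
    weighted_mse (Gt theta) (outcome_law (ntensmx (rho theta) n) M) est (psi theta)).

End bayes.

(* Main.v *)
Require Import Defs.
From HB Require Import structures.
From mathcomp Require Import all_boot all_order all_algebra.
From mathcomp Require Import sesquilinear spectral.
From mathcomp Require Import all_classical all_reals all_analysis.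
From mathcomp Require Import measurable_realfun.
From mathcomp.real_closed Require Import complex mxtens.
From mathcomp Require Import ring lra.

Set Implicit Arguments.
Unset Strict Implicit.
Unset Printing Implicit Defensive.

Import Order.TTheory GRing.Theory Num.Theory.
Import numFieldNormedType.Exports.

Local Open Scope classical_set_scope.
Local Open Scope ring_scope.
Local Open Scope sesquilinear_scope.

Local Notation "x %:C" := (real_complex _ x) (format "x %:C").
Local Notation "A %:CM" := (map_mx (real_complex _) A) (at level 2).

(** Why the bound holds. Let [V0] be the optimal matrix at a parameter where the
    prior is positive, and [C_G] the Holevo bound there.

    Duality. The problem defining [C_G] is convex in the observables and the
    matrix [V], so it has multipliers: a positive complex weight [W] with real part
    [G], and a matrix [L] for the unbiasedness constraints
    ([holevo_multipliers]). Deforming the weight shows that [L = 2 G V0]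
    ([holevo_multiplierE]), and stationarity that there are optimal observables
    [X_j] with
      [sum_j (W_ij rho X_j + W_ji X_j rho) = sum_k L_ik d_k rho]
    and [tr (W Z(X)) <= C_G] ([holevo_kkt]). This is a logarithmic derivative
    equation; it is inherited by [N] copies when the observables are summed over
    the copies, and the covariance is then multiplied by [N]
    ([copies_logderiv], [copies_obs_cov]). The matrix [V0] exists because [C_G] is
    concave and homogeneous in [G]: it is a supergradient, and it is positive
    definite by a Cramer-Rao inequality ([holevo_optimum]).

    The van Trees inequality. A measurement has a density [m], a positive matrix
    for each outcome, relative to a finite measure ([povm_density]). With [u] the
    error of the estimate and [Y_i] the observables lifted along the Jacobian of
    [psi] and shifted by the logarithmic derivative of the prior, the square
      [0 <= sum_ij W_ij tr (rho^N (u_j - Y_j) m (u_i - Y_i))]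
    expands by the equation above into an inequality between [2 u . div (C pi p)],
    where [p] is the likelihood of the outcome, and the loss plus the trace of [m]
    against an operator ([van_trees_op_ineq], [point_ineq]); here [W] stands for a
    weight with real part [G~] that restricts to the multiplier along the Jacobian.
    Integrated over the outcomes and the parameter, that last term is at most the
    information [J] of the prior plus [N] times the mean Holevo bound
    ([van_trees_op_tr]).

    Integration over the parameter. The field [u C pi p] vanishes where the prior
    does, so the divergence term integrates by parts to twice the mean of
    [tr (C^T psi') = C_G] ([integral_partial_eq0], [integral_div_field]). Replacing
    [u] by [N u] and dividing by [N] gives
      [N R >= E C_G - J / N]
    ([van_trees_core]), and the limit follows. *)

(** * Adjoints and positive matrices *)

Section adjoint.
Context {R : realType}.
Local Notation C := R[i].

Lemma dagM m n p (A : 'M[C]_(m, n)) (B : 'M[C]_(n, p)) :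
  (A *m B)^t* = B^t* *m A^t*.
Proof. by rewrite trmx_mul map_mxM. Qed.

Lemma dagD m n (A B : 'M[C]_(m, n)) : (A + B)^t* = A^t* + B^t*.
Proof. by rewrite linearD /= map_mxD. Qed.

Lemma dagN m n (A : 'M[C]_(m, n)) : (- A)^t* = - A^t*.
Proof. by rewrite linearN /= map_mxN. Qed.

Lemma dagZ m n a (A : 'M[C]_(m, n)) : (a *: A)^t* = a^* *: A^t*.
Proof. by rewrite linearZ /= map_mxZ. Qed.

Lemma dag_sum m n (I : Type) (r : seq I) (P : pred I) (F : I -> 'M[C]_(m, n)) :
  (\sum_(i <- r | P i) F i)^t* = \sum_(i <- r | P i) (F i)^t*.
Proof. by rewrite linear_sum raddf_sum. Qed.

Lemma dag_scalar n (a : C) : (a%:M : 'M[C]_n)^t* = (a^*)%:M.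
Proof. by rewrite tr_scalar_mx map_scalar_mx. Qed.

Lemma mxtrace_dag n (A : 'M[C]_n) : \tr (A^t*) = (\tr A)^*.
Proof. by rewrite trace_map_mx mxtrace_tr. Qed.

Lemma hermP n (A : 'M[C]_n) : (A \is hermsymmx) <-> A^t* = A.
Proof.
split=> [h|h].
  by have := is_hermitianmxP _ _ _ h; rewrite expr0 scale1r => {2}->.
by apply/is_hermitianmxP; rewrite expr0 scale1r h.
Qed.

Lemma dag_tens m n p q (A : 'M[C]_(m, n)) (B : 'M[C]_(p, q)) :
  (A *t B)^t* = A^t* *t B^t*.
Proof. by rewrite trmx_tens map_mxT. Qed.

Lemma conj_realC (x : R) : (real_complex R x)^* = real_complex R x.
Proof. exact: conjc_real. Qed.

End adjoint.

Section psd.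
Context {R : realType}.
Local Notation C := R[i].

Lemma psdmxW n (A : 'M[C]_n) : psdmx A -> A^t* = A.
Proof. by case=> /hermP. Qed.

(** The spectral theorem in the form [A = P^* D P], the diagonal [D] being
    read off from the quadratic form of [A] on the columns of [P^*]. *)
Lemma herm_spectral n (A : 'M[C]_n) : A^t* = A ->
  exists (P : 'M[C]_n) (e : 'rV[C]_n),
    [/\ A = P^t* *m diag_mx e *m P, P *m P^t* = 1%:M,
        (forall k, ((row k P) *m A *m (row k P)^t*) 0 0 = e 0 k) &
        (forall k, (e 0 k)^* = e 0 k)].
Proof.
move=> /hermP hA; have nA := hermitian_normalmx hA.
have /orthomx_spectralP := nA.
set P := spectralmx A; set e := spectral_diag A.
have uP : P \is unitarymx by exact: spectral_unitarymx.
rewrite (invmx_unitary uP) => AE; exists P, e.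
have PP : P *m P^t* = 1%:M by apply/unitarymxP.
split=> // k; last first.
  have /mxOverP/(_ 0 k) := hermitian_spectral_diag_real hA.
  by move=> /CrealP.
rewrite AE !mulmxA -row_mul PP row1 -!mulmxA.
rewrite (_ : P *m (row k P)^t* = col k 1%:M); last first.
  rewrite -PP; apply/colP => i; rewrite !mxE; apply: eq_bigr => j _.
  by rewrite !mxE.
rewrite -rowE !mxE (bigD1 k) //= big1 ?addr0.
  by rewrite !mxE !eqxx mulr1n mulr1.
by move=> i /negbTE ik; rewrite !mxE ik mulr0.
Qed.

Lemma psd_row n (A : 'M[C]_n) (v : 'rV[C]_n) : psdmx A ->
  0 <= (v *m A *m v^t*) 0 0.
Proof.
move=> [_ /(_ (v^t*))]; rewrite trmxCK //.
Qed.

(** The factor is [P^* sqrt D], with [P] and [D] from the spectral theorem. *)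
Lemma psd_factor n (A : 'M[C]_n) : psdmx A -> exists B : 'M[C]_n, A = B *m B^t*.
Proof.
move=> pA; have [P [e [AE _ eE er]]] := herm_spectral (psdmxW pA).
have e0 k : 0 <= e 0 k by rewrite -eE; apply: psd_row.
pose s := \row_k sqrtC (e 0 k).
exists (P^t* *m diag_mx s).
rewrite dagM trmxCK AE -!mulmxA; congr (_ *m _); rewrite mulmxA; congr (_ *m _).
rewrite tr_diag_mx map_diag_mx mulmx_diag; congr diag_mx.
apply/rowP => k; rewrite !mxE.
have sE : (sqrtC (e 0 k))^* = sqrtC (e 0 k).
  by apply/CrealP; rewrite ger0_real // sqrtC_ge0.
rewrite /= sE; by rewrite -expr2 sqrtCK.
Qed.

Lemma psd_sandwich m n (A : 'M[C]_n) (B : 'M[C]_(n, m)) :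
  psdmx A -> psdmx (B^t* *m A *m B).
Proof.
move=> pA; split.
  by apply/hermP; rewrite !dagM trmxCK (psdmxW pA) mulmxA.
move=> v; case: pA => _ /(_ (B *m v)).
by rewrite dagM !mulmxA.
Qed.

Lemma psd1 n : psdmx (1%:M : 'M[C]_n).
Proof.
split; first by apply/hermP; rewrite dag_scalar conjC1.
move=> v; rewrite mulmx1 mxE; apply: sumr_ge0 => i _.
by rewrite !mxE mulrC mul_conjC_ge0.
Qed.

Lemma psd_gram m n (B : 'M[C]_(n, m)) : psdmx (B *m B^t*).
Proof. by have := psd_sandwich (B^t*) (psd1 m); rewrite trmxCK mulmx1. Qed.

Lemma psdD n (A B : 'M[C]_n) : psdmx A -> psdmx B -> psdmx (A + B).
Proof.
move=> pA pB; split; first by apply/hermP; rewrite dagD (psdmxW pA) (psdmxW pB).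
by move=> v; rewrite mulmxDr mulmxDl mxE addr_ge0 //; [case: pA|case: pB].
Qed.

Lemma psdZ n (a : C) (A : 'M[C]_n) : 0 <= a -> psdmx A -> psdmx (a *: A).
Proof.
move=> a0 pA; split.
  apply/hermP; rewrite dagZ (psdmxW pA); congr (_ *: _).
  by apply/CrealP; exact: ger0_real.
by move=> v; rewrite -scalemxAr -scalemxAl mxE mulr_ge0 //; case: pA.
Qed.

Lemma psd_tens m n (A : 'M[C]_m) (B : 'M[C]_n) :
  psdmx A -> psdmx B -> psdmx (A *t B).
Proof.
move=> /psd_factor[A' ->] /psd_factor[B' ->].
by rewrite -tensmx_mul -dag_tens; exact: psd_gram.
Qed.

Lemma psd_trM_ge0 n (A B : 'M[C]_n) : psdmx A -> psdmx B -> 0 <= \tr (A *m B).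
Proof.
move=> /psd_factor[F ->] pB; rewrite -mulmxA mxtrace_mulC.
have := psd_sandwich F pB; set D := _ *m F => -[_ pD].
apply: sumr_ge0 => i _; have := pD (delta_mx i 0).
rewrite trmx_delta map_delta_mx -rowE -colE !mxE //.
Qed.

(** The sum of the absolute eigenvalues of [H] exceeds each of them. *)
Lemma herm_le_scalar n (H : 'M[C]_n) : H^t* = H ->
  exists c : R, psdmx ((real_complex R c)%:M - H).
Proof.
move=> hH; have [P [e [HE PP _ er]]] := herm_spectral hH.
have e_real k : e 0 k = real_complex R (complex.Re (e 0 k)).
  by apply/esym/RRe_real/CrealP.
pose c := \sum_k `|complex.Re (e 0 k)|.
exists c; have -> : (real_complex R c)%:M - H =
    P^t* *m diag_mx (\row_k (real_complex R (c - complex.Re (e 0 k)))) *m P.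
  have PP' : P^t* *m P = 1%:M by apply: mulmx1C.
  rewrite HE -[X in X%:M]mulr1 -scale_scalar_mx -PP' scalemxAr -mulmxA -mulmxBr.
  rewrite -mulmxA; congr (_ *m _); rewrite -mul_scalar_mx.
  rewrite -mulmxBl; congr (_ *m _); apply/matrixP => i j; rewrite !mxE.
  by rewrite rmorphB /= -e_real mulrnBl.
apply: psd_sandwich; split.
  apply/hermP; rewrite tr_diag_mx map_diag_mx; congr diag_mx.
  by apply/rowP => k; rewrite !mxE; exact: conj_realC.
move=> v; rewrite mxE; apply: sumr_ge0 => j _.
rewrite mul_mx_diag !mxE -mulrA [_ * v j 0]mulrC mulrA [_^* * _]mulrC.
rewrite mulr_ge0 ?mul_conjC_ge0 //.
rewrite (_ : 0 = real_complex R 0) // lecR subr_ge0 /c (bigD1 j) //=.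
by rewrite (le_trans (ler_norm _)) // lerDl sumr_ge0.
Qed.

End psd.

(** * Several copies of a state *)

Section tensor.
Context {K : comNzRingType}.

Lemma tensmxDl m n p q (A B : 'M[K]_(m, n)) (D : 'M[K]_(p, q)) :
  (A + B) *t D = A *t D + B *t D.
Proof. by apply/matrixP => i j; rewrite !mxE mulrDl. Qed.

Lemma tensmxDr m n p q (A : 'M[K]_(m, n)) (B D : 'M[K]_(p, q)) :
  A *t (B + D) = A *t B + A *t D.
Proof. by apply/matrixP => i j; rewrite !mxE mulrDr. Qed.

Lemma tensmxZl m n p q a (A : 'M[K]_(m, n)) (D : 'M[K]_(p, q)) :
  (a *: A) *t D = a *: (A *t D).
Proof. by apply/matrixP => i j; rewrite !mxE mulrA. Qed.

Lemma tensmxZr m n p q a (A : 'M[K]_(m, n)) (D : 'M[K]_(p, q)) :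
  A *t (a *: D) = a *: (A *t D).
Proof. by apply/matrixP => i j; rewrite !mxE mulrCA. Qed.

Lemma tensmx_suml m n p q (I : Type) (r : seq I) (F : I -> 'M[K]_(m, n))
    (D : 'M[K]_(p, q)) :
  (\sum_(i <- r) F i) *t D = \sum_(i <- r) F i *t D.
Proof.
elim/big_rec2: _ => [|i x y _ <-]; last by rewrite tensmxDl.
exact: tens0mx.
Qed.

Lemma tensmx_sumr m n p q (I : Type) (r : seq I) (A : 'M[K]_(m, n))
    (F : I -> 'M[K]_(p, q)) :
  A *t (\sum_(i <- r) F i) = \sum_(i <- r) A *t F i.
Proof.
elim/big_rec2: _ => [|i x y _ <-]; last by rewrite tensmxDr.
exact: tensmx0.
Qed.

Lemma mxtrace_tens m n (A : 'M[K]_m) (B : 'M[K]_n) :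
  \tr (A *t B) = \tr A * \tr B.
Proof. by rewrite /mxtrace mulr_sum; apply: eq_bigr => i _; rewrite !mxE. Qed.

End tensor.

Section copies.
Context {R : realType} {d p : nat}.
Local Notation C := R[i].

(** For one parameter and [W = 1], [L = 2] this is the equation of the symmetric
    logarithmic derivative. With a general hermitian weight it is the
    stationarity equation of the Holevo bound. *)
Definition logderiv_eq n (W : 'M[C]_p) (L : 'M[R]_p) (sigma : 'M[C]_n)
    (dsigma X : 'I_p -> 'M[C]_n) :=
  forall i, \sum_j (W i j *: (sigma *m X j) + W j i *: (X j *m sigma)) =
            \sum_k (L i k)%:C *: dsigma k.

(** Logarithmic derivatives of a product state add up over its factors, which is
    why each observable is summed over the copies. *)
Fixpoint copies_obs (X : 'I_p -> 'M[C]_d) k : 'I_p -> 'M[C]_(d ^ k.+1) :=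
  if k is k'.+1 return 'I_p -> 'M[C]_(d ^ k.+1)
  then fun i => X i *t 1%:M + 1%:M *t copies_obs X k' i else X.

Fixpoint copies_deriv (rho : 'M[C]_d) (drho : 'I_p -> 'M[C]_d) k :
    'I_p -> 'M[C]_(d ^ k.+1) :=
  if k is k'.+1 return 'I_p -> 'M[C]_(d ^ k.+1)
  then fun i => drho i *t ntensmx_rec rho k' + rho *t copies_deriv rho drho k' i
  else drho.

Variables (rho : 'M[C]_d) (drho X : 'I_p -> 'M[C]_d).

Lemma psd_ntens k : psdmx rho -> psdmx (ntensmx_rec rho k).
Proof. by move=> h; elim: k => //= k IH; exact: psd_tens. Qed.

Lemma mxtrace_ntens k : \tr rho = 1 -> \tr (ntensmx_rec rho k) = 1.
Proof. by move=> h; elim: k => //= k IH; rewrite mxtrace_tens h IH mulr1. Qed.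

Lemma copies_obs_herm k i : (forall i, (X i)^t* = X i) ->
  (copies_obs X k i)^t* = copies_obs X k i.
Proof.
move=> h; elim: k => //= k IH.
by rewrite dagD !dag_tens h IH !dag_scalar conjC1.
Qed.

Lemma copies_obs_centered k i : \tr rho = 1 -> (forall i, \tr (rho *m X i) = 0) ->
  \tr (ntensmx_rec rho k *m copies_obs X k i) = 0.
Proof.
move=> h h0; elim: k => //= k IH.
rewrite mulmxDr !tensmx_mul !mulmx1 mxtraceD !mxtrace_tens h0 IH.
by rewrite mul0r mulr0 addr0.
Qed.

(** The covariance of two different copies is a product of expectations, which
    are zero. *)
Lemma copies_obs_cov k i j : \tr rho = 1 -> (forall i, \tr (rho *m X i) = 0) ->
  \tr (ntensmx_rec rho k *m copies_obs X k i *m copies_obs X k j) =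
  k.+1%:R * \tr (rho *m X i *m X j).
Proof.
move=> h h0; elim: k => [|k IH] /=; first by rewrite mul1r.
rewrite [X in \tr (X *m _)]mulmxDr !tensmx_mul !mulmx1 mulmxDl !mulmxDr.
rewrite !tensmx_mul !mulmx1 !mxtraceD !mxtrace_tens IH !copies_obs_centered // h0 h.
by rewrite !mxtrace_ntens // !(mulr0, mul0r) !mul1r mulr1 addr0 add0r
   -[in RHS]nat1r mulrDl mul1r.
Qed.

(** Both sides obey the Leibniz rule: a factor on which [X j] does not act
    contributes the state of that copy. *)
Lemma copies_logderiv k W L : logderiv_eq W L rho drho X ->
  logderiv_eq W L (ntensmx_rec rho k) (copies_deriv rho drho k) (copies_obs X k).
Proof.
move=> h; elim: k => // k IH i /=.
rewrite (eq_bigr (fun j =>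
    (W i j *: (rho *m X j) + W j i *: (X j *m rho)) *t ntensmx_rec rho k +
    rho *t (W i j *: (ntensmx_rec rho k *m copies_obs X k j) +
            W j i *: (copies_obs X k j *m ntensmx_rec rho k)))); last first.
  move=> j _; rewrite mulmxDr mulmxDl !tensmx_mul !mulmx1 !mul1mx !scalerDr.
  by rewrite addrACA tensmxDl tensmxDr !tensmxZl !tensmxZr.
rewrite big_split /= -tensmx_suml -tensmx_sumr h IH.
under [in RHS]eq_bigr do rewrite scalerDr -tensmxZl -tensmxZr.
by rewrite big_split /= -tensmx_suml -tensmx_sumr.
Qed.

End copies.

(** * The operator form of the van Trees inequality *)

Section operator_inequality.
Context {R : realType} {n : nat}.
Local Notation C := R[i].

(** The sum is [tr (W H)], where [H_ij = tr (sigma A_i m A_j)] is positive because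
    its quadratic form is a trace [tr (sigma (B^* m B))]. *)
Lemma psd_weighted_form q (W : 'M[C]_q) (sigma m : 'M[C]_n) (A : 'I_q -> 'M[C]_n) :
  psdmx W -> psdmx sigma -> psdmx m -> (forall i, (A i)^t* = A i) ->
  0 <= \sum_i \sum_j W i j * \tr (sigma *m A j *m m *m A i).
Proof.
move=> pW ps pm hA.
pose H := \matrix_(i, j) \tr (sigma *m A i *m m *m A j).
have -> : \sum_i \sum_j W i j * \tr (sigma *m A j *m m *m A i) = \tr (W *m H).
  apply: eq_bigr => i _; rewrite mxE; apply: eq_bigr => j _; by rewrite mxE.
apply: (psd_trM_ge0 pW); split.
  apply/hermP/matrixP => i j; rewrite !mxE -mxtrace_dag !dagM !hA.
  by rewrite (psdmxW ps) (psdmxW pm) !mulmxA mxtrace_mulC !mulmxA.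
move=> v; pose B := \sum_j v j 0 *: A j.
have -> : (v^t* *m H *m v) 0 0 = \tr (sigma *m (B^t* *m m *m B)).
  rewrite mxE.
  under eq_bigr do rewrite mxE mulr_suml.
  rewrite /B mulmx_sumr !mulmx_sumr raddf_sum /=; apply: eq_bigr => j _.
  rewrite dag_sum !mulmx_suml !mulmx_sumr raddf_sum /=; apply: eq_bigr => i _.
  rewrite !mxE dagZ hA -scalemxAr -!scalemxAl -!scalemxAr !mxtraceZ.
  by rewrite !mulmxA [LHS]mulrC.
exact: (psd_trM_ge0 ps (psd_sandwich B pm)).
Qed.

(** The cross terms of the square assemble into the left-hand side of the
    logarithmic derivative equation, paired with [m]. *)
Lemma psd_weighted_expand q (W : 'M[C]_q) (sigma m : 'M[C]_n) (Y : 'I_q -> 'M[C]_n)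
    (u : 'I_q -> C) :
  \sum_i \sum_j W i j *
     \tr (sigma *m ((u j)%:M - Y j) *m m *m ((u i)%:M - Y i)) =
  (\sum_i \sum_j W i j * u i * u j) * \tr (sigma *m m) -
  \sum_i u i * \tr ((\sum_j (W i j *: (sigma *m Y j) + W j i *: (Y j *m sigma))) *m m)
  + \sum_i \sum_j W i j * \tr (sigma *m Y j *m m *m Y i).
Proof.
have E i j : \tr (sigma *m ((u j)%:M - Y j) *m m *m ((u i)%:M - Y i)) =
   u i * u j * \tr (sigma *m m) - u i * \tr (sigma *m Y j *m m)
   - u j * \tr (Y i *m sigma *m m) + \tr (sigma *m Y j *m m *m Y i).
  rewrite !mulmxBr !mulmxBl !mul_mx_scalar -!scalemxAl !raddfB /= !mxtraceZ.
  rewrite ?opprK [\tr (sigma *m m *m Y i)]mxtrace_mulC !mulmxA mulrA.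
  by rewrite !addrA.
under eq_bigr do under eq_bigr do rewrite E mulrDr !mulrBr.
under eq_bigr do rewrite big_split /= !sumrB.
rewrite big_split /= !sumrB; congr (_ + _).
rewrite -addrA -opprD; congr (_ - _).
  rewrite mulr_suml; apply: eq_bigr => i _; rewrite mulr_suml.
  by apply: eq_bigr => j _; rewrite !mulrA.
rewrite [X in _ + X]exchange_big /= -big_split /=; apply: eq_bigr => i _.
rewrite mulmx_suml raddf_sum mulr_sumr -big_split /=; apply: eq_bigr => j _.
rewrite mulmxDl mxtraceD mulrDr -!scalemxAl !mxtraceZ.
by congr (_ + _); rewrite mulrCA.
Qed.

End operator_inequality.

Section posdef.
Context {R : realType}.
Local Notation C := R[i].

Lemma posdef_unit n (G : 'M[R]_n) : posdefmx G -> G \in unitmx.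
Proof.
move=> [_ G0]; rewrite -row_free_unit -kermx_eq0.
apply/eqP/eqP; apply: contraT => /rowV0Pn[v /sub_kermxP vG v0].
have := G0 v^T; rewrite trmxK vG mul0mx mxE ltxx.
by rewrite trmx_eq0 v0 => /(_ isT).
Qed.

Lemma posdef_ge0 n (G : 'M[R]_n) (v : 'cV[R]_n) : posdefmx G ->
  0 <= (v^T *m G *m v) 0 0.
Proof.
move=> [_ G0]; have [->|/G0/ltW//] := eqVneq v 0.
by rewrite mulmx0 mxE.
Qed.

Lemma dag_realC m n (A : 'M[R]_(m, n)) : A%:CM^t* = A^T%:CM.
Proof. by apply/matrixP => i j; rewrite !mxE; exact: conj_realC. Qed.

(** A real symmetric form acts on the real and the imaginary part of a
    complex vector separately. *)
Lemma posdef_psdC n (G : 'M[R]_n) : posdefmx G -> psdmx G%:CM.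
Proof.
move=> pG; have [sG _] := pG; split; first by apply/hermP; rewrite dag_realC sG.
move=> v; pose a := map_mx (@complex.Re R) v; pose b := map_mx (@complex.Im R) v.
have -> : (v^t* *m G%:CM *m v) 0 0 =
    real_complex R ((a^T *m G *m a) 0 0 + (b^T *m G *m b) 0 0).
  have vE : v = a%:CM + (Complex 0 1 : C) *: b%:CM.
    by apply/colP => i; rewrite !mxE; case: (v i 0) => x y; simpc.
  have bGa : b^T *m G *m a = a^T *m G *m b.
    have <- : (b^T *m G *m a)^T = b^T *m G *m a.
      by apply/matrixP => i j; rewrite mxE !ord1.
    by rewrite !trmx_mul trmxK sG mulmxA.
  rewrite vE dagD dagZ !dag_realC.
  rewrite !mulmxDl !mulmxDr -!scalemxAl -!scalemxAr -!map_mxM bGa.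
  rewrite (_ : (Complex 0 1 : C)^* = - (Complex 0 1 : C)); last first.
    by apply/eqP; rewrite eq_complex /= oppr0 !eqxx.
  clearbody a b; move: (a^T *m G *m a) (b^T *m G *m b) (a^T *m G *m b) => x y z.
  rewrite !scaleNr addrA addrK scalerA -expr2 sqr_i scaleN1r opprK -map_mxD.
  by rewrite mxE mxE.
by rewrite (_ : 0 = real_complex R 0) // lecR addr_ge0 // posdef_ge0.
Qed.

End posdef.

Section lift.
Context {R : realType} {n p q : nat}.
Local Notation C := R[i].

Variables (W : 'M[C]_p) (L V0 : 'M[R]_p) (Gt : 'M[R]_q) (D : 'M[R]_(q, p)).
Let G := D^T *m Gt *m D.
Let B : 'M[R]_(q, p) := Gt *m D *m invmx G.
Let Q : 'M[R]_q := 1%:M - D *m B^T.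

(** The loss is measured on [R^q] whereas duality yields a weight [W] on [R^p].
    The lifted weight is [W] carried to the range of the Jacobian [D], plus the
    part of [Gt] that vanishes there; its real part is [Gt]. *)
Definition lift_weight : 'M[C]_q := (Q^T *m Gt *m Q)%:CM + B%:CM *m W *m B^T%:CM.

Hypotheses (pGt : posdefmx Gt) (pG : posdefmx G) (pW : psdmx W)
  (hW : W + W^T = 2%:R *: G%:CM) (hL : L = 2%:R *: (G *m V0)).

Lemma lift_BD : B^T *m D = 1%:M.
Proof.
rewrite /B !trmx_mul trmx_inv; have [sG _] := pG; have [sGt _] := pGt.
by rewrite sG sGt -!mulmxA [D^T *m _]mulmxA mulVmx // posdef_unit.
Qed.

Lemma lift_QD : Q *m D = 0.
Proof. by rewrite mulmxBl mul1mx -mulmxA lift_BD mulmx1 subrr. Qed.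

Lemma lift_weight_psd : psdmx lift_weight.
Proof.
apply: psdD.
  rewrite !map_mxM -dag_realC; apply: psd_sandwich; exact: posdef_psdC.
rewrite -[X in X *m _ *m _]trmxCK [in X in _ X]dag_realC; exact: psd_sandwich.
Qed.

Lemma lift_weight_mulD : lift_weight *m D%:CM = B%:CM *m W.
Proof.
rewrite /lift_weight mulmxDl -map_mxM -[Q^T *m Gt *m Q *m D]mulmxA lift_QD.
rewrite mulmx0 map_mx0 add0r.
by rewrite -mulmxA -map_mxM lift_BD map_mx1 mulmx1.
Qed.

Lemma lift_weight_trmulD : lift_weight^T *m D%:CM = B%:CM *m W^T.
Proof.
have [sGt _] := pGt; have hBD := lift_BD; have hQD := lift_QD.
rewrite /lift_weight linearD /= mulmxDl; clearbody Q B.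
rewrite map_trmx -map_mxM !trmx_mul trmxK sGt -!mulmxA hQD !mulmx0 map_mx0.
by rewrite add0r map_trmx map_trmx trmxK -[B^T%:CM *m D%:CM]map_mxM hBD map_mx1 mulmx1.
Qed.

Lemma lift_weight_re : lift_weight + lift_weight^T = 2%:R *: Gt%:CM.
Proof.
have [sGt _] := pGt; have [sG _] := pG.
have E : Gt = Q^T *m Gt *m Q + B *m G *m B^T.
  have GtD : Gt *m D = B *m G by rewrite /B -mulmxA mulVmx ?mulmx1 // posdef_unit.
  have DGt : D^T *m Gt = G *m B^T.
    by rewrite -[LHS]trmxK trmx_mul trmxK sGt GtD trmx_mul sG.
  have -> : Q^T = 1%:M - B *m D^T by rewrite /Q linearB /= trmx1 trmx_mul trmxK.
  rewrite /Q.
  rewrite !(mulmxBl, mulmxBr) !mul1mx !mulmx1.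
  rewrite !mulmxA GtD -[B *m D^T *m Gt]mulmxA DGt mulmxA.
  rewrite -[B *m G *m B^T *m D]mulmxA lift_BD mulmx1.
  by rewrite subrr subr0 addrNK.
have -> : lift_weight^T = (Q^T *m Gt *m Q)%:CM + B%:CM *m W^T *m B^T%:CM.
  rewrite /lift_weight linearD /=; clearbody Q B; congr (_ + _).
    by rewrite map_trmx !trmx_mul trmxK sGt mulmxA.
  by rewrite !trmx_mul !map_trmx trmxK mulmxA.
rewrite /lift_weight addrACA.
rewrite -mulmxDl -mulmxDr hW -mulr2n -scaler_nat.
by rewrite -scalemxAr -scalemxAl -scalerDr -!map_mxM -map_mxD -E.
Qed.

Lemma lift_weight_DD : D^T%:CM *m lift_weight *m D%:CM = W.
Proof.
rewrite -mulmxA lift_weight_mulD mulmxA -map_mxM.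
have -> : D^T *m B = 1%:M by rewrite -[LHS]trmxK trmx_mul trmxK lift_BD trmx1.
by rewrite map_mx1 mul1mx.
Qed.

Lemma lift_BL : B *m L = 2%:R *: (Gt *m D *m V0).
Proof.
by rewrite hL -scalemxAr mulmxA /B -[_ *m invmx G *m G]mulmxA mulVmx ?mulmx1 // posdef_unit.
Qed.

End lift.

Section operator_van_trees.
Context {R : realType} {n p q : nat}.
Local Notation C := R[i].

Lemma Re_realM (x : R) (z : C) : complex.Re (x%:C * z) = x * complex.Re z.
Proof. by case: z => a b /=; rewrite mul0r subr0. Qed.

Lemma quadE (G : 'M[R]_q) (a : 'cV[R]_q) :
  (a^T *m G *m a) 0 0 = \sum_i \sum_j G i j * a i 0 * a j 0.
Proof.
rewrite mxE exchange_big; apply: eq_bigr => j _; rewrite mxE mulr_suml.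
by apply: eq_bigr => i _; rewrite mxE; congr (_ * _); rewrite mulrC.
Qed.

Lemma herm_weight_quad (W : 'M[C]_q) (G : 'M[R]_q) (a : 'cV[R]_q) :
  W + W^T = 2%:R *: G%:CM ->
  \sum_i \sum_j W i j * (a i 0)%:C * (a j 0)%:C = ((a^T *m G *m a) 0 0)%:C.
Proof.
move=> h; apply: (@mulrI _ 2%:R); first by rewrite unitfE pnatr_eq0.
rewrite mulr2n mulrDl mul1r {2}exchange_big -big_split quadE.
rewrite rmorph_sum mulr_sumr; apply: eq_bigr => i _.
rewrite rmorph_sum mulr_sumr -big_split; apply: eq_bigr => j _ /=.
rewrite !rmorphM /= -[LHS]/(_ + _) [X in _ + X]mulrAC -!mulrDl.
have /matrixP/(_ i j) := h; rewrite !mxE => ->.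
by rewrite !mulrA.
Qed.

Variables (W : 'M[C]_p) (L V0 : 'M[R]_p) (Gt : 'M[R]_q) (D : 'M[R]_(q, p)).
Let G := D^T *m Gt *m D.
Hypotheses (pGt : posdefmx Gt) (pG : posdefmx G) (pW : psdmx W)
  (hW : W + W^T = 2%:R *: G%:CM) (hL : L = 2%:R *: (G *m V0)).
Variables (sigma : 'M[C]_n) (dsigma X : 'I_p -> 'M[C]_n).
Hypotheses (psigma : psdmx sigma) (tsigma : \tr sigma = 1)
  (hX : forall i, (X i)^t* = X i) (cX : forall i, \tr (sigma *m X i) = 0)
  (eqX : logderiv_eq W L sigma dsigma X).
Variable w : 'cV[R]_q.

Let Wt := lift_weight W Gt D.
Let a : 'cV[R]_q := invmx Gt *m w.
Let X' (i : 'I_q) := \sum_l (D i l)%:C *: X l.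
(* The optimal observables carried along the Jacobian, shifted by constants
   which account for the derivative of the prior. *)
Let Y (i : 'I_q) := ((a i 0)%:C)%:M + X' i.

Lemma lift_obs_herm i : (Y i)^t* = Y i.
Proof.
rewrite /Y /X' dagD dag_scalar dag_sum conj_realC; congr (_ + _).
by apply: eq_bigr => l _; rewrite dagZ conj_realC hX.
Qed.

(** The lifted observables solve the equation for the lifted weight; its right-hand
    side is the derivative of the state weighted by the prior, [w] being the
    logarithmic derivative contributed by the prior. *)
Lemma lift_logderiv i :
  \sum_j (Wt i j *: (sigma *m Y j) + Wt j i *: (Y j *m sigma)) =
  2%:R *: ((w i 0)%:C *: sigma +
           \sum_k ((Gt *m D *m V0) i k)%:C *: dsigma k).
Proof.
rewrite scalerDr; have WtRe := lift_weight_re pGt pG hW.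
transitivity (\sum_j (Wt i j + Wt j i) *: ((a j 0)%:C *: sigma) +
   \sum_j (Wt i j *: (sigma *m X' j) + Wt j i *: (X' j *m sigma))).
  rewrite -big_split /=; apply: eq_bigr => j _.
  rewrite /Y mulmxDl mulmxDr mul_scalar_mx mul_mx_scalar !scalerDr addrACA.
  by rewrite scalerDl.
congr (_ + _).
  have E j : Wt i j + Wt j i = 2%:R * (Gt i j)%:C.
    by have /matrixP/(_ i j) := WtRe; rewrite !mxE.
  under eq_bigr do rewrite E -scalerA [_%:C *: (_ *: _)]scalerA -rmorphM.
  rewrite -scaler_sumr -scaler_suml -rmorph_sum /=; congr (_ *: (_%:C *: _)).
  have : (Gt *m a) i 0 = w i 0 by rewrite mulKVmx // posdef_unit.
  by rewrite mxE.
transitivity (\sum_l ((Wt *m D%:CM) i l *: (sigma *m X l) +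
                      (Wt^T *m D%:CM) i l *: (X l *m sigma))).
  rewrite [RHS]big_split /= [LHS]big_split /=; congr (_ + _).
    under [RHS]eq_bigr do rewrite mxE scaler_suml.
    rewrite [RHS]exchange_big; apply: eq_bigr => j _.
    rewrite /X' mulmx_sumr scaler_sumr; apply: eq_bigr => l _.
    by rewrite !mxE -scalemxAr scalerA.
  under [RHS]eq_bigr do rewrite mxE scaler_suml.
  rewrite [RHS]exchange_big; apply: eq_bigr => j _.
  rewrite /X' mulmx_suml scaler_sumr; apply: eq_bigr => l _.
  by rewrite !mxE -scalemxAl scalerA.
rewrite /Wt lift_weight_mulD // lift_weight_trmulD //.
set B := Gt *m D *m invmx _.
transitivity (\sum_r (B i r)%:C *: (\sum_k (L r k)%:C *: dsigma k)).
  rewrite [RHS](eq_bigr (fun r => \sum_l ((B i r)%:C * W r l *: (sigma *m X l) +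
       (B i r)%:C * W l r *: (X l *m sigma)))); last first.
    move=> r _; rewrite -eqX scaler_sumr; apply: eq_bigr => l _.
    by rewrite scalerDr !scalerA.
  rewrite exchange_big; apply: eq_bigr => l _; rewrite big_split /=.
  rewrite !mxE !scaler_suml; congr (_ + _);
    by apply: eq_bigr => r _; rewrite !mxE.
under eq_bigr do rewrite scaler_sumr.
rewrite exchange_big scaler_sumr; apply: eq_bigr => k _.
under eq_bigr do rewrite scalerA -rmorphM.
rewrite -scaler_suml -rmorph_sum /= scalerA.
have /matrixP/(_ i k) := lift_BL pG hL; rewrite -/B !mxE => ->.
by rewrite rmorphM /= rmorph_nat.
Qed.

(** The quadratic term of the expanded square, as an operator to be paired with
    the density of the outcome. *)
Definition van_trees_op : 'M[C]_n := \sum_i \sum_j Wt i j *: (Y i *m sigma *m Y j).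

Lemma van_trees_op_trM m : \tr (van_trees_op *m m) =
  \sum_i \sum_j Wt i j * \tr (sigma *m Y j *m m *m Y i).
Proof.
rewrite /van_trees_op mulmx_suml raddf_sum; apply: eq_bigr => i _.
rewrite mulmx_suml raddf_sum; apply: eq_bigr => j _ /=.
by rewrite -scalemxAl mxtraceZ [in RHS]mxtrace_mulC !mulmxA.
Qed.

(** Expansion of [0 <= sum_ij W_ij tr (sigma (u_j - Y_j) m (u_i - Y_i))]. It holds
    for each outcome, with [m] the density of the measurement and [u] the error of
    the estimate there. *)
Lemma van_trees_op_ineq (u : 'cV[R]_q) (m : 'M[C]_n) : psdmx m ->
  2%:R * \sum_i u i 0 * (w i 0 * complex.Re (\tr (sigma *m m)) +
     \sum_k (Gt *m D *m V0) i k * complex.Re (\tr (dsigma k *m m))) <=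
  (u^T *m Gt *m u) 0 0 * complex.Re (\tr (sigma *m m)) +
    complex.Re (\tr (van_trees_op *m m)).
Proof.
move=> pm; have WtRe := lift_weight_re pGt pG hW.
have pWt : psdmx Wt by exact: lift_weight_psd.
have := @psd_weighted_form R n q Wt sigma m (fun i => ((u i 0)%:C)%:M - Y i)
  pWt psigma pm.
have hA i : (((u i 0)%:C)%:M - Y i)^t* = ((u i 0)%:C)%:M - Y i.
  by rewrite dagD dagN dag_scalar conj_realC lift_obs_herm.
move=> /(_ hA).
rewrite (psd_weighted_expand Wt sigma m Y (fun i => (u i 0)%:C)).
rewrite (herm_weight_quad u WtRe) -van_trees_op_trM.
rewrite lecE => /andP[_]; rewrite raddfD raddfB /=.
set s := complex.Re (\sum_i (u i 0)%:C * _).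
have -> : s = 2%:R * \sum_i u i 0 *
    (w i 0 * complex.Re (\tr (sigma *m m)) +
     \sum_k (Gt *m D *m V0) i k * complex.Re (\tr (dsigma k *m m))).
  rewrite /s raddf_sum mulr_sumr; apply: eq_bigr => i _.
  rewrite lift_logderiv -scalemxAl mxtraceZ mulrCA.
  rewrite -[2%:R in LHS](rmorph_nat (real_complex R)) [LHS]Re_realM Re_realM.
  congr (_ * (_ * _)); rewrite mulmxDl mxtraceD raddfD /=; congr (_ + _).
    by rewrite -scalemxAl mxtraceZ Re_realM.
  rewrite mulmx_suml [\tr _]raddf_sum [LHS]raddf_sum; apply: eq_bigr => k _ /=.
  by rewrite -scalemxAl mxtraceZ Re_realM.
by rewrite Re_realM addrAC subr_ge0.
Qed.

(** The observables being centred, the constants and the observables contribute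
    separately. *)
Lemma van_trees_op_tr : \tr van_trees_op =
  ((w^T *m invmx Gt *m w) 0 0)%:C + \sum_i \sum_j W i j * \tr (sigma *m X j *m X i).
Proof.
have WtRe := lift_weight_re pGt pG hW.
have := van_trees_op_trM 1%:M; rewrite mulmx1 => ->.
transitivity (\sum_i \sum_j (Wt i j * (a i 0)%:C * (a j 0)%:C +
                              Wt i j * \tr (sigma *m X' j *m X' i))).
  apply: eq_bigr => i _; apply: eq_bigr => j _; rewrite mulmx1.
  have cX' k : \tr (sigma *m X' k) = 0.
    rewrite /X' mulmx_sumr raddf_sum big1 // => l _ /=.
    by rewrite -scalemxAr mxtraceZ cX mulr0.
  rewrite /Y [sigma *m (_ + _)]mulmxDr mulmxDl !mulmxDr !mul_mx_scalar.
  rewrite -!scalemxAl !mxtraceD !mxtraceZ tsigma !cX' !mulr0 addr0 add0r mulr1.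
  by rewrite mulrDr mulrA.
under eq_bigr do rewrite big_split.
rewrite big_split; congr (_ + _).
  rewrite (herm_weight_quad a WtRe) /a trmx_mul trmx_inv.
  have [-> _] := pGt.
  by rewrite -mulmxA mulKVmx ?mulmxA // posdef_unit.
transitivity (\sum_l \sum_r (D%:CM^T *m Wt *m D%:CM) l r * \tr (sigma *m X r *m X l)).
  under [RHS]eq_bigr do under eq_bigr do rewrite mxE mulr_suml.
  under [RHS]eq_bigr do rewrite exchange_big.
  rewrite [RHS]exchange_big.
  rewrite exchange_big /=; apply: eq_bigr => j _.
  under [RHS]eq_bigr do under eq_bigr do rewrite mxE !mulr_suml.
  under [RHS]eq_bigr do rewrite exchange_big.
  rewrite [RHS]exchange_big /=; apply: eq_bigr => i _.
  rewrite /X' mulmx_sumr raddf_sum mulr_sumr; apply: eq_bigr => l _ /=.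
  rewrite -scalemxAr mxtraceZ mulmx_sumr mulmx_suml raddf_sum !mulr_sumr.
  apply: eq_bigr => r _ /=; rewrite -scalemxAr -scalemxAl mxtraceZ.
  have -> : D%:CM^T l i = (D i l)%:C by rewrite !mxE.
  have -> : D%:CM j r = (D j r)%:C by rewrite !mxE.
  by rewrite mulrCA !mulrA.
by have := lift_weight_DD W pGt pG; rewrite map_trmx => ->.
Qed.

End operator_van_trees.

(** * Subgradients and solvability of symmetric systems *)

Section subgradient.
Context {R : realType}.

Let dot n (x l : 'rV[R]_n) := \sum_i x 0 i * l 0 i.

Let dotD n (x y l : 'rV[R]_n) : dot (x + y) l = dot x l + dot y l.
Proof. by rewrite -big_split; apply: eq_bigr => i _; rewrite mxE mulrDl. Qed.

Let dotZ n a (x l : 'rV[R]_n) : dot (a *: x) l = a * dot x l.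
Proof. by rewrite mulr_sumr; apply: eq_bigr => i _; rewrite mxE mulrA. Qed.

Let row_mx_comb n (a b : R) (x x' : 'rV[R]_1) (y y' : 'rV[R]_n) :
  a *: (row_mx x y : 'rV_n.+1) + b *: (row_mx x' y' : 'rV_n.+1) =
  row_mx (a *: x + b *: x') (a *: y + b *: y').
Proof.
by apply/rowP => i; rewrite !mxE; case: (@fintype.split 1 n i) => j; rewrite !mxE.
Qed.

Definition convex_on_rV n (f : 'rV[R]_n -> R) := forall x y a, 0 <= a <= 1 ->
  f (a *: x + (1 - a) *: y) <= a * f x + (1 - a) * f y.

(** The extension step of the Hahn-Banach theorem: the slopes of [f] minus the
    given functional are larger on the right of the hyperplane than on its
    left, so that some slope lies between. *)
Lemma subgradient_step n (f : 'rV[R]_n.+1 -> R) (l : 'rV[R]_n) :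
  convex_on_rV f ->
  (forall y, f 0 + dot y l <= f (row_mx (0 : 'rV_1) y)) ->
  exists a, forall t y, f 0 + t * a + dot y l <= f (row_mx (t%:M : 'rV_1) y).
Proof.
move=> cf fl; pose g t y := f (row_mx (t%:M : 'rV_1) y) - f 0 - dot y l.
have lr s t y z : 0 < s -> 0 < t -> - (g (- s) y / s) <= g t z / t.
  move=> s0 t0; have st0 : 0 < s + t by rewrite addr_gt0.
  pose a := t / (s + t).
  have a1 : 1 - a = s / (s + t).
    by rewrite -(divff (lt0r_neq0 st0)) -mulrBl addrK.
  have a01 : 0 <= a <= 1.
    apply/andP; split; first by rewrite divr_ge0 // ltW.
    by rewrite -subr_ge0 a1 divr_ge0 // ltW.
  have := cf (row_mx ((- s)%:M : 'rV_1) y) (row_mx (t%:M : 'rV_1) z) a a01.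
  rewrite row_mx_comb !scale_scalar_mx -raddfD /=.
  have -> : a * - s + (1 - a) * t = 0 by rewrite a1 /a; ring.
  rewrite raddf0 => /(le_trans (fl _)); rewrite dotD !dotZ => H.
  have H2 : 0 <= a * g (- s) y + (1 - a) * g t z.
    rewrite /g -subr_ge0 in H *; rewrite (le_trans H) // le_eqVlt.
    by apply/orP; left; apply/eqP; ring.
  rewrite -subr_ge0 opprK.
  have -> : g t z / t + g (- s) y / s =
      (a * g (- s) y + (1 - a) * g t z) * ((s + t) / (s * t)).
    rewrite a1 /a; field; rewrite ?lt0r_neq0 //.
  by rewrite mulr_ge0 // divr_ge0 // ?ltW // mulr_gt0.
pose A := [set x | exists s y, 0 < s /\ x = - (g (- s) y / s)].
have A0 : A !=set0 by exists (- (g (-1) 0 / 1)), 1, 0.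
have uA t z : 0 < t -> ubound A (g t z / t).
  by move=> t0 x [s [y [s0 ->]]]; exact: lr.
have sA : has_sup A by split => //; exists (g 1 0 / 1); apply: uA.
exists (sup A) => t y.
suff : t * sup A <= g t y by rewrite /g; lra.
have [t0|t0|->] := ltgtP t 0.
- have : A (- (g (- - t) y / - t)) by exists (- t), y; rewrite oppr_gt0.
  move=> /(ub_le_sup (proj2 sA)); rewrite opprK => H.
  have := ler_wnM2l (ltW t0) H.
  suff -> : t * - (g t y / - t) = g t y by [].
  by rewrite invrN !mulrN opprK mulrC divfK // lt_eqF.
- have := ge_sup A0 (uA t y t0) => H.
  have := ler_wpM2l (ltW t0) H.
  suff -> : t * (g t y / t) = g t y by [].
  by field; rewrite lt0r_neq0.
- rewrite mul0r /g raddf0; have := fl y; lra.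
Qed.

Lemma subgradient n (f : 'rV[R]_n -> R) : convex_on_rV f ->
  exists l : 'rV[R]_n, forall x, f 0 + dot x l <= f x.
Proof.
elim: n f => [|n IH] f cf.
  by exists 0 => x; rewrite /dot big_ord0 addr0 [x]thinmx0.
have [|l fl] := IH (fun y => f (row_mx (0 : 'rV_1) y)).
  move=> x y a a01.
  have := cf (row_mx (0 : 'rV_1) x) (row_mx (0 : 'rV_1) y) a a01.
  by rewrite row_mx_comb !scaler0 addr0.
have [|a fa] := subgradient_step cf (l := l).
  by move=> y; have := fl y; rewrite row_mx0.
exists (row_mx (a%:M : 'rV_1) l) => x.
rewrite -[x](@hsubmxK R 1 1 n x) [@lsubmx R 1 1 n x]mx11_scalar.
have := fa (@lsubmx R 1 1 n x 0 0) (@rsubmx R 1 1 n x).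
move: (@lsubmx R 1 1 n x 0 0) (@rsubmx R 1 1 n x) => t y H.
suff -> : dot (row_mx t%:M y) (row_mx a%:M l) = t * a + dot y l by rewrite addrA.
rewrite /dot (@big_split_ord _ _ _ 1 n) /= big_ord1 /=; congr (_ + _).
  by rewrite !row_mxEl !mxE eqxx !mulr1n.
by apply: eq_bigr => i _; rewrite !row_mxEr.
Qed.

Lemma mxvec_dot m n (A B : 'M[R]_(m, n)) :
  dot (mxvec A) (mxvec B) = \sum_i \sum_j A i j * B i j.
Proof.
rewrite /dot (reindex _ (curry_mxvec_bij _ _)) /= pair_bigA /=.
by apply: eq_bigr => -[i j] _ /=; rewrite !mxvecE.
Qed.

Lemma subgradient_mx m n (f : 'M[R]_(m, n) -> R) :
  (forall x y a, 0 <= a <= 1 ->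
     f (a *: x + (1 - a) *: y) <= a * f x + (1 - a) * f y) ->
  exists L : 'M[R]_(m, n), forall A : 'M[R]_(m, n), f 0 + \sum_i \sum_j A i j * L i j <= f A.
Proof.
move=> cf; have [|l fl] := @subgradient _ (f \o vec_mx).
  by move=> x y a a01 /=; rewrite linearD !linearZ; exact: cf.
exists (vec_mx l) => A; have := fl (mxvec A).
by rewrite -[X in dot _ X]vec_mxK mxvec_dot /= mxvecK raddf0.
Qed.

Lemma subgradient_mx2 m n m' n' (f : 'M[R]_(m, n) -> 'M[R]_(m', n') -> R) :
  (forall x y x' y' a, 0 <= a <= 1 ->
     f (a *: x + (1 - a) *: y) (a *: x' + (1 - a) *: y') <=
     a * f x x' + (1 - a) * f y y') ->
  exists (K : 'M[R]_(m, n)) (L : 'M[R]_(m', n')),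
    forall (A : 'M[R]_(m, n)) (B : 'M[R]_(m', n')),
    f 0 0 + \sum_i \sum_j A i j * K i j + \sum_i \sum_j B i j * L i j <= f A B.
Proof.
move=> cf; have [|l fl] := @subgradient _
    (fun x : 'rV_(m * n + m' * n') => f (vec_mx (lsubmx x)) (vec_mx (rsubmx x))).
  by move=> x y a a01 /=; rewrite !linearD !linearZ; exact: cf.
exists (vec_mx (lsubmx l)), (vec_mx (rsubmx l)) => A B.
have := fl (row_mx (mxvec A) (mxvec B)).
rewrite row_mxKl row_mxKr !mxvecK !raddf0 -addrA.
suff -> : dot (row_mx (mxvec A) (mxvec B)) l =
    dot (mxvec A) (lsubmx l) + dot (mxvec B) (rsubmx l).
  by rewrite -(vec_mxK (lsubmx l)) -(vec_mxK (rsubmx l)) !mxvec_dot !vec_mxK.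
rewrite /dot big_split_ord /=; congr (_ + _).
  by apply: eq_bigr => i _; rewrite row_mxEl mxE.
by apply: eq_bigr => i _; rewrite row_mxEr mxE.
Qed.

(** The range of a symmetric matrix is the orthogonal of its kernel. The index
    is any finite type, so that a spanning family of observables can serve. *)
Lemma symmetric_form_range (I : finType) (b : I -> I -> R) (l : I -> R) :
  (forall k m, b k m = b m k) ->
  (forall x, (forall m, \sum_k x k * b k m = 0) -> \sum_k x k * l k = 0) ->
  exists x, forall m, \sum_k x k * b k m = l m.
Proof.
move=> bC rad; pose B := \matrix_(i < #|I|, j < #|I|) b (enum_val i) (enum_val j).
pose lv := \row_(i < #|I|) l (enum_val i).
have enumE (F : I -> R) : \sum_k F k = \sum_(i < #|I|) F (enum_val i).
  by rewrite (reindex _ (onW_bij _ (@enum_val_bij I))).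
suff /submxP[x xB] : (lv <= B)%MS.
  exists (fun k => x 0 (enum_rank k)) => m.
  have /rowP/(_ (enum_rank m)) := xB; rewrite !mxE enum_rankK => ->.
  rewrite enumE; apply: eq_bigr => i _; rewrite enum_valK mxE enum_rankK //.
rewrite submxE; apply/eqP/rowP => j; rewrite mxE [RHS]mxE.
have := rad (fun k => cokermx B (enum_rank k) j) _.
rewrite enumE => H; rewrite -[RHS]H; first last.
  move=> m; have /matrixP/(_ (enum_rank m) j) := mulmx_coker B.
  rewrite !mxE enumE => {2}<-; apply: eq_bigr => i _.
  by rewrite enum_valK [B _ _]mxE enum_rankK mulrC bC.
by apply: eq_bigr => i _; rewrite mxE enum_valK mulrC.
Qed.

End subgradient.

(** * Duality for the Holevo bound *)

Section real_trace.
Context {R : realType}.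
Local Notation C := R[i].

(** The traces of interest are real; the real part is taken so as to compute
    with them in [R]. *)
Definition rtr n (A : 'M[C]_n) : R := complex.Re (\tr A).

Lemma rtrD n (A B : 'M[C]_n) : rtr (A + B) = rtr A + rtr B.
Proof. by rewrite /rtr mxtraceD raddfD. Qed.

Lemma rtrZ n (a : R) (A : 'M[C]_n) : rtr (a%:C *: A) = a * rtr A.
Proof. by rewrite /rtr mxtraceZ Re_realM. Qed.

Lemma rtr0 n : rtr (0 : 'M[C]_n) = 0.
Proof. by rewrite /rtr mxtrace0. Qed.

Lemma rtr_sum n (I : Type) (r : seq I) (F : I -> 'M[C]_n) :
  rtr (\sum_(i <- r) F i) = \sum_(i <- r) rtr (F i).
Proof. by rewrite /rtr [\tr _]raddf_sum [LHS]raddf_sum. Qed.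

Lemma rtr_mulC m n (A : 'M[C]_(m, n)) B : rtr (A *m B) = rtr (B *m A).
Proof. by rewrite /rtr mxtrace_mulC. Qed.

Lemma rtr_dag n (A : 'M[C]_n) : rtr (A^t*) = rtr A.
Proof. by rewrite /rtr mxtrace_dag; case: (\tr A). Qed.

Lemma rtr_psd_ge0 n (A B : 'M[C]_n) : psdmx A -> psdmx B -> 0 <= rtr (A *m B).
Proof. by move=> pA pB; have := psd_trM_ge0 pA pB; rewrite lecE => /andP[]. Qed.

Lemma rtr_gram_eq0 m n (F : 'M[C]_(m, n)) : rtr (F *m F^t*) = 0 -> F = 0.
Proof.
move=> h.
have hs : \sum_i \sum_j (complex.Re (F i j) ^+ 2 + complex.Im (F i j) ^+ 2) = 0.
  rewrite -[RHS]h /rtr /mxtrace raddf_sum; apply: eq_bigr => i _ /=.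
  rewrite mxE raddf_sum; apply: eq_bigr => j _ /=.
  by rewrite !mxE; case: (F i j) => a b /=; rewrite mulrN opprK !expr2.
have ge0 i j : 0 <= complex.Re (F i j) ^+ 2 + complex.Im (F i j) ^+ 2.
  by rewrite addr_ge0// sqr_ge0.
apply/matrixP => i j; rewrite [RHS]mxE.
have hi : \sum_j (complex.Re (F i j) ^+ 2 + complex.Im (F i j) ^+ 2) = 0.
  by apply: (psumr_eq0P _ hs) => // k _; apply: sumr_ge0 => l _; exact: ge0.
have /eqP : complex.Re (F i j) ^+ 2 + complex.Im (F i j) ^+ 2 = 0.
  by apply: (psumr_eq0P _ hi) => // k _; exact: ge0.
rewrite paddr_eq0 ?sqr_ge0// !sqrf_eq0 => /andP[/eqP a /eqP b].
by move: a b; case: (F i j) => a b /= -> ->.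
Qed.

End real_trace.

Section holevo_dual.
Context {R : realType} {d p : nat}.
Local Notation C := R[i].

Variables (rho : 'M[C]_d) (drho : 'I_p -> 'M[C]_d).

Lemma convex_comb_le (a e x y m u v : R) : 0 <= a -> 0 <= 1 - a ->
  u < x + e -> v < y + e -> m <= a * u + (1 - a) * v ->
  m <= a * x + (1 - a) * y + e.
Proof.
move=> a0 b0 ux vy /le_trans; apply.
apply: (le_trans (lerD (ler_wpM2l a0 (ltW ux)) (ler_wpM2l b0 (ltW vy)))).
by rewrite !mulrDr addrACA -[X in _ + X]mulrDl [a + _]addrC subrK mul1r.
Qed.

Definition herm_tuple (X : 'I_p -> 'M[C]_d) := forall i, (X i)^t* = X i.

Definition obs_deriv (X : 'I_p -> 'M[C]_d) : 'M[R]_p :=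
  \matrix_(i, j) rtr (drho j *m X i).

Definition obs_cov (X : 'I_p -> 'M[C]_d) : 'M[C]_p :=
  \matrix_(i, j) \tr (rho *m X i *m X j).

Definition mix (T : 'M[R]_p) (X : 'I_p -> 'M[C]_d) i := \sum_l (T i l)%:C *: X l.

Hypothesis prho : psdmx rho.

Lemma mix_herm T X : herm_tuple X -> herm_tuple (mix T X).
Proof.
move=> h i; rewrite /mix dag_sum; apply: eq_bigr => l _.
by rewrite dagZ conj_realC h.
Qed.

Lemma obs_deriv_mix T X : obs_deriv (mix T X) = T *m obs_deriv X.
Proof.
apply/matrixP => i j; rewrite !mxE /mix mulmx_sumr rtr_sum.
by apply: eq_bigr => l _; rewrite -scalemxAr rtrZ mxE.
Qed.

Lemma obs_cov_mix T X : obs_cov (mix T X) = T%:CM *m obs_cov X *m T%:CM^T.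
Proof.
apply/matrixP => i j; rewrite !mxE /mix mulmx_sumr raddf_sum.
apply: eq_bigr => m _ /=; rewrite -scalemxAr mxtraceZ mulmx_sumr mulmx_suml.
rewrite [\tr _]raddf_sum [RHS]mulrC; congr (_ * _); first by rewrite !mxE.
rewrite mxE; apply: eq_bigr => l _ /=.
by rewrite -scalemxAr -scalemxAl mxtraceZ !mxE.
Qed.

Lemma obs_cov_form X (v : 'cV[C]_p) : herm_tuple X ->
  (v^t* *m obs_cov X *m v) 0 0 =
  \tr (rho *m ((\sum_j v j 0 *: X j)^t* *m (\sum_j v j 0 *: X j))).
Proof.
move=> hX; rewrite mxE mulmx_sumr mulmx_sumr raddf_sum /=.
apply: eq_bigr => j _; rewrite mxE dag_sum !mulmx_suml mulmx_sumr raddf_sum mulr_suml.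
apply: eq_bigr => i _ /=; rewrite dagZ hX !mxE -scalemxAr -!scalemxAl -!scalemxAr.
by rewrite !mxtraceZ !mulmxA mulrC.
Qed.

Lemma obs_cov_psd X : herm_tuple X -> psdmx (obs_cov X).
Proof.
move=> hX; split.
  apply/hermP/matrixP => i j; rewrite !mxE -mxtrace_dag !dagM !hX (psdmxW prho).
  by rewrite mulmxA mxtrace_mulC mulmxA.
move=> v; rewrite obs_cov_form //; apply: (psd_trM_ge0 prho).
by set B := \sum_j _; rewrite -{2}(trmxCK B); exact: psd_gram.
Qed.

(** Convexity of the covariance: the defect is a covariance again. *)
Lemma obs_cov_convex (X Y : 'I_p -> 'M[C]_d) (a : R) :
  obs_cov (fun i => a%:C *: X i + (1 - a)%:C *: Y i) =
  a%:C *: obs_cov X + (1 - a)%:C *: obs_cov Y -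
  (a * (1 - a))%:C *: obs_cov (fun i => X i - Y i).
Proof.
pose f (A B : 'M[C]_d) := \tr (rho *m A *m B).
have fDl A B D : f (A + B) D = f A D + f B D by rewrite /f mulmxDr mulmxDl mxtraceD.
have fDr A B D : f D (A + B) = f D A + f D B by rewrite /f mulmxDr mxtraceD.
have fZl c A B : f (c *: A) B = c * f A B.
  by rewrite /f -scalemxAr -scalemxAl mxtraceZ.
have fZr c A B : f A (c *: B) = c * f A B by rewrite /f -scalemxAr mxtraceZ.
apply/matrixP => i j; rewrite !mxE -!/(f _ _); clearbody f.
rewrite -(scaleN1r (Y i)) -(scaleN1r (Y j)) !(fDl, fDr, fZl, fZr).
by rewrite rmorphM rmorphB rmorph1; ring.
Qed.

(** The values of the minimization problem under perturbed constraints: [B]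
    perturbs the derivatives of the expectations, and [A] the matrix inequality.
    Real [V] absorbs symmetric perturbations, so only the skew part of [A]
    appears. At [A = 0], [B = 0] the infimum is the Holevo bound. *)
Definition holevo_values (G A B : 'M[R]_p) : set R :=
  [set c | exists X (V : 'M[R]_p), [/\ herm_tuple X, obs_deriv X = 1%:M + B,
     V^T = V, psdmx (V%:CM + (Complex 0 1 : C) *: (A - A^T)%:CM - obs_cov X) &
     c = \tr (G *m V)]].

Definition holevo_inf G := inf (holevo_values G 0 0).

Hypothesis feasible : exists X, herm_tuple X /\ obs_deriv X = 1%:M.

Lemma iskew_herm (A : 'M[R]_p) :
  ((Complex 0 1 : C) *: (A - A^T)%:CM)^t* = (Complex 0 1 : C) *: (A - A^T)%:CM.
Proof.
apply/matrixP => i j; rewrite !mxE /=; simpc.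
by [].
Qed.

Lemma tr_realM n (A B : 'M[R]_n) : \tr (A%:CM *m B%:CM) = (\tr (A *m B))%:C.
Proof. by rewrite -map_mxM trace_map_mx. Qed.

(** Only the real part of a hermitian weight is seen by a real symmetric
    matrix. *)
Lemma rtr_weight_real n (W : 'M[C]_n) (G V : 'M[R]_n) :
  W + W^T = 2%:R *: G%:CM -> V^T = V -> rtr (W *m V%:CM) = \tr (G *m V).
Proof.
move=> hW sV; apply: (@mulrI _ 2%:R); first by rewrite unitfE pnatr_eq0.
rewrite mulr2n mulrDl mul1r -{2}rtr_dag.
have -> : rtr ((W *m V%:CM)^t*) = rtr (W^T *m V%:CM).
  rewrite /rtr mxtrace_dag -[\tr (W *m _)]mxtrace_tr trmx_mul mxtrace_mulC.
  by rewrite map_trmx sV; case: (\tr _).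
by rewrite -rtrD -mulmxDl hW -scalemxAl -(rmorph_nat (real_complex R)) rtrZ
   /rtr tr_realM.
Qed.

Lemma holevo_values_ge0 G A B c : posdefmx G -> holevo_values G A B c -> 0 <= c.
Proof.
move=> pG [X [V [hX _ sV pV ->]]].
have pVA : psdmx (V%:CM + (Complex 0 1 : C) *: (A - A^T)%:CM).
  rewrite -[X in psdmx X](subrK (obs_cov X)).
  exact: (psdD pV (obs_cov_psd hX)).
have [sG _] := pG.
have := rtr_psd_ge0 (posdef_psdC pG) pVA; rewrite mulmxDr rtrD.
have -> : rtr (G%:CM *m V%:CM) = \tr (G *m V).
  by rewrite /rtr tr_realM.
suff -> : rtr (G%:CM *m ((Complex 0 1 : C) *: (A - A^T)%:CM)) = 0 by rewrite addr0.
by rewrite -scalemxAr /rtr mxtraceZ tr_realM /= mul0r mul1r oppr0 addr0.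
Qed.

Lemma holevo_values_nonempty G A B : holevo_values G A B !=set0.
Proof.
have [X [hX uX]] := feasible.
pose Y := mix (1%:M + B) X.
have hY : herm_tuple Y by exact: mix_herm.
have hH : (obs_cov Y - (Complex 0 1 : C) *: (A - A^T)%:CM)^t* =
    obs_cov Y - (Complex 0 1 : C) *: (A - A^T)%:CM.
  by rewrite dagD dagN iskew_herm (psdmxW (obs_cov_psd hY)).
have [c pc] := herm_le_scalar hH.
exists (\tr (G *m c%:M)), Y, c%:M; split.
- exact: hY.
- by rewrite obs_deriv_mix uX mulmx1.
- by rewrite tr_scalar_mx.
- by rewrite map_scalar_mx; move: pc; rewrite opprB addrA.
- by [].
Qed.

Lemma has_inf_holevo_values G A B : posdefmx G -> has_inf (holevo_values G A B).
Proof.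
move=> pG; split; first exact: holevo_values_nonempty.
by exists 0 => c; exact: holevo_values_ge0.
Qed.

(** The problem is jointly convex in its variables and its perturbations, since
    the covariance is convex. *)
Lemma holevo_values_convex G A B A' B' c c' a : 0 <= a <= 1 ->
  holevo_values G A B c -> holevo_values G A' B' c' ->
  holevo_values G (a *: A + (1 - a) *: A') (a *: B + (1 - a) *: B')
    (a * c + (1 - a) * c').
Proof.
move=> /andP[a0 a1] [X [V [hX uX sV pV ->]]] [X' [V' [hX' uX' sV' pV' ->]]].
exists (fun i => a%:C *: X i + (1 - a)%:C *: X' i), (a *: V + (1 - a) *: V').
split.
- by move=> i; rewrite dagD !dagZ !conj_realC hX hX'.
- have -> : obs_deriv (fun i => a%:C *: X i + (1 - a)%:C *: X' i) =
      a *: obs_deriv X + (1 - a) *: obs_deriv X'.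
    by apply/matrixP => i j; rewrite !mxE mulmxDr -!scalemxAr rtrD !rtrZ.
  rewrite uX uX' !scalerDr addrACA -scalerDl; congr (_ + _).
  by rewrite addrC subrK scale1r.
- by rewrite linearD !linearZ /= sV sV'.
- rewrite obs_cov_convex.
  set D := obs_cov (fun i => X i - X' i).
  have -> : (a *: V + (1 - a) *: V')%:CM + (Complex 0 1 : C) *:
      (a *: A + (1 - a) *: A' - (a *: A + (1 - a) *: A')^T)%:CM -
      (a%:C *: obs_cov X + (1 - a)%:C *: obs_cov X' - (a * (1 - a))%:C *: D) =
    a%:C *: (V%:CM + (Complex 0 1 : C) *: (A - A^T)%:CM - obs_cov X) +
    (1 - a)%:C *: (V'%:CM + (Complex 0 1 : C) *: (A' - A'^T)%:CM - obs_cov X') +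
    (a * (1 - a))%:C *: D.
    move: (obs_cov X) (obs_cov X') D (Complex 0 1 : C) => M M' N ii.
    apply/matrixP => i j; rewrite !mxE.
    by rewrite !(rmorphD, rmorphB, rmorphM, rmorph1, rmorphN) /=; ring.
  apply: psdD; last first.
    apply: psdZ; first by rewrite ler0c mulr_ge0 // subr_ge0.
    by apply: obs_cov_psd => i; rewrite dagD dagN hX hX'.
  by apply: psdD; apply: psdZ; rewrite // ler0c // subr_ge0.
- by rewrite mulmxDr mxtraceD -!scalemxAr !mxtraceZ.
Qed.

Lemma inf_holevo_values_convex G A B A' B' a : posdefmx G -> 0 <= a <= 1 ->
  inf (holevo_values G (a *: A + (1 - a) *: A') (a *: B + (1 - a) *: B')) <=
  a * inf (holevo_values G A B) + (1 - a) * inf (holevo_values G A' B').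
Proof.
move=> pG a01; have /andP[a0 a1] := a01; have b0 : 0 <= 1 - a by rewrite subr_ge0.
apply/ler_addgt0Pr => e e0.
have [c hc ce] := inf_adherent e0 (has_inf_holevo_values A B pG).
have [c' hc' ce'] := inf_adherent e0 (has_inf_holevo_values A' B' pG).
have h : inf (holevo_values G (a *: A + (1 - a) *: A') (a *: B + (1 - a) *: B')) <=
    a * c + (1 - a) * c'.
  apply: ge_inf; last exact: holevo_values_convex.
  by exists 0 => x; exact: holevo_values_ge0.
exact: (convex_comb_le a0 b0 ce ce' h).
Qed.

End holevo_dual.

Section sylvester.
Context {R : realType} {d p : nat}.
Local Notation C := R[i].

(* Real coordinates on tuples of self-adjoint matrices, by the spanning family
   [E_ab + E_ba], [i (E_ab - E_ba)] in each component. *)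
Let I := ('I_p * ('I_d * 'I_d) * bool)%type.

Let he (k : I) : 'M[C]_d := let: (_, (a, b), s) := k in
  if s then (Complex 0 1 : C) *: (delta_mx a b - delta_mx b a)
  else delta_mx a b + delta_mx b a.

Let E (k : I) (i : 'I_p) : 'M[C]_d := if i == k.1.1 then he k else 0.

Let comb (x : I -> R) (i : 'I_p) : 'M[C]_d := \sum_k (x k)%:C *: E k i.

Let he_herm k : (he k)^t* = he k.
Proof.
case: k => [[i [a b]] []] /=.
  rewrite dagZ dagD dagN !trmx_delta !map_delta_mx.
  rewrite (_ : (Complex 0 1 : C)^* = - (Complex 0 1 : C)); last first.
    by apply/eqP; rewrite eq_complex /= oppr0 !eqxx.
  by rewrite scaleNr -scalerN opprB.
by rewrite dagD !trmx_delta !map_delta_mx addrC.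
Qed.

Let comb_herm x : herm_tuple (comb x).
Proof.
move=> i; rewrite /comb dag_sum; apply: eq_bigr => k _; rewrite dagZ conj_realC.
by rewrite /E; case: eqP => _; rewrite ?he_herm // trmx0 map_mx0.
Qed.

Let herm_comb X : herm_tuple X -> exists x, forall i, X i = comb x i.
Proof.
move=> hX; exists (fun k => let: (i, (a, b), s) := k in
  2^-1 * (if s then complex.Im (X i a b) else complex.Re (X i a b))) => i.
have sumE (F : I -> 'M[C]_d) :
    \sum_k F k = \sum_i0 \sum_a \sum_b \sum_s F (i0, (a, b), s).
  transitivity (\sum_i0 \sum_(ab : 'I_d * 'I_d) \sum_s F (i0, ab, s)).
    by rewrite pair_bigA pair_bigA; apply: eq_bigr => -[[i0 ab] s].
  by apply: eq_bigr => i0 _; rewrite [RHS]pair_bigA; apply: eq_bigr => -[a b].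
rewrite /comb sumE (bigD1 i) //= [X in _ + X]big1 ?addr0; last first.
  move=> j ji; rewrite big1 // => a _; rewrite big1 // => b _; rewrite big1 // => s _.
  by rewrite /E /= eq_sym (negbTE ji) scaler0.
transitivity ((2^-1)%:C *: (\sum_a \sum_b (X i a b *: delta_mx a b) +
   \sum_a \sum_b ((X i a b)^* *: delta_mx b a))).
  rewrite -matrix_sum_delta exchange_big /=.
  rewrite [X in _ + X](_ : _ = X i); last first.
    rewrite [RHS]matrix_sum_delta; apply: eq_bigr => a _; apply: eq_bigr => b _.
    by rewrite -{2}(hX i) !mxE.
  rewrite -[X in _ = _ *: (X + X)]scale1r -scalerDl scalerA.
  have -> : (2^-1)%:C * (1 + 1) = 1 :> C; last by rewrite scale1r.
  by rewrite -[1 + 1](rmorph_nat (real_complex R) 2) -rmorphM mulVf ?rmorph1 // pnatr_eq0.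
rewrite -big_split scaler_sumr; apply: eq_bigr => a _ /=.
rewrite -big_split scaler_sumr; apply: eq_bigr => b _ /=.
rewrite big_bool /E /= eqxx !rmorphM -!scalerA -scalerDr; congr (_ *: _).
rewrite scalerA scalerBr scalerDr -scaleNr addrACA -!scalerDl.
by congr (_ *: _ + _ *: _); case: (X i a b) => u v /=; simpc.
Qed.

Variables (rho : 'M[C]_d) (W : 'M[C]_p).
Hypotheses (prho : psdmx rho) (pW : psdmx W).

Let D (X : 'I_p -> 'M[C]_d) i :=
  \sum_j (W i j *: (rho *m X j) + W j i *: (X j *m rho)).

Let bil X Y := \sum_i rtr (Y i *m D X i).

Let D_herm X i : herm_tuple X -> (D X i)^t* = D X i.
Proof.
move=> hX; rewrite /D dag_sum; apply: eq_bigr => j _.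
rewrite dagD !dagZ !dagM hX (psdmxW prho) addrC.
have WE a b : (W a b)^* = W b a by rewrite -{2}(psdmxW pW) !mxE.
by rewrite !WE.
Qed.

Let bilE X Y : bil X Y =
  complex.Re (\sum_i \sum_j (W i j * \tr (rho *m X j *m Y i) +
                             W i j * \tr (rho *m Y j *m X i))).
Proof.
under eq_bigr do rewrite big_split.
rewrite big_split /= [X in _ + X]exchange_big -big_split raddf_sum.
apply: eq_bigr => i _; rewrite /= -big_split /D mulmx_sumr rtr_sum raddf_sum.
apply: eq_bigr => j _ /=; rewrite mulmxDr -!scalemxAr rtrD raddfD /rtr !mxtraceZ.
congr (complex.Re (_ * _) + complex.Re (_ * _)).
  by rewrite mxtrace_mulC.
by rewrite mulmxA mxtrace_mulC mulmxA.
Qed.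

Let bilC X Y : bil X Y = bil Y X.
Proof.
rewrite !bilE; congr complex.Re; apply: eq_bigr => i _; apply: eq_bigr => j _.
by rewrite addrC.
Qed.

Let bil_self X : bil X X = 2%:R * rtr (W *m obs_cov rho X).
Proof.
rewrite bilE mulr2n mulrDl mul1r -raddfD /= -mulr2n.
congr complex.Re; rewrite mulr2n /mxtrace -big_split; apply: eq_bigr => i _ /=.
rewrite mxE -big_split; apply: eq_bigr => j _ /=.
by rewrite !mxE.
Qed.

Lemma sylvester_energy X :
  \sum_i rtr (X i *m \sum_j (W i j *: (rho *m X j) + W j i *: (X j *m rho))) =
  2%:R * rtr (W *m obs_cov rho X).
Proof. exact: bil_self. Qed.

Let bil_combr X y : bil X (comb y) = \sum_k y k * bil X (E k).
Proof.
rewrite /bil; under [RHS]eq_bigr do rewrite mulr_sumr.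
rewrite exchange_big; apply: eq_bigr => i _.
rewrite /comb mulmx_suml rtr_sum; apply: eq_bigr => k _.
by rewrite -scalemxAl rtrZ.
Qed.

Variable L : 'I_p -> 'M[C]_d.
Hypothesis hL : herm_tuple L.
Hypothesis rad : forall X, herm_tuple X -> rtr (W *m obs_cov rho X) = 0 ->
  \sum_i rtr (X i *m L i) = 0.

Let lcomb x : \sum_i rtr (comb x i *m L i) = \sum_k x k * \sum_i rtr (E k i *m L i).
Proof.
under [RHS]eq_bigr do rewrite mulr_sumr.
rewrite exchange_big; apply: eq_bigr => i _.
rewrite /comb mulmx_suml rtr_sum; apply: eq_bigr => k _.
by rewrite -scalemxAl rtrZ.
Qed.

(** The weighted Sylvester equation is the stationarity equation of the form
    [tr (W Z(X))]; it is solvable as soon as its right-hand side vanishes on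
    the radical of the form. *)
Lemma sylvester_solve : exists2 X, herm_tuple X &
  forall i, \sum_j (W i j *: (rho *m X j) + W j i *: (X j *m rho)) = L i.
Proof.
have [||x xE] := @symmetric_form_range R I (fun k m => bil (E k) (E m))
    (fun m => \sum_i rtr (E m i *m L i)).
- by move=> k m; exact: bilC.
- move=> x x0; rewrite -lcomb; apply: rad; first exact: comb_herm.
  have : bil (comb x) (comb x) = 0.
    rewrite bil_combr big1 // => k _; rewrite bilC bil_combr.
    under eq_bigr do rewrite bilC.
    by rewrite x0 mulr0.
  by rewrite bil_self => /eqP; rewrite mulf_eq0 pnatr_eq0 => /eqP.
exists (comb x); first exact: comb_herm.
have key Y : herm_tuple Y -> \sum_i rtr (Y i *m (D (comb x) i - L i)) = 0.
  move=> /herm_comb[y yE].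
  have -> : \sum_i rtr (Y i *m (D (comb x) i - L i)) =
      bil (comb x) (comb y) - \sum_i rtr (comb y i *m L i).
    rewrite /bil -sumrB; apply: eq_bigr => i _.
    by rewrite yE mulmxBr /rtr !raddfB.
  rewrite bil_combr lcomb -sumrB big1 // => k _.
  rewrite -mulrBr -xE; have -> : bil (comb x) (E k) = \sum_m x m * bil (E m) (E k).
    rewrite bilC bil_combr; apply: eq_bigr => m _; by rewrite bilC.
  by rewrite subrr mulr0.
move=> i; apply/eqP; rewrite -subr_eq0; apply/eqP.
pose Y j := if j == i then D (comb x) i - L i else 0.
have hY : herm_tuple Y.
  move=> j; rewrite /Y; case: eqP => _; last by rewrite trmx0 map_mx0.
  by rewrite dagD dagN D_herm ?hL //; exact: comb_herm.
have := key Y hY; rewrite (bigD1 i) //= big1 ?addr0; last first.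
  by move=> j /negbTE ji; rewrite /Y ji mul0mx rtr0.
have := hY i; rewrite /Y eqxx -/(D (comb x) i).
move: (D (comb x) i - L i) => Delta hD H.
by apply: rtr_gram_eq0; rewrite hD.
Qed.

End sylvester.

Section multipliers.
Context {R : realType} {d p : nat}.
Local Notation C := R[i].
Local Notation ii := (Complex 0 1 : C).

Lemma affine_growth (c c' a : R) : (forall t, 0 <= t -> c <= c' + t * a) -> 0 <= a.
Proof.
move=> h; rewrite leNgt; apply/negP => a0.
have t0 : 0 <= (`|c' - c| + 1) / - a.
  by rewrite divr_ge0 ?addr_ge0 // oppr_ge0 ltW.
have := h _ t0.
have -> : (`|c' - c| + 1) / - a * a = - (`|c' - c| + 1).
  by rewrite invrN mulrN mulNr divfK // lt_eqF.
have := ler_norm (c' - c) => h1 h2.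
have h3 : c' - (`|c' - c| + 1) < c.
  by rewrite ltrBlDr -ltrBlDl (le_lt_trans h1) // ltrDl ltr01.
by have := le_lt_trans h2 h3; rewrite ltxx.
Qed.

Lemma affine_bounded_eq0 (c a : R) : (forall t, t * a <= c) -> a = 0.
Proof.
move=> h; apply/eqP; rewrite eq_le; apply/andP; split.
  rewrite -oppr_ge0; apply: (@affine_growth 0 c) => t _.
  by rewrite mulrN subr_ge0.
apply: (@affine_growth 0 c) => t _.
by have := h (- t); rewrite mulNr -subr_ge0 opprK.
Qed.

Lemma first_order_eq (x y k : R) :
  (forall t, t != 0 -> t * x <= t * y + t ^+ 2 * k) -> x = y.
Proof.
move=> h; apply/eqP; rewrite -subr_eq0 -normr_eq0; apply/negPn/negP => n0.
have d0 : 0 < `|x - y| by rewrite lt_neqAle eq_sym n0 normr_ge0.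
pose s := `|x - y| / (2 * (`|k| + 1)).
have k1 : 0 < `|k| + 1 by rewrite ltr_wpDl.
have s0 : 0 < s by rewrite divr_gt0 // mulr_gt0.
have sk : s * k <= `|x - y| / 2.
  rewrite /s invfM mulrA -mulrA -[leRHS]mulr1 ler_wpM2l ?divr_ge0 //.
  rewrite mulrC ler_pdivrMr // mul1r (le_trans (ler_norm _)) // lerDl.
  exact: ler01.
have h1 : x - y <= s * k.
  by have := h s (lt0r_neq0 s0); rewrite expr2 -mulrA -mulrDr ler_pM2l // lerBlDl.
have h2 : - (x - y) <= s * k.
  have := h (- s); rewrite oppr_eq0 lt0r_neq0 // => /(_ isT).
  rewrite sqrrN expr2 -mulrA mulNr mulNr -subr_ge0 => h2.
  by rewrite -subr_ge0 -(pmulr_rge0 _ s0) (le_trans h2) // le_eqVlt;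
     apply/orP; left; apply/eqP; ring.
have : `|x - y| <= s * k by rewrite ler_norml; apply/andP; split => //; lra.
by move: d0 sk; lra.
Qed.

Lemma herm_ReIm n (P : 'M[C]_n) : P^t* = P ->
  let V := map_mx (@complex.Re R) P in
  let A := 2^-1 *: map_mx (@complex.Im R) P in
  [/\ P = V%:CM + ii *: (A - A^T)%:CM, V^T = V & (2%:R *: A)^T = - (2%:R *: A)].
Proof.
move=> hP V A.
have h i j : P i j = (P j i)^* by rewrite -{1}hP !mxE.
have A2 : 2%:R *: A = map_mx (@complex.Im R) P.
  by rewrite scalerA divff ?scale1r // pnatr_eq0.
have AT : (2%:R *: A)^T = - (2%:R *: A).
  by rewrite A2; apply/matrixP => i j; rewrite !mxE h; case: (P i j).
split => //; last first.
  by apply/matrixP => i j; rewrite !mxE h; case: (P i j).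
have -> : A - A^T = map_mx (@complex.Im R) P.
  rewrite -A2; apply: (scalerI (_ : 2%:R != 0 :> R)); first by rewrite pnatr_eq0.
  rewrite scalerBr -[2%:R *: A^T]linearZ /= AT opprK -mulr2n.
  by rewrite !scaler_nat.
by apply/matrixP => i j; rewrite !mxE; case: (P i j) => a b; simpc.
Qed.

Lemma herm_psd n (A : 'M[C]_n) : A^t* = A ->
  (forall v : 'cV[C]_n, 0 <= rtr (A *m (v *m v^t*))) -> psdmx A.
Proof.
move=> hA h; split; first exact/hermP.
move=> v; have := h v; rewrite mulmxA rtr_mulC mulmxA /rtr trace_mx11.
have : ((v^t* *m A *m v) 0 0)^* = (v^t* *m A *m v) 0 0.
  have -> : ((v^t* *m A *m v) 0 0)^* = ((v^t* *m A *m v)^t*) 0 0 by rewrite !mxE.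
  by rewrite !dagM trmxCK hA mulmxA.
case: ((v^t* *m A *m v) 0 0) => a b /eqP; rewrite eq_complex /= => /andP[_ /eqP b0] a0.
by rewrite lecE /= a0 andbT; apply/eqP; lra.
Qed.

Lemma rtr_ReImM n (G S V B : 'M[R]_n) :
  rtr ((G%:CM + ii *: S%:CM) *m (V%:CM + ii *: B%:CM)) =
  \tr (G *m V) - \tr (S *m B).
Proof.
rewrite /rtr /mxtrace raddf_sum -sumrB; apply: eq_bigr => i _ /=.
rewrite !mxE raddf_sum -sumrB; apply: eq_bigr => j _ /=.
by rewrite !mxE /=; ring.
Qed.

(** The multipliers of the constraints in the definition of the Holevo bound,
    obtained as a subgradient of the perturbed optimal value. *)
Lemma holevo_multipliers (rho : 'M[C]_d) (drho : 'I_p -> 'M[C]_d) (G : 'M[R]_p) :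
  psdmx rho -> (exists X, herm_tuple X /\ obs_deriv drho X = 1%:M) -> posdefmx G ->
  exists W (L : 'M[R]_p), [/\ psdmx W, W + W^T = 2%:R *: G%:CM &
    forall X, herm_tuple X -> holevo_inf rho drho G +
      \sum_i \sum_j (obs_deriv drho X - 1%:M) i j * L i j <= rtr (W *m obs_cov rho X)].
Proof.
move=> prho feas pG.
have [K [L KL]] := @subgradient_mx2 R p p p p
  (fun A B => inf (holevo_values rho drho G A B))
  (fun A A' B B' a => @inf_holevo_values_convex R d p rho drho prho feas G A B A' B' a pG).
have infP A B c : holevo_values rho drho G A B c ->
    holevo_inf rho drho G + \sum_i \sum_j A i j * K i j + \sum_i \sum_j B i j * L i j <= c.
  move=> hc; apply: (le_trans (KL A B)); apply: ge_inf hc.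
  by exists 0 => x; exact: (holevo_values_ge0 prho pG).
(* [W] is the weight with [tr (W P) = tr (G Re P) - sum (Im P / 2) K] for every
   hermitian [P], as the perturbation [A = Im P / 2] turns [P] into [Re P]. *)
pose S := - 4^-1 *: (K - K^T); pose W := G%:CM + ii *: S%:CM.
have [sG _] := pG.
have ST : S^T = - S.
  by rewrite /S linearZ /= linearB /= trmxK -scalerN opprB.
have WP (P : 'M[C]_p) : P^t* = P -> rtr (W *m P) =
    \tr (G *m map_mx (@complex.Re R) P) -
    \sum_i \sum_j (2^-1 *: map_mx (@complex.Im R) P) i j * K i j.
  move=> /herm_ReIm /=.
  set V := map_mx _ P; set A := 2^-1 *: _ => -[-> _ AT].
  have AT' i j : A j i = - A i j.
    have /matrixP/(_ i j) := AT; rewrite !mxE => h.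
    by move: h; rewrite -mulrN => /mulfI; apply; rewrite pnatr_eq0.
  clearbody A; rewrite rtr_ReImM; congr (_ - _).
  have -> : \tr (S *m (A - A^T)) = \sum_i \sum_j 2^-1 * (A i j * (K i j - K j i)).
    rewrite /mxtrace exchange_big /=; apply: eq_bigr => i _.
    rewrite mxE; apply: eq_bigr => j _; rewrite !mxE AT'.
    by field.
  rewrite (eq_bigr (fun i => 2^-1 * \sum_j A i j * (K i j - K j i))); last first.
    by move=> i _; rewrite mulr_sumr.
  rewrite -mulr_sumr.
  have -> : \sum_i \sum_j A i j * (K i j - K j i) = 2%:R * \sum_i \sum_j A i j * K i j.
    rewrite mulr2n mulrDl mul1r [X in _ = _ + X]exchange_big -big_split.
    apply: eq_bigr => i _ /=; rewrite -big_split; apply: eq_bigr => j _ /=.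
    by rewrite (AT' i j); ring.
  by rewrite mulrA mulVf ?mul1r // pnatr_eq0.
have hW : W^t* = W.
  rewrite /W dagD dagZ !dag_realC sG ST map_mxN.
  rewrite (_ : ii^* = - ii); last by apply/eqP; rewrite eq_complex /= oppr0 !eqxx.
  by rewrite scalerN scaleNr opprK.
exists W, L; split.
- apply: (herm_psd hW) => v.
  have pP : psdmx (v *m v^t*) by exact: psd_gram.
  have [c0 hc0] := holevo_values_nonempty prho feas G 0 0.
  rewrite WP; last exact: psdmxW pP.
  have [PE VT _] := herm_ReIm (psdmxW pP).
  move: PE VT pP; move: (v *m v^t*) => P.
  set V := map_mx _ P; set A := 2^-1 *: _ => PE VT pP.
  apply: (@affine_growth (holevo_inf rho drho G) c0) => t t0.
  have t0c : 0 <= t%:C by rewrite ler0c.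
  have [X [V0 [hX uX sV pV c0E]]] := hc0.
  have : holevo_values rho drho G (t *: A) 0 (c0 + t * \tr (G *m V)).
    exists X, (V0 + t *: V); split.
    + exact: hX.
    + exact: uX.
    + by rewrite linearD linearZ /= sV VT.
    + have -> : (V0 + t *: V)%:CM + ii *: (t *: A - (t *: A)^T)%:CM - obs_cov rho X =
         (V0%:CM + ii *: (0 - 0^T : 'M[R]_p)%:CM - obs_cov rho X) + t%:C *: P.
        rewrite PE; clear; move: (obs_cov rho X) ii => Z j.
        apply/matrixP => a b; rewrite !mxE.
        by rewrite !(rmorphD, rmorphM, rmorphB) /= rmorph0; ring.
      exact: (psdD pV (psdZ (t0c : 0 <= t%:C) pP)).
    + by rewrite mulmxDr mxtraceD -scalemxAr mxtraceZ c0E.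
  move=> /infP.
  have -> : \sum_i \sum_j (0 : 'M[R]_p) i j * L i j = 0.
    by rewrite big1 // => i _; rewrite big1 // => j _; rewrite mxE mul0r.
  have -> : \sum_i \sum_j (t *: A) i j * K i j = t * \sum_i \sum_j A i j * K i j.
    rewrite mulr_sumr; apply: eq_bigr => i _; rewrite mulr_sumr.
    by apply: eq_bigr => j _; rewrite mxE mulrA.
  rewrite addr0 -lerBrDr => h; apply: (le_trans h).
  by rewrite mulrBr addrA.
- rewrite /W linearD linearZ /= map_trmx map_trmx sG ST map_mxN scalerN.
  by rewrite addrACA subrr addr0 -mulr2n scaler_nat.
- move=> X hX; have pZ := obs_cov_psd prho hX.
  rewrite (WP _ (psdmxW pZ)).
  have [ZE VT _] := herm_ReIm (psdmxW pZ).
  set V := map_mx (@complex.Re R) (obs_cov rho X) in ZE VT *.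
  set A := 2^-1 *: _ in ZE *.
  have : holevo_values rho drho G A (obs_deriv drho X - 1%:M) (\tr (G *m V)).
    exists X, V; split.
    + exact: hX.
    + by rewrite addrC subrK.
    + exact: VT.
    + rewrite -ZE subrr -(scale0r 1%:M); exact: (psdZ (lexx 0) (psd1 p)).
    + by [].
  by move=> /infP; rewrite addrAC -lerBrDr.
Qed.

End multipliers.

Section posdef_cone.
Context {R : realType}.

Lemma sqnorm_ge0 n (v : 'cV[R]_n) : 0 <= (v^T *m v) 0 0.
Proof. by rewrite mxE sumr_ge0 // => i _; rewrite !mxE -expr2 sqr_ge0. Qed.

Lemma sqnorm_gt0 n (v : 'cV[R]_n) : v != 0 -> 0 < (v^T *m v) 0 0.
Proof.
move=> v0; rewrite lt_neqAle sqnorm_ge0 andbT eq_sym; apply: contra v0 => /eqP h.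
apply/eqP/colP => i; rewrite mxE; apply/eqP; rewrite -sqrf_eq0.
move: h; rewrite mxE => /eqP; rewrite psumr_eq0; last first.
  by move=> j _; rewrite !mxE -expr2 sqr_ge0.
by move=> /allP/(_ i (mem_index_enum _)); rewrite !mxE -expr2.
Qed.

Lemma posdefD n (A B : 'M[R]_n) : posdefmx A -> posdefmx B -> posdefmx (A + B).
Proof.
move=> [sA A0] [sB B0]; split; first by rewrite linearD /= sA sB.
by move=> v v0; rewrite mulmxDr mulmxDl mxE addr_gt0 ?A0 ?B0.
Qed.

Lemma posdefZ n a (A : 'M[R]_n) : 0 < a -> posdefmx A -> posdefmx (a *: A).
Proof.
move=> a0 [sA A0]; split; first by rewrite linearZ /= sA.
by move=> v v0; rewrite -scalemxAr -scalemxAl mxE mulr_gt0 ?A0.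
Qed.

Lemma posdef_scalar n (a : R) : 0 < a -> posdefmx (a%:M : 'M[R]_n).
Proof.
move=> a0; split; first by rewrite tr_scalar_mx.
by move=> v v0; rewrite mul_mx_scalar -scalemxAl mxE mulr_gt0 ?sqnorm_gt0.
Qed.

Lemma real_quadC n (A : 'M[R]_n) (v : 'cV[R]_n) :
  (v%:CM^t* *m A%:CM *m v%:CM) 0 0 = ((v^T *m A *m v) 0 0)%:C.
Proof. by rewrite dag_realC -!map_mxM mxE. Qed.

Lemma psdC_quad_ge0 n (A : 'M[R]_n) (v : 'cV[R]_n) : psdmx A%:CM ->
  0 <= (v^T *m A *m v) 0 0.
Proof. by move=> [_ /(_ v%:CM)]; rewrite real_quadC ler0c. Qed.

(** A positive definite matrix dominates a multiple of the identity: with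
    [G = F F^*], an upper bound of the inverse Gram matrix is conjugated by [F]. *)
Lemma posdef_dominates n (G : 'M[R]_n) : posdefmx G ->
  exists2 c : R, 0 <= c & forall v : 'cV[R]_n,
    (v^T *m v) 0 0 <= c * (v^T *m G *m v) 0 0.
Proof.
move=> pG; have [F GF] := psd_factor (posdef_psdC pG).
have uF : F \in unitmx.
  have : G%:CM \in unitmx by rewrite map_unitmx posdef_unit.
  by rewrite GF unitmx_mul => /andP[].
pose K := invmx F *m (invmx F)^t*.
have hK : K^t* = K by rewrite /K dagM trmxCK.
have [c pc] := herm_le_scalar hK.
exists `|c| => // v.
suff : (v^T *m v) 0 0 <= c * (v^T *m G *m v) 0 0.
  by move=> /le_trans; apply; rewrite ler_wpM2r ?ler_norm // posdef_ge0.
have := psd_sandwich (F^t*) pc; rewrite trmxCK.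
have -> : F *m ((c%:C)%:M - K) *m F^t* = (c *: G - 1%:M)%:CM.
  rewrite mulmxBr mulmxBl mul_mx_scalar -scalemxAl -GF /K mulmxA mulmxV // mul1mx.
  rewrite -dagM mulmxV // dag_scalar conjC1.
  by rewrite map_mxB map_mxZ map_mx1.
move=> pD; have := psdC_quad_ge0 v pD.
rewrite mulmxBr mulmxBl mulmx1 -scalemxAr -scalemxAl mxE [X in X + _]mxE.
by rewrite [X in _ + X]mxE subr_ge0.
Qed.

Lemma sym_bounded n (H : 'M[R]_n) : H^T = H ->
  exists2 c : R, 0 <= c & forall v : 'cV[R]_n,
    - (v^T *m H *m v) 0 0 <= c * (v^T *m v) 0 0.
Proof.
move=> sH; have hH : (- H)%:CM^t* = (- H)%:CM by rewrite dag_realC linearN /= sH.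
have [c pc] := herm_le_scalar hH.
exists `|c| => // v.
suff : - (v^T *m H *m v) 0 0 <= c * (v^T *m v) 0 0.
  by move=> /le_trans; apply; rewrite ler_wpM2r ?ler_norm // sqnorm_ge0.
have : psdmx (c%:M + H)%:CM.
  by move: pc; rewrite map_mxN opprK map_mxD map_scalar_mx.
move=> pD; have := psdC_quad_ge0 v pD.
rewrite mulmxDr mulmxDl mul_mx_scalar -scalemxAl mxE [X in X + _]mxE.
by rewrite -[X in _ + X]opprK subr_ge0.
Qed.

Lemma posdef_absorb n (G H : 'M[R]_n) : posdefmx G -> H^T = H ->
  exists2 s : R, 0 < s & posdefmx (s *: G + H).
Proof.
move=> pG sH; have [c c0 Gc] := posdef_dominates pG.
have [h h0 Hh] := sym_bounded sH.
have s0 : 0 < h * c + 1 by rewrite ltr_wpDl // mulr_ge0.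
exists (h * c + 1) => //; split.
  by have [sG _] := pG; rewrite linearD linearZ /= sG sH.
move=> v v0; have [_ /(_ v v0) G0] := pG.
rewrite mulmxDr mulmxDl -scalemxAr -scalemxAl mxE [X in X + _]mxE.
have h1 := ler_wpM2l h0 (Gc v); have h2 := Hh v.
have h3 := le_trans h2 h1.
rewrite mulrDl mul1r -addrA [X in _ + X]addrC addrA ltr_wpDl //.
by rewrite -mulrA -lerBlDr sub0r.
Qed.

Lemma tr_rank1 n (v : 'cV[R]_n) (V : 'M[R]_n) :
  \tr (v *m v^T *m V) = (v^T *m V *m v) 0 0.
Proof. by rewrite -mulmxA mxtrace_mulC trace_mx11. Qed.

Lemma posdef_trM_ge0 n (G V : 'M[R]_n) : posdefmx G -> psdmx V%:CM ->
  0 <= \tr (G *m V).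
Proof.
move=> pG pV; have := rtr_psd_ge0 (posdef_psdC pG) pV.
by rewrite /rtr tr_realM.
Qed.

End posdef_cone.

Section kkt.
Context {R : realType} {d p : nat}.
Local Notation C := R[i].

Variables (rho : 'M[C]_d) (drho : 'I_p -> 'M[C]_d).
Hypotheses (prho : psdmx rho)
  (feas : exists X, herm_tuple X /\ obs_deriv drho X = 1%:M).

Lemma holevo_values0P (G : 'M[R]_p) c : holevo_values rho drho G 0 0 c <->
  exists X V, [/\ herm_tuple X, obs_deriv drho X = 1%:M, V^T = V,
    psdmx (V%:CM - obs_cov rho X) & c = \tr (G *m V)].
Proof.
have E (V : 'M[R]_p) (Z : 'M[C]_p) :
    V%:CM + (Complex 0 1 : C) *: (0 - 0^T : 'M[R]_p)%:CM - Z = V%:CM - Z.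
  by rewrite trmx0 subr0 map_mx0 scaler0 addr0.
split=> -[X [V [hX uX sV pV cE]]]; exists X, V; split.
- exact: hX.
- by rewrite uX addr0.
- exact: sV.
- by move: pV; rewrite E.
- exact: cE.
- exact: hX.
- by rewrite uX addr0.
- exact: sV.
- by rewrite E.
- exact: cE.
Qed.

Lemma holevo_inf_ge (G : 'M[R]_p) b :
  (forall X V, herm_tuple X -> obs_deriv drho X = 1%:M -> V^T = V ->
     psdmx (V%:CM - obs_cov rho X) -> b <= \tr (G *m V)) ->
  b <= holevo_inf rho drho G.
Proof.
move=> h; apply: lb_le_inf; first exact: (holevo_values_nonempty prho feas).
by move=> c /holevo_values0P[X [V [hX uX sV pV ->]]]; exact: h pV.
Qed.

Lemma rtr_weight_le (W Z : 'M[C]_p) (G V : 'M[R]_p) : psdmx W ->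
  W + W^T = 2%:R *: G%:CM -> V^T = V -> psdmx (V%:CM - Z) ->
  rtr (W *m Z) <= \tr (G *m V).
Proof.
move=> pW hW sV pV; rewrite -(rtr_weight_real hW sV).
have := rtr_psd_ge0 pW pV; rewrite mulmxBr /rtr !raddfB /=.
by rewrite subr_ge0.
Qed.

Lemma holevo_inf_le (G : 'M[R]_p) X V : posdefmx G -> herm_tuple X ->
  obs_deriv drho X = 1%:M -> V^T = V -> psdmx (V%:CM - obs_cov rho X) ->
  holevo_inf rho drho G <= \tr (G *m V).
Proof.
move=> pG hX uX sV pV; apply: ge_inf.
  by exists 0 => c; exact: (holevo_values_ge0 prho pG).
by apply/holevo_values0P; exists X, V.
Qed.

(** The multiplier of the unbiasedness constraint is determined by the
    optimal matrix: apply the multiplier inequality with the deformed weights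
    [T^T W T], [T = 1 + t S], and compare first order terms in [t]. *)
Lemma holevo_multiplierE (G V0 : 'M[R]_p) W (L : 'M[R]_p) :
  posdefmx G -> V0^T = V0 ->
  (forall G', posdefmx G' -> holevo_inf rho drho G' <= \tr (G' *m V0)) ->
  \tr (G *m V0) = holevo_inf rho drho G ->
  psdmx W -> W + W^T = 2%:R *: G%:CM ->
  (forall X, herm_tuple X -> holevo_inf rho drho G +
      \sum_i \sum_j (obs_deriv drho X - 1%:M) i j * L i j <=
      rtr (W *m obs_cov rho X)) ->
  L = 2%:R *: (G *m V0).
Proof.
move=> pG sV0 V0le V0eq pW hW hL; have [sG _] := pG.
have key (S : 'M[R]_p) :
    \sum_i \sum_j S i j * L i j = 2%:R * \tr (G *m S *m V0).
  apply: (@first_order_eq _ _ _ (\tr (S^T *m G *m S *m V0) + \tr V0)) => t t0.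
  pose T : 'M[R]_p := 1%:M + t *: S.
  (* the last term keeps the weight positive definite when [T] is singular, and
     is of second order *)
  pose Gt := T^T *m G *m T + (t ^+ 2)%:M.
  have t2 : 0 < t ^+ 2 by rewrite lt_neqAle sqr_ge0 eq_sym sqrf_eq0 t0.
  have pGt : posdefmx Gt.
    split; first by rewrite linearD /= tr_scalar_mx !trmx_mul trmxK sG mulmxA.
    move=> v v0; rewrite mulmxDr mulmxDl mxE ltr_wpDl //; last first.
      by have [_] := @posdef_scalar R p (t ^+ 2) t2; apply.
    by have := posdef_ge0 (T *m v) pG; rewrite trmx_mul !mulmxA.
  have low : holevo_inf rho drho G + t * \sum_i \sum_j S i j * L i j <=
      holevo_inf rho drho Gt.
    apply: holevo_inf_ge => X V hX uX sV pV.
    have := hL _ (mix_herm T hX).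
    rewrite obs_deriv_mix uX mulmx1 obs_cov_mix /T addrAC subrr add0r.
    have -> : \sum_i \sum_j (t *: S) i j * L i j = t * \sum_i \sum_j S i j * L i j.
      rewrite mulr_sumr; apply: eq_bigr => i _; rewrite mulr_sumr.
      by apply: eq_bigr => j _; rewrite mxE mulrA.
    move=> /le_trans; apply; rewrite -/T.
    have -> : rtr (W *m (T%:CM *m obs_cov rho X *m T%:CM^T)) =
        rtr ((T^T%:CM *m W *m T%:CM) *m obs_cov rho X).
      by rewrite !mulmxA rtr_mulC -map_trmx !mulmxA.
    have pWT : psdmx (T^T%:CM *m W *m T%:CM).
      by rewrite -dag_realC; exact: psd_sandwich.
    have hWT : T^T%:CM *m W *m T%:CM + (T^T%:CM *m W *m T%:CM)^T =
        2%:R *: (T^T *m G *m T)%:CM.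
      rewrite !trmx_mul -!map_trmx trmxK mulmxA -mulmxDl -mulmxDr hW.
      rewrite -scalemxAr -scalemxAl; congr (_ *: _).
      by rewrite [RHS]map_mxM [X in _ = X *m _]map_mxM map_trmx.
    apply: (le_trans (rtr_weight_le pWT hWT sV pV)).
    rewrite /Gt mulmxDl mxtraceD lerDl mul_scalar_mx mxtraceZ.
    apply: (mulr_ge0 (ltW t2)); have := posdef_trM_ge0 (@posdef_scalar R p 1 ltr01) (_ : psdmx V%:CM).
    rewrite mul1mx; apply.
    rewrite -[V%:CM](subrK (obs_cov rho X)); exact: (psdD pV (obs_cov_psd prho hX)).
  have := le_trans low (V0le _ pGt); rewrite -V0eq.
  have -> : \tr (Gt *m V0) = \tr (G *m V0) + (t * (2%:R * \tr (G *m S *m V0)) +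
      t ^+ 2 * (\tr (S^T *m G *m S *m V0) + \tr V0)).
    have TT : T^T = 1%:M + t *: S^T by rewrite /T linearD linearZ /= trmx1.
    rewrite /Gt TT /T mulmxDl mxtraceD.
    rewrite mul_scalar_mx mxtraceZ mulrDr !addrA; congr (_ + _).
    have -> : (1%:M + t *: S^T) *m G *m (1%:M + t *: S) *m V0 =
        G *m V0 + t *: (S^T *m G *m V0) + t *: (G *m S *m V0) +
        t ^+ 2 *: (S^T *m G *m S *m V0).
      rewrite !(mulmxDl, mulmxDr, mul1mx, mulmx1) -?scalemxAr -?scalemxAl.
      rewrite -?scalemxAr -?scalemxAl scalerA -expr2.
      by rewrite !addrA.
    rewrite !mxtraceD !mxtraceZ.
    have -> : \tr (S^T *m G *m V0) = \tr (G *m S *m V0).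
      by rewrite -mxtrace_tr !trmx_mul trmxK sV0 sG mxtrace_mulC.
    by move: (\tr _) (\tr _) (\tr _) => x y z; ring.
  by rewrite lerD2l.
apply/matrixP => i j; have := key (delta_mx i j).
rewrite (bigD1 i) //= [X in _ + X]big1 ?addr0; last first.
  move=> k /negbTE ki; rewrite big1 // => l _.
  by rewrite mxE ki mul0r.
rewrite (bigD1 j) //= [X in _ + X]big1 ?addr0; last first.
  by move=> k /negbTE kj; rewrite mxE kj andbF mul0r.
rewrite mxE !eqxx mul1r => ->; rewrite mxE; congr (_ * _).
rewrite -mulmxA mxtrace_mulC -mulmxA.
have -> : V0 *m G = (G *m V0)^T by rewrite trmx_mul sG sV0.
move: (G *m V0) => M; rewrite /mxtrace (bigD1 i) //= big1 ?addr0; last first.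
  move=> k ki; rewrite mxE big1 // => l _.
  by rewrite mxE (negbTE ki) mul0r.
rewrite mxE (bigD1 j) //= big1 ?addr0; last first.
  by move=> k kj; rewrite mxE (negbTE kj) andbF mul0r.
by rewrite !mxE !eqxx mul1r.
Qed.

(** In the multiplier inequality a linear form is bounded by a quadratic one. It
    vanishes on the radical, so that the equation is solvable, and at a solution
    the inequality bounds the value of the quadratic form. *)
Lemma holevo_kkt (G V0 : 'M[R]_p) : herm_tuple drho -> posdefmx G -> V0^T = V0 ->
  (forall G', posdefmx G' -> holevo_inf rho drho G' <= \tr (G' *m V0)) ->
  \tr (G *m V0) = holevo_inf rho drho G ->
  exists W X, [/\ psdmx W, W + W^T = 2%:R *: G%:CM, herm_tuple X,
    logderiv_eq W (2%:R *: (G *m V0)) rho drho X &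
    rtr (W *m obs_cov rho X) <= \tr (G *m V0)].
Proof.
move=> hdrho pG sV0 V0le V0eq.
have [W [L [pW hW hL]]] := holevo_multipliers prho feas pG.
have LE := holevo_multiplierE pG sV0 V0le V0eq pW hW hL.
pose Lam i : 'M[C]_d := \sum_k (L i k)%:C *: drho k.
have hLam : herm_tuple Lam.
  move=> i; rewrite /Lam dag_sum; apply: eq_bigr => k _.
  by rewrite dagZ conj_realC hdrho.
have ell X : \sum_i rtr (X i *m Lam i) = \sum_i \sum_j obs_deriv drho X i j * L i j.
  apply: eq_bigr => i _; rewrite /Lam mulmx_sumr rtr_sum; apply: eq_bigr => j _.
  by rewrite -scalemxAr rtrZ mxE rtr_mulC mulrC.
have hL' X : herm_tuple X -> holevo_inf rho drho G +
    (\sum_i rtr (X i *m Lam i) - \tr L) <= rtr (W *m obs_cov rho X).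
  move=> hX; have := hL X hX; rewrite ell.
  suff -> : \sum_i \sum_j (obs_deriv drho X - 1%:M) i j * L i j =
      \sum_i \sum_j obs_deriv drho X i j * L i j - \tr L by [].
  rewrite /mxtrace -sumrB; apply: eq_bigr => i _.
  rewrite [X in _ = _ - X](_ : _ = \sum_j (1%:M : 'M[R]_p) i j * L i j); last first.
    rewrite (bigD1 i) //= big1 ?addr0; first by rewrite mxE eqxx mul1r.
    by move=> j /negbTE ji; rewrite mxE eq_sym ji mul0r.
  rewrite -sumrB; apply: eq_bigr => j _.
  by rewrite -mulrBl; congr (_ * _); rewrite mxE [X in _ + X]mxE.
have rad X : herm_tuple X -> rtr (W *m obs_cov rho X) = 0 ->
    \sum_i rtr (X i *m Lam i) = 0.
  move=> hX q0; apply: (@affine_bounded_eq0 _ (\tr L - holevo_inf rho drho G)) => t.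
  have := hL' _ (mix_herm t%:M hX).
  have mixE i : mix t%:M X i = t%:C *: X i.
    rewrite /mix (bigD1 i) //= big1 ?addr0; first by rewrite mxE eqxx.
    by move=> l /negbTE li; rewrite mxE eq_sym li scale0r.
  have -> : \sum_i rtr (mix t%:M X i *m Lam i) = t * \sum_i rtr (X i *m Lam i).
    by rewrite mulr_sumr; apply: eq_bigr => i _; rewrite mixE -scalemxAl rtrZ.
  rewrite obs_cov_mix map_scalar_mx mul_scalar_mx tr_scalar_mx mul_mx_scalar.
  by rewrite -!scalemxAr !rtrZ q0 !mulr0 addrA subr_le0 -lerBrDl.
have [X hX XE] := sylvester_solve prho pW hLam rad.
exists W, X; split.
- exact: pW.
- exact: hW.
- exact: hX.
- by rewrite -LE.
have := hL' X hX; have := sylvester_energy rho W X.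
under eq_bigr do rewrite XE.
move=> ->; rewrite -V0eq LE mxtraceZ.
by move: (rtr _) (\tr _) => a b; lra.
Qed.

End kkt.

(** * The optimal mean square error matrix *)

Section optimum.
Context {R : realType} {d p : nat}.
Local Notation C := R[i].

Variables (rho : 'M[C]_d) (drho : 'I_p -> 'M[C]_d).
Hypotheses (prho : psdmx rho) (hdrho : herm_tuple drho)
  (feas : exists X, herm_tuple X /\ obs_deriv drho X = 1%:M).
(* The first order condition for the model to stay in the set of states. *)
Hypothesis drho_ker : forall k (v : 'rV[C]_d), v *m rho = 0 ->
  complex.Re ((v *m drho k *m v^t*) 0 0) = 0.

(** An observable of zero second moment lives on the kernel of the state,
    on which the quadratic form of the derivative vanishes. *)
Lemma drho_radical k (Y : 'M[C]_d) : Y^t* = Y -> rtr (rho *m Y *m Y) = 0 ->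
  rtr (drho k *m Y) = 0.
Proof.
move=> hY q0; have [F FE] := psd_factor prho.
have YF : Y *m F = 0.
  apply: rtr_gram_eq0; rewrite dagM hY -[RHS]q0 FE -!mulmxA rtr_mulC.
  by rewrite -!mulmxA.
have [P [e [YE PP _ er]]] := herm_spectral hY.
have ePr l : e 0 l *: (row l P *m rho) = 0.
  have : P *m Y *m rho = 0 by rewrite -mulmxA FE [Y *m _]mulmxA YF mul0mx mulmx0.
  rewrite YE !mulmxA PP mul1mx => /(congr1 (row l)).
  rewrite row0 -mulmxA row_mul row_diag_mx -scalemxAl.
  by rewrite -rowE row_mul.
rewrite YE mulmxA rtr_mulC mulmxA mulmxA.
rewrite /rtr /mxtrace raddf_sum big1 // => l _ /=.
rewrite mul_mx_diag mxE.
have -> : (P *m drho k *m P^t*) l l = ((row l P) *m drho k *m (row l P)^t*) 0 0.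
  rewrite -row_mul [RHS]mxE [LHS]mxE; apply: eq_bigr => m _.
  by rewrite [row _ _ _ _]mxE; congr (_ * _); rewrite !mxE.
have [->|e0] := eqVneq (e 0 l) 0; first by rewrite mulr0.
have ker : row l P *m rho = 0.
  by have /eqP := ePr l; rewrite scaler_eq0 (negbTE e0) => /eqP.
have := drho_ker k ker; have := er l.
case: (e 0 l) => x y /eqP; rewrite eq_complex /= eqxx /= => /eqP y0.
have {}y0 : y = 0 by lra.
by case: (_ 0 0) => a b /= ->; rewrite y0 mulr0 mul0r subrr.
Qed.

(** Symmetric logarithmic derivatives exist, whence a Cramer-Rao inequality. *)
Lemma drho_bound k : exists2 K : R, 0 <= K & forall (Y : 'M[C]_d) s, Y^t* = Y ->
  s * rtr (drho k *m Y) <= rtr (rho *m Y *m Y) + s ^+ 2 * K.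
Proof.
have [||X hX XE] := @sylvester_solve R d 1 rho 1%:M prho (psd1 1) (fun=> drho k).
- by move=> i.
- move=> X hX; rewrite mul1mx big_ord1 rtr_mulC {1}/rtr trace_mx11 mxE => q0.
  exact: drho_radical.
have hX0 := hX 0.
have SE : drho k = rho *m X 0 + X 0 *m rho.
  by rewrite -(XE 0) big_ord1 !mxE eqxx !scale1r.
have sq (Y : 'M[C]_d) : Y^t* = Y -> 0 <= rtr (rho *m Y *m Y).
  move=> hY; rewrite -mulmxA -{2}hY.
  exact: (rtr_psd_ge0 prho (psd_gram Y)).
exists (rtr (rho *m X 0 *m X 0)); first exact: sq.
move=> Y s hY; have := sq (Y - s%:C *: X 0).
rewrite dagD dagN dagZ conj_realC hY hX0 => /(_ erefl).
have -> : rtr (rho *m (Y - s%:C *: X 0) *m (Y - s%:C *: X 0)) =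
   rtr (rho *m Y *m Y) - s * rtr (drho k *m Y) + s ^+ 2 * rtr (rho *m X 0 *m X 0).
  have rtrN n (A : 'M[C]_n) : rtr (- A) = - rtr A by rewrite /rtr !raddfN.
  rewrite SE mulmxDl rtrD.
  have -> : rtr (X 0 *m rho *m Y) = rtr (rho *m Y *m X 0).
    by rewrite -mulmxA rtr_mulC.
  have f (A B : 'M[C]_d) : rho *m (A - s%:C *: B) *m (A - s%:C *: B) =
     rho *m A *m A + (-1)%:C *: (s%:C *: (rho *m A *m B)) +
     ((-1)%:C *: (s%:C *: (rho *m B *m A)) + s%:C *: (s%:C *: (rho *m B *m B))).
    rewrite [rho *m (A - _)]mulmxBr mulmxBl !mulmxBr -!scalemxAr -!scalemxAl.
    rewrite (_ : (-1)%:C = -1); last by rewrite rmorphN1.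
    rewrite !scaleN1r -?scalemxAr opprB.
    by congr (_ + _); rewrite addrC.
  rewrite f; move: (rho *m Y *m Y) (rho *m Y *m X 0) (rho *m X 0 *m Y)
    (rho *m X 0 *m X 0) => A1 A2 A3 A4; rewrite !rtrD !rtrZ.
  by move: (rtr _) (rtr _) (rtr _) (rtr _) => a b c e; ring.
by move: (rtr _) (rtr _) (rtr _) => a b c; lra.
Qed.

(** As an infimum of linear functions of [G], the bound is superadditive. *)
Lemma holevo_infD (G H : 'M[R]_p) : posdefmx G -> posdefmx H ->
  holevo_inf rho drho G + holevo_inf rho drho H <= holevo_inf rho drho (G + H).
Proof.
move=> pG pH; apply: holevo_inf_ge => // X V hX uX sV pV.
rewrite mulmxDl mxtraceD.
by rewrite lerD ?(holevo_inf_le prho _ hX uX sV pV).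
Qed.

Lemma holevo_infZ a (G : 'M[R]_p) : posdefmx G -> 0 < a ->
  holevo_inf rho drho (a *: G) = a * holevo_inf rho drho G.
Proof.
move=> pG a0.
have low b (K : 'M[R]_p) : posdefmx K -> 0 < b ->
    b * holevo_inf rho drho K <= holevo_inf rho drho (b *: K).
  move=> pK b0; apply: holevo_inf_ge => // X V hX uX sV pV.
  rewrite -scalemxAl mxtraceZ ler_pM2l //; exact: (holevo_inf_le prho pK hX uX sV pV).
apply/eqP; rewrite eq_le low // andbT.
have := low a^-1 (a *: G) (posdefZ a0 pG).
rewrite invr_gt0 => /(_ a0); rewrite scalerA mulVf ?lt0r_neq0 // scale1r.
by rewrite ler_pdivrMl.
Qed.

Let gap_values (G M : 'M[R]_p) : set R :=
  [set x | exists2 t, 0 < t & posdefmx (t *: G + (M + M^T)) /\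
     x = t * holevo_inf rho drho G - holevo_inf rho drho (t *: G + (M + M^T))].

Let symM (M : 'M[R]_p) : (M + M^T)^T = M + M^T.
Proof. by rewrite linearD /= trmxK addrC. Qed.

Let gap_has_inf G M : posdefmx G -> has_inf (gap_values G M).
Proof.
move=> pG; split.
  have [s s0 pS] := posdef_absorb pG (symM M).
  by exists (s * holevo_inf rho drho G - holevo_inf rho drho (s *: G + (M + M^T))), s.
have [s s0 pS] := posdef_absorb pG (symM (- M)).
exists (holevo_inf rho drho (s *: G + (- M + (- M)^T)) - s * holevo_inf rho drho G).
move=> _ [t t0 [pT ->]].
have := holevo_infD pT pS.
have -> : t *: G + (M + M^T) + (s *: G + (- M + (- M)^T)) = (t + s) *: G.
  by rewrite linearN /= addrACA -scalerDl -opprD subrr addr0.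
rewrite holevo_infZ ?addr_gt0 // mulrDl.
move: (holevo_inf _ _ _) (holevo_inf _ _ _) (holevo_inf _ _ _) => a b c.
by move=> h; rewrite lerBrDr addrAC lerBlDr [leLHS]addrC.
Qed.

Let gap_convex G M M' a : posdefmx G -> 0 <= a <= 1 ->
  inf (gap_values G (a *: M + (1 - a) *: M')) <=
  a * inf (gap_values G M) + (1 - a) * inf (gap_values G M').
Proof.
move=> pG /andP[]; rewrite le_eqVlt => /predU1P[<- _|a0].
  by rewrite scale0r add0r subr0 scale1r mul0r add0r mul1r; exact: lexx.
rewrite le_eqVlt => /predU1P[->|a1].
  by rewrite subrr scale0r addr0 scale1r mul0r addr0 mul1r; exact: lexx.
have b0 : 0 < 1 - a by rewrite subr_gt0.
apply/ler_addgt0Pr => e e0.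
have [_ [t t0 [pT ->]] ce] := inf_adherent e0 (gap_has_inf M pG).
have [_ [s s0 [pS ->]] ce'] := inf_adherent e0 (gap_has_inf M' pG).
apply: (convex_comb_le (ltW a0) (ltW b0) ce ce').
have E : (a * t + (1 - a) * s) *: G + (a *: M + (1 - a) *: M' + (a *: M + (1 - a) *: M')^T) =
    a *: (t *: G + (M + M^T)) + (1 - a) *: (s *: G + (M' + M'^T)).
  by apply/matrixP => i j; rewrite !mxE; ring.
have pa := posdefZ a0 pT; have pb := posdefZ b0 pS.
have le1 : inf (gap_values G (a *: M + (1 - a) *: M')) <=
   (a * t + (1 - a) * s) * holevo_inf rho drho G - holevo_inf rho drho
    (a *: (t *: G + (M + M^T)) + (1 - a) *: (s *: G + (M' + M'^T))).
  apply: ge_inf; first by have [] := gap_has_inf (a *: M + (1 - a) *: M') pG.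
  exists (a * t + (1 - a) * s); first by rewrite addr_gt0 // mulr_gt0.
  by rewrite E; split => //; exact: posdefD.
apply: (le_trans le1).
have := holevo_infD pa pb; rewrite (holevo_infZ pT a0) (holevo_infZ pS b0).
move: (holevo_inf _ _ _) (holevo_inf _ _ _) (holevo_inf _ _ _) (holevo_inf _ _ _).
move=> x y z w h; rewrite -subr_ge0 (_ : _ - _ = y - (a * w + (1 - a) * z)).
  by rewrite subr_ge0.
ring.
Qed.

(** The optimal matrix is a supergradient, at [G], of the concave and positively
    homogeneous function [G |-> C_G]; it is found as a subgradient of the
    directional gap [M |-> inf_t (t C_G - C_(t G + M + M^T))]. *)
Lemma holevo_optimum G : posdefmx G -> exists V0, [/\ posdefmx V0,
  forall G', posdefmx G' -> holevo_inf rho drho G' <= \tr (G' *m V0) &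
  \tr (G *m V0) = holevo_inf rho drho G].
Proof.
move=> pG; have [L hL] := @subgradient_mx R p p (fun M => inf (gap_values G M))
   (fun M M' a => @gap_convex G M M' a pG).
have gap0 : inf (gap_values G 0) = 0.
  have gE : gap_values G 0 = [set 0].
    have E t : t *: G + (0 + 0^T) = t *: G by rewrite trmx0 !addr0.
    apply/seteqP; split => [_ [t t0 [_ ->]]|_ ->] /=.
      by rewrite E holevo_infZ // subrr.
    by exists 1; rewrite // E scale1r mul1r subrr.
  by rewrite gE inf1.
pose V0 := - 4^-1 *: (L + L^T).
have sV0 : V0^T = V0 by rewrite /V0 linearZ /= symM.
have trV0 (H : 'M[R]_p) : H^T = H ->
    \tr (H *m V0) = - \sum_i \sum_j (2^-1 *: H) i j * L i j.
  move=> sH; have HE i j : H i j = H j i by rewrite -{1}sH mxE.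
  have -> : \tr (H *m V0) = \sum_i \sum_j (- 4^-1 * (H i j * L i j) + - 4^-1 * (H i j * L j i)).
    apply: eq_bigr => i _; rewrite mxE; apply: eq_bigr => j _.
    by rewrite !mxE; ring.
  under eq_bigr do rewrite big_split.
  rewrite big_split /= [X in _ + X]exchange_big -big_split -sumrN /=.
  apply: eq_bigr => i _; rewrite -big_split -sumrN; apply: eq_bigr => j _ /=.
  by rewrite mxE (HE j i); field.
have V0gap (H : 'M[R]_p) t : H^T = H -> 0 < t -> posdefmx (t *: G + H) ->
    - \tr (H *m V0) <= t * holevo_inf rho drho G - holevo_inf rho drho (t *: G + H).
  move=> sH t0 pT; rewrite trV0 // opprK.
  have := hL (2^-1 *: H); rewrite gap0 add0r => /le_trans; apply.
  have E : 2^-1 *: H + (2^-1 *: H)^T = H.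
    rewrite linearZ /= sH -scalerDl.
    by rewrite -mulr2n -[2^-1 *+ 2]mulr_natl divff ?scale1r // pnatr_eq0.
  apply: ge_inf; first by have [] := gap_has_inf (2^-1 *: H) pG.
  by exists t => //; rewrite E.
have V0le G' : posdefmx G' -> holevo_inf rho drho G' <= \tr (G' *m V0).
  move=> pG'; have [sG' _] := pG'.
  have pGG : posdefmx (1 *: G + G') by rewrite scale1r; exact: posdefD.
  have := V0gap G' 1 sG' ltr01 pGG; have := holevo_infD pG pG'.
  rewrite scale1r mul1r.
  move: (holevo_inf _ _ _) (holevo_inf _ _ _) (holevo_inf _ _ _) (\tr _).
  by move=> a b c e; lra.
have V0eq : \tr (G *m V0) = holevo_inf rho drho G.
  apply/eqP; rewrite eq_le V0le // andbT.
  have h0 : 0 < 2^-1 :> R by rewrite invr_gt0.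
  have sH : (- (2^-1 *: G))^T = - (2^-1 *: G).
    by have [sG _] := pG; rewrite linearN linearZ /= sG.
  have E : 1 *: G + - (2^-1 *: G) = 2^-1 *: G.
    by rewrite -scalerBl; congr (_ *: _); field.
  have := V0gap _ 1 sH ltr01; rewrite E => /(_ (posdefZ h0 pG)).
  rewrite holevo_infZ // mulNmx raddfN /= opprK -scalemxAl mxtraceZ mul1r.
  by move: (holevo_inf _ _ _) (\tr _) => a b; lra.
exists V0; split => //; split => // v v0.
(* [V0] is positive definite: it dominates the bound at the weights [v v^T + dl],
   which the Cramer-Rao inequality keeps away from zero as [dl] tends to [0]. *)
have [k vk] : exists k, v k 0 != 0.
  apply/existsP; rewrite -negb_forall; apply: contra v0 => /forallP h.
  by apply/eqP/colP => i; rewrite mxE; apply/eqP.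
have [K K0 hK] := drho_bound k.
(* with this [s], [kap] is the square of [s] *)
pose s := v k 0 / (K + 1); pose kap := s * v k 0 - s ^+ 2 * K.
have K1 : 0 < K + 1 by rewrite ltr_wpDl.
have kap0 : 0 < kap.
  have -> : kap = (v k 0 / (K + 1)) ^+ 2.
    by rewrite /kap /s; field; rewrite lt0r_neq0.
  by rewrite lt_neqAle sqr_ge0 andbT eq_sym sqrf_eq0 mulf_neq0 // invr_neq0 // lt0r_neq0.
suff : kap <= (v^T *m V0 *m v) 0 0 by exact: lt_le_trans.
apply/ler_addgt0Pr => e e0.
pose dl := e / (`|\tr V0| + 1).
have V1 : 0 < `|\tr V0| + 1 by rewrite ltr_wpDl.
have dl0 : 0 < dl by rewrite divr_gt0.
have pGv : posdefmx (v *m v^T + dl%:M).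
  split; first by rewrite linearD /= trmx_mul trmxK tr_scalar_mx.
  move=> w w0; rewrite mulmxDr mulmxDl mxE ltr_wpDl //; last first.
    by have [_] := @posdef_scalar R p dl dl0; apply.
  rewrite mulmxA -mulmxA mxE big_ord1.
  have -> : (v^T *m w) 0 0 = (w^T *m v) 0 0.
    by rewrite -[w in LHS]trmxK -trmx_mul mxE.
  by rewrite -expr2 sqr_ge0.
have low : kap <= holevo_inf rho drho (v *m v^T + dl%:M).
  apply: holevo_inf_ge => // X V hX uX sV pV.
  have pVC : psdmx V%:CM.
    rewrite -[V%:CM](subrK (obs_cov rho X)); exact: (psdD pV (obs_cov_psd prho hX)).
  rewrite mulmxDl mxtraceD.
  have h1 : 0 <= \tr (dl%:M *m V) by apply: posdef_trM_ge0 => //; exact: posdef_scalar.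
  suff h2 : kap <= \tr (v *m v^T *m V).
    by rewrite (le_trans h2) // lerDl.
  rewrite tr_rank1.
  have := psdC_quad_ge0.
  pose Xv := \sum_j (v j 0)%:C *: X j.
  have hXv : Xv^t* = Xv.
    by rewrite /Xv dag_sum; apply: eq_bigr => j _; rewrite dagZ conj_realC hX.
  have q : rtr (rho *m Xv *m Xv) <= (v^T *m V *m v) 0 0.
    have [_ /(_ v%:CM)] := pV.
    have -> : (v%:CM^t* *m (V%:CM - obs_cov rho X) *m v%:CM) 0 0 =
        ((v^T *m V *m v) 0 0)%:C - \tr (rho *m Xv *m Xv).
      rewrite mulmxBr mulmxBl mxE real_quadC; congr (_ + _).
      rewrite mxE obs_cov_form //.
      have -> : \sum_j v%:CM j 0 *: X j = Xv by apply: eq_bigr => j _; rewrite mxE.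
      by rewrite hXv mulmxA.
    rewrite lecE => /andP[_]; rewrite raddfB /= subr_ge0; exact.
  move=> _; apply: le_trans q.
  have := hK Xv s hXv.
  have -> : rtr (drho k *m Xv) = v k 0.
    rewrite /Xv mulmx_sumr rtr_sum (bigD1 k) //= big1 ?addr0.
      rewrite -scalemxAr rtrZ.
      have /matrixP/(_ k k) := uX; rewrite !mxE eqxx => ->.
      by rewrite mulr1.
    move=> j jk; rewrite -scalemxAr rtrZ.
    have /matrixP/(_ j k) := uX; rewrite !mxE (negbTE jk) => ->.
    by rewrite mulr0.
  by rewrite /kap lerBlDr.
have := le_trans low (V0le _ pGv); rewrite mulmxDl mxtraceD tr_rank1.
move=> /le_trans; apply; rewrite lerD2l mul_scalar_mx mxtraceZ.
rewrite /dl mulrAC ler_pdivrMr // ler_pM2l //.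
by rewrite (le_trans (ler_norm _)) // lerDl.
Qed.

End optimum.

(** * Continuously differentiable quantum models *)

Section C1.
Context {R : realType} {p : nat}.
Implicit Types (f g : 'cV[R]_p -> R) (x : 'cV[R]_p) (j : 'I_p).

(** The pointwise form of [smooth_near]; it passes to sums and products without a
    choice of neighbourhoods. *)
Definition C1_at f x := (\forall y \near x, differentiable f y) /\
  forall j, {for x, continuous (partial j f)}.

Lemma smooth_near_C1 (A : set 'cV[R]_p) f : smooth_near A f ->
  forall x, A x -> C1_at f x.
Proof.
move=> [U [oU AU dU cU]] x /AU Ux; split; last by move=> j; exact: cU.
by near=> y; apply: dU; near: y; exact: open_nbhs_nbhs.
Unshelve. all: by end_near. Qed.

Lemma C1_diff f x : C1_at f x -> differentiable f x.
Proof. by case=> /nbhs_singleton. Qed.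

Lemma C1_derivable f x v : C1_at f x -> derivable f x v.
Proof. by move=> /C1_diff /diff_derivable; exact. Qed.

Lemma C1_continuous f x : C1_at f x -> {for x, continuous f}.
Proof. by move=> /C1_diff; exact: differentiable_continuous. Qed.

Lemma near_continuous (T : topologicalType) (h h' : T -> R) (x : T) :
  (\forall y \near x, h y = h' y) -> {for x, continuous h'} -> {for x, continuous h}.
Proof.
move=> e ch; rewrite /prop_for /continuous_at (nbhs_singleton e).
by apply: cvg_trans ch; apply: near_eq_cvg; apply: filterS e => y ->.
Qed.

Lemma partialD j f g x : derivable f x (delta_mx j 0) ->
  derivable g x (delta_mx j 0) ->
  partial j (fun t => f t + g t) x = partial j f x + partial j g x.
Proof. exact: deriveD. Qed.

Lemma partialM j f g x : derivable f x (delta_mx j 0) ->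
  derivable g x (delta_mx j 0) ->
  partial j (fun t => f t * g t) x = f x * partial j g x + g x * partial j f x.
Proof. exact: deriveM. Qed.

Lemma partial_cst j c x : partial j (fun=> c) x = 0.
Proof. exact: derive_cst. Qed.

Lemma C1_cst c x : C1_at (fun=> c) x.
Proof.
split; first by near=> y; exact: differentiable_cst.
move=> j; rewrite /partial (_ : 'D_(delta_mx j 0) _ = fun=> 0).
  exact: cst_continuous.
by apply/funext => y; exact: derive_cst.
Unshelve. all: by end_near. Qed.

Lemma C1D f g x : C1_at f x -> C1_at g x -> C1_at (fun t => f t + g t) x.
Proof.
move=> [df cf] [dg cg]; split.
  by near=> y; apply: differentiableD; [near: y; exact: df|near: y; exact: dg].
move=> j; apply: (@near_continuous _ _ (fun y => partial j f y + partial j g y)).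
  near=> y; apply: partialD; apply: diff_derivable.
    by near: y; exact: df.
  by near: y; exact: dg.
exact: (continuousD (cf j) (cg j)).
Unshelve. all: by end_near. Qed.

Lemma C1M f g x : C1_at f x -> C1_at g x -> C1_at (fun t => f t * g t) x.
Proof.
move=> Cf Cg; have cf0 := C1_continuous Cf; have cg0 := C1_continuous Cg.
move: Cf Cg => [df cf] [dg cg]; split.
  by near=> y; apply: differentiableM; [near: y; exact: df|near: y; exact: dg].
move=> j; apply: (@near_continuous _ _
  (fun y => f y * partial j g y + g y * partial j f y)).
  near=> y; apply: partialM; apply: diff_derivable.
    by near: y; exact: df.
  by near: y; exact: dg.
exact: (continuousD (continuousM cf0 (cg j)) (continuousM cg0 (cf j))).
Unshelve. all: by end_near. Qed.

Lemma C1N f x : C1_at f x -> C1_at (fun t => - f t) x.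
Proof.
move=> Cf; rewrite (_ : (fun t => - f t) = (fun t => (-1) * f t)).
  exact: (C1M (C1_cst _ _) Cf).
by apply/funext => t; rewrite mulN1r.
Qed.

Lemma C1_sum (I : Type) (r : seq I) (F : I -> 'cV[R]_p -> R) x :
  (forall i, C1_at (F i) x) -> C1_at (fun t => \sum_(i <- r) F i t) x.
Proof.
move=> CF; elim: r => [|a r IH].
  rewrite (_ : (fun _ => _) = fun=> 0); first exact: C1_cst.
  by apply/funext => t; rewrite big_nil.
rewrite (_ : (fun _ => _) = fun t => F a t + \sum_(i <- r) F i t).
  exact: C1D.
by apply/funext => t; rewrite big_cons.
Qed.

Lemma partial_sum (I : Type) (r : seq I) (F : I -> 'cV[R]_p -> R) j x :
  (forall i, C1_at (F i) x) ->
  partial j (fun t => \sum_(i <- r) F i t) x = \sum_(i <- r) partial j (F i) x.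
Proof.
move=> CF; elim: r => [|a r IH].
  rewrite big_nil (_ : (fun _ => _) = fun=> 0) ?partial_cst //.
  by apply/funext => t; rewrite big_nil.
rewrite big_cons -IH (_ : (fun _ => _) = fun t => F a t + \sum_(i <- r) F i t).
  by rewrite partialD //; apply: C1_derivable => //; exact: C1_sum.
by apply/funext => t; rewrite big_cons.
Qed.

End C1.

Section matrix_C1.
Context {R : realType} {p : nat}.
Local Notation C := R[i].

Definition C1c_at (f : 'cV[R]_p -> C) x :=
  C1_at (fun t => complex.Re (f t)) x /\ C1_at (fun t => complex.Im (f t)) x.

Definition C1m_at m n (F : 'cV[R]_p -> 'M[C]_(m, n)) x :=
  forall i j, C1c_at (fun t => F t i j) x.

Definition cpartial k (f : 'cV[R]_p -> C) x : C :=
  Complex (partial k (fun t => complex.Re (f t)) x)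
          (partial k (fun t => complex.Im (f t)) x).

Definition mpartial m n k (F : 'cV[R]_p -> 'M[C]_(m, n)) x : 'M[C]_(m, n) :=
  \matrix_(i, j) cpartial k (fun t => F t i j) x.

Lemma ReM (a b : C) : complex.Re (a * b) =
  complex.Re a * complex.Re b - complex.Im a * complex.Im b.
Proof. by case: a b => [a b] [c e]. Qed.

Lemma ImM (a b : C) : complex.Im (a * b) =
  complex.Re a * complex.Im b + complex.Im a * complex.Re b.
Proof. by case: a b => [a b] [c e]. Qed.

Lemma C1cM f g x : C1c_at f x -> C1c_at g x -> C1c_at (fun t => f t * g t) x.
Proof.
move=> [fr fi] [gr gi]; split.
  rewrite (_ : (fun _ => _) = fun t => complex.Re (f t) * complex.Re (g t) +
      - (complex.Im (f t) * complex.Im (g t))).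
    by apply: C1D; [exact: C1M|apply: C1N; exact: C1M].
  by apply/funext => t; rewrite ReM.
rewrite (_ : (fun _ => _) = fun t => complex.Re (f t) * complex.Im (g t) +
    complex.Im (f t) * complex.Re (g t)).
  by apply: C1D; exact: C1M.
by apply/funext => t; rewrite ImM.
Qed.

Lemma partialN k (f : 'cV[R]_p -> R) x : derivable f x (delta_mx k 0) ->
  partial k (fun t => - f t) x = - partial k f x.
Proof. exact: deriveN. Qed.

Lemma cpartialM k f g x : C1c_at f x -> C1c_at g x ->
  cpartial k (fun t => f t * g t) x = cpartial k f x * g x + f x * cpartial k g x.
Proof.
move=> [fr fi] [gr gi]; rewrite /cpartial.
rewrite (_ : (fun t => complex.Re _) = fun t => complex.Re (f t) * complex.Re (g t) +
    - (complex.Im (f t) * complex.Im (g t))); last first.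
  by apply/funext => t; rewrite ReM.
rewrite (_ : (fun t => complex.Im _) = fun t => complex.Re (f t) * complex.Im (g t) +
    complex.Im (f t) * complex.Re (g t)); last first.
  by apply/funext => t; rewrite ImM.
have D (h : 'cV[R]_p -> R) : C1_at h x -> derivable h x (delta_mx k 0).
  by move=> ?; exact: C1_derivable.
rewrite (partialD (D _ (C1M fr gr)) (D _ (C1N (C1M fi gi)))).
rewrite (partialD (D _ (C1M fr gi)) (D _ (C1M fi gr))).
rewrite (partialN (D _ (C1M fi gi))) (partialM (D _ fr) (D _ gr)).
rewrite (partialM (D _ fi) (D _ gi)) (partialM (D _ fr) (D _ gi)).
rewrite (partialM (D _ fi) (D _ gr)).
move: (partial _ _ _) (partial _ _ _) (partial _ _ _) (partial _ _ _) => u v u' v'.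
by case: (f x) (g x) => [a b] [c e] /=; simpc; apply/eqP; rewrite eq_complex /=;
  apply/andP; split; apply/eqP; ring.
Qed.

Lemma C1m_tens m n m' n' (F : 'cV[R]_p -> 'M[C]_(m, n))
    (G : 'cV[R]_p -> 'M[C]_(m', n')) x :
  C1m_at F x -> C1m_at G x -> C1m_at (fun t => F t *t G t) x.
Proof.
move=> CF CG i j.
rewrite (_ : (fun _ => _) = fun t => F t (mxtens_unindex i).1 (mxtens_unindex j).1 *
   G t (mxtens_unindex i).2 (mxtens_unindex j).2); first exact: C1cM.
by apply/funext => t; rewrite mxE.
Qed.

Lemma mpartial_tens m n m' n' k (F : 'cV[R]_p -> 'M[C]_(m, n))
    (G : 'cV[R]_p -> 'M[C]_(m', n')) x :
  C1m_at F x -> C1m_at G x ->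
  mpartial k (fun t => F t *t G t) x =
  mpartial k F x *t G x + F x *t mpartial k G x.
Proof.
move=> CF CG; apply/matrixP => i j.
have -> : mpartial k (fun t => F t *t G t) x i j = cpartial k
    (fun t => F t (mxtens_unindex i).1 (mxtens_unindex j).1 *
              G t (mxtens_unindex i).2 (mxtens_unindex j).2) x.
  rewrite mxE (_ : (fun t => (F t *t G t) i j) =
    fun t => F t (mxtens_unindex i).1 (mxtens_unindex j).1 *
             G t (mxtens_unindex i).2 (mxtens_unindex j).2) //.
  by apply/funext => t; rewrite mxE.
rewrite (cpartialM k (CF _ _) (CG _ _)) [RHS]mxE [X in _ = X + _]mxE.
rewrite [X in _ = _ + X]mxE [mpartial k F x _ _]mxE [mpartial k G x _ _]mxE.
by [].
Qed.

Lemma C1m_ntens d (rho : 'cV[R]_p -> 'M[C]_d) N x : C1m_at rho x ->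
  C1m_at (fun t => ntensmx_rec (rho t) N) x.
Proof. by move=> Crho; elim: N => //= N IH; exact: C1m_tens. Qed.

Lemma mpartial_ntens d (rho : 'cV[R]_p -> 'M[C]_d) N k x : C1m_at rho x ->
  mpartial k (fun t => ntensmx_rec (rho t) N) x =
  copies_deriv (rho x) (fun k => mpartial k rho x) N k.
Proof.
move=> Crho; elim: N => //= N IH.
by rewrite mpartial_tens ?IH //; exact: C1m_ntens.
Qed.

Lemma rtr_mulE m (A B : 'M[C]_m) : rtr (A *m B) = \sum_i \sum_j
  (complex.Re (A i j) * complex.Re (B j i) - complex.Im (A i j) * complex.Im (B j i)).
Proof.
rewrite /rtr /mxtrace raddf_sum; apply: eq_bigr => i _ /=.
rewrite mxE raddf_sum; apply: eq_bigr => j _ /=; exact: ReM.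
Qed.

Let term (F : 'cV[R]_p -> C) (b : C) t :=
  complex.Re (F t) * complex.Re b + - (complex.Im (F t) * complex.Im b).

Let C1_term F b x : C1c_at F x -> C1_at (term F b) x.
Proof.
move=> [Fr Fi]; exact: (C1D (C1M Fr (C1_cst _ _)) (C1N (C1M Fi (C1_cst _ _)))).
Qed.

Lemma C1_rtr m (F : 'cV[R]_p -> 'M[C]_m) (B : 'M[C]_m) x : C1m_at F x ->
  C1_at (fun t => rtr (F t *m B)) x.
Proof.
move=> CF; rewrite (_ : (fun _ => _) = fun t => \sum_i \sum_j term (fun t => F t i j) (B j i) t).
  by apply: C1_sum => i; apply: C1_sum => j; exact: C1_term.
by apply/funext => t; rewrite rtr_mulE.
Qed.

Lemma partial_rtr m k (F : 'cV[R]_p -> 'M[C]_m) (B : 'M[C]_m) x : C1m_at F x ->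
  partial k (fun t => rtr (F t *m B)) x = rtr (mpartial k F x *m B).
Proof.
move=> CF; rewrite (_ : (fun _ => _) = fun t => \sum_i \sum_j term (fun t => F t i j) (B j i) t); last first.
  by apply/funext => t; rewrite rtr_mulE.
rewrite partial_sum => [|i]; last by apply: C1_sum => j; exact: C1_term.
rewrite rtr_mulE; apply: eq_bigr => i _.
rewrite partial_sum => [|j]; last exact: C1_term.
apply: eq_bigr => j _; have [Fr Fi] := CF i j.
rewrite mxE; move: Fr Fi (B j i) => Fr Fi b.
have D (h : 'cV[R]_p -> R) : C1_at h x -> derivable h x (delta_mx k 0).
  by move=> ?; exact: C1_derivable.
have Cr := C1_cst (complex.Re b) x; have Ci := C1_cst (complex.Im b) x.
rewrite /term (partialD (D _ (C1M Fr Cr)) (D _ (C1N (C1M Fi Ci)))).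
rewrite (partialN (D _ (C1M Fi Ci))) (partialM (D _ Fr) (D _ Cr)).
rewrite (partialM (D _ Fi) (D _ Ci)) !partial_cst !mulr0 !add0r.
by rewrite mulrC [X in _ - X]mulrC.
Qed.

End matrix_C1.

Section line.
Context {R : realType} {V : normedModType R}.

Lemma line_deriveE (f : V -> R) x v (t : R) :
  'D_1 (fun s : R => f (s *: v + x)) t = 'D_v f (t *: v + x).
Proof.
rewrite /derive; set g1 := fun h => h^-1 *: _; set g2 := fun h => h^-1 *: _.
suff -> : g1 = g2 by [].
by rewrite funeqE /g1 /g2 => h /=; rewrite scalerDl -addrA [_%:A]mulr1.
Qed.

Lemma line_derivable (f : V -> R) x v (t : R) : derivable f (t *: v + x) v ->
  derivable (fun s : R => f (s *: v + x)) t 1.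
Proof.
rewrite /derivable; set g2 := fun h => h^-1 *: _; set g1 := fun h => h^-1 *: _.
suff -> : g1 = g2 by [].
by rewrite funeqE /g1 /g2 => h /=; rewrite scalerDl -addrA [_%:A]mulr1.
Qed.

End line.

Section interior_min.
Context {R : realType} {p : nat}.

(** Fermat's rule, along the line in the direction [k]. *)
Lemma C1_min_partial0 (f : 'cV[R]_p -> R) x k : C1_at f x ->
  (\forall y \near x, f x <= f y) -> partial k f x = 0.
Proof.
move=> [df _] fmin; pose v : 'cV[R]_p := delta_mx k 0.
have cv : (fun s : R => s *: v + x) @ (0 : R) --> x.
  rewrite -[X in _ --> X]add0r -(scale0r v); apply: cvgD; last exact: cvg_cst.
  exact: scalel_continuous.
have : \forall s \near (0 : R), differentiable f (s *: v + x) /\ f x <= f (s *: v + x).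
  exact: (cv _ (filterI df fmin)).
move=> /nbhs_ballP[r /= r0 hr].
have in0 s : s \in `]-r, r[ -> ball (0 : R) r s.
  by rewrite in_itv /= => sr; rewrite /ball /= sub0r normrN ltr_norml.
have := @derive1_at_min R (fun s => f (s *: v + x)) (- r) r 0.
rewrite ge0_cp ?ltW // => /(_ isT).
have h1 (t : R) : t \in `]-r, r[ -> derivable (fun s : R => f (s *: v + x)) t 1.
  move=> /in0/hr[d _]; apply: line_derivable; exact: diff_derivable.
have h0 : 0 \in `]-r, r[ by rewrite in_itv /= r0 oppr_lt0 r0.
have h2 (t : R) : t \in `]-r, r[ -> f (0 *: v + x) <= f (t *: v + x).
  by move=> /in0/hr[_]; rewrite scale0r add0r.
move=> /(_ h1 h0 h2) [_ ]; rewrite line_deriveE scale0r add0r.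
by [].
Qed.

End interior_min.

Section quantum_model.
Context {R : realType} {d p : nat}.
Local Notation C := R[i].

Variables (rho : 'cV[R]_p -> 'M[C]_d) (x : 'cV[R]_p).
Hypotheses (Crho : C1m_at rho x) (drho_near : \forall y \near x, density_mx (rho y)).

Let drho k := mpartial k rho x.

Lemma model_state : psdmx (rho x) /\ \tr (rho x) = 1.
Proof. exact: (nbhs_singleton drho_near). Qed.

Lemma model_deriv_herm : herm_tuple drho.
Proof.
move=> k; apply/matrixP => i j; rewrite !mxE /cpartial.
have e : \forall y \near x, rho y j i = (rho y i j)^*.
  by apply: filterS drho_near => y [/psdmxW h _]; rewrite -{1}h !mxE.
have -> : partial k (fun t => complex.Re (rho t j i)) x =
    partial k (fun t => complex.Re (rho t i j)) x.
  by apply: near_eq_derive; apply: filterS e => y ->; case: (rho y i j).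
have -> : partial k (fun t => complex.Im (rho t j i)) x =
    - partial k (fun t => complex.Im (rho t i j)) x.
  rewrite -partialN; last by apply: C1_derivable; have [] := Crho i j.
  by apply: near_eq_derive; apply: filterS e => y ->; case: (rho y i j).
by apply/eqP; rewrite eq_complex /= opprK !eqxx.
Qed.

Lemma model_deriv_tr k : \tr (drho k) = 0.
Proof.
have hr : rtr (drho k) = 0.
  rewrite -[drho k]mulmx1 -partial_rtr //.
  have <- : partial k (fun=> 1) x = 0 by exact: partial_cst.
  apply: near_eq_derive; apply: filterS drho_near => y [_ ty].
  by rewrite mulmx1 /rtr ty.
have : (\tr (drho k))^* = \tr (drho k) by rewrite -mxtrace_dag model_deriv_herm.
move: hr; rewrite /rtr; case: (\tr (drho k)) => a b /= -> /eqP.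
rewrite eq_complex /= => /andP[_ /eqP b0]; apply/eqP; rewrite eq_complex /= eqxx.
by apply/eqP; lra.
Qed.

(** A vector in the kernel of the state minimizes the expectation of its
    projector over the neighbouring states. *)
Lemma model_deriv_ker k (v : 'rV[C]_d) : v *m rho x = 0 ->
  complex.Re ((v *m drho k *m v^t*) 0 0) = 0.
Proof.
move=> v0; rewrite -trace_mx11 mxtrace_mulC mulmxA mxtrace_mulC -/(rtr _).
rewrite -partial_rtr //; apply: C1_min_partial0; first exact: C1_rtr.
apply: filterS drho_near => y [py _].
have -> : rtr (rho x *m (v^t* *m v)) = 0.
  by rewrite mulmxA rtr_mulC mulmxA v0 mul0mx rtr0.
apply: rtr_psd_ge0 => //; have := psd_gram (v^t*); by rewrite trmxCK.
Qed.

Lemma locally_unbiasedP X : locally_unbiased rho X x <->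
  herm_tuple X /\ obs_deriv drho X = 1%:M.
Proof.
split=> [[hX uX]|[hX uX]]; split.
- by move=> i; apply/hermP.
- by apply/matrixP => i j; rewrite !mxE -partial_rtr // [LHS]uX eq_sym.
- by move=> i; apply/hermP.
- move=> i j; have /matrixP/(_ j i) := uX; rewrite !mxE -partial_rtr // eq_sym.
  by [].
Qed.

Hypothesis feasible : exists X, locally_unbiased rho X x.

Lemma model_feasible : exists X, herm_tuple X /\ obs_deriv drho X = 1%:M.
Proof. by have [X /locally_unbiasedP] := feasible; exists X. Qed.

(** The definition in terms of derivatives of expectations agrees with the
    one in terms of the derivative of the state. *)
Lemma holevo_boundE (G : 'M[R]_p) : posdefmx G ->
  holevo_bound rho G x = (holevo_inf (rho x) drho G)%:E.
Proof.
move=> pG; have [prho _] := model_state.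
rewrite /holevo_inf -ereal_inf_EFin; first last.
- exact: (holevo_values_nonempty prho model_feasible).
- by exists 0 => c; exact: (holevo_values_ge0 prho).
congr ereal_inf; apply/seteqP; split => [_ [X [V [uX sV pV ->]]]|_ [c + <-]] /=.
  exists (\tr (G *m V)) => //; apply/holevo_values0P.
  have [hX uX'] := (locally_unbiasedP X).1 uX.
  by exists X, V; split.
move=> /holevo_values0P[X [V [hX uX sV pV ->]]].
by exists X, V; split => //; apply/locally_unbiasedP; split.
Qed.

(** [holevo_argmin] satisfies its specification, because the supergradient of
    the bound is positive definite. *)
Lemma holevo_argminP (G : 'M[R]_p) : posdefmx G ->
  let V0 := holevo_argmin rho G x in
  [/\ V0^T = V0,
      forall G', posdefmx G' -> holevo_inf (rho x) drho G' <= \tr (G' *m V0) &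
      \tr (G *m V0) = holevo_inf (rho x) drho G].
Proof.
move=> pG V0; have [prho _] := model_state.
have : exists V, holevo_set rho x V /\ (\tr (G *m V))%:E = holevo_bound rho G x.
  have [V [pV Vle Veq]] := holevo_optimum prho model_deriv_herm model_feasible
    model_deriv_ker pG.
  exists V; split; last by rewrite holevo_boundE // Veq.
  by split => // G' pG'; rewrite holevo_boundE // lee_fin Vle.
move=> /getPex; rewrite -/V0 => -[[[sV _] Vle] Veq]; split => //.
- by move=> G' pG'; have := Vle G' pG'; rewrite holevo_boundE // lee_fin.
- by apply: EFin_inj; rewrite -holevo_boundE.
Qed.

(** The optimal observables are centred: taking the trace of the logarithmic
    derivative equation gives [2 G z = 0] for the vector [z] of expectations, as
    the derivatives of the state are traceless. *)
Lemma model_kkt (G : 'M[R]_p) : posdefmx G -> let V0 := holevo_argmin rho G x in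
  exists W X, [/\ psdmx W, W + W^T = 2%:R *: G%:CM, herm_tuple X,
    logderiv_eq W (2%:R *: (G *m V0)) (rho x) drho X &
    rtr (W *m obs_cov (rho x) X) <= \tr (G *m V0)] /\
    forall i, \tr (rho x *m X i) = 0.
Proof.
move=> pG V0; have [prho _] := model_state.
have [sV Vle Veq] := holevo_argminP pG.
have [W [X [pW hW hX eX qX]]] := holevo_kkt prho model_feasible model_deriv_herm pG
  sV Vle Veq.
exists W, X; split => //.
pose z := \col_j \tr (rho x *m X j).
suff z0 : z = 0 by move=> i; have /colP/(_ i) := z0; rewrite !mxE.
have uG : (2%:R *: G%:CM) \in unitmx.
  by rewrite unitmxZ ?unitfE ?pnatr_eq0 // map_unitmx posdef_unit.
suff : (2%:R *: G%:CM) *m z = 0.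
  by move=> /(congr1 (mulmx (invmx (2%:R *: G%:CM)))); rewrite mulKmx // mulmx0.
apply/colP => i; have /(congr1 mxtrace) := eX i.
rewrite [RHS]raddf_sum [X in _ = X -> _]big1; last first.
  by move=> k _ /=; rewrite mxtraceZ model_deriv_tr mulr0.
move=> h; rewrite [RHS]mxE -h [RHS]raddf_sum mxE -hW.
apply: eq_bigr => j _ /=; rewrite mxtraceD !mxtraceZ.
by rewrite [\tr (X j *m _)]mxtrace_mulC -mulrDl !mxE.
Qed.

End quantum_model.

(** * Densities of measurements *)

Section raw_integral.
Import HBNNSimple.
Context {R : realType} {dX : measure_display} {X : measurableType dX}.

(** The integral with respect to a mere set function sees only its values on
    measurable sets. *)
Lemma eq_raw_integral (P P' : set X -> \bar R) (f : X -> \bar R) :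
  (forall B, measurable B -> P B = P' B) ->
  (\int[P]_x f x = \int[P']_x f x)%E.
Proof.
move=> PP'.
have eq_sint (h : {nnsfun X >-> R}) : sintegral P h = sintegral P' h.
  by rewrite /sintegral; apply: eq_fsbigr => r _; rewrite PP'.
rewrite /integral; congr (_ - _)%E; congr ereal_sup;
  by apply/seteqP; split=> y [h hf <-]; exists h.
Qed.

End raw_integral.

Section povm_measures.
Context {R : realType} {dX : measure_display} {X : measurableType dX} {n : nat}.
Variable (M : povm R X n).
Local Notation C := (R[i]).

(** Vanishing on sets that are not measurable makes this a measure when [Q] is
    positive, for a measurement says nothing of such sets. *)
Definition povm_charge (Q : 'M[C]_n) (B : set X) : \bar R :=
  if `[<measurable B>] then (rtr (M B *m Q))%:E else 0%E.

Lemma povm_chargeE Q B : measurable B -> povm_charge Q B = (rtr (M B *m Q))%:E.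
Proof. by move=> mB; rewrite /povm_charge asboolT. Qed.

Lemma povm_charge_outcome S B : measurable B ->
  outcome_law S M B = povm_charge S B.
Proof. by move=> mB; rewrite povm_chargeE// /outcome_law rtr_mulC. Qed.

(** Additivity along a constant sequence of empty sets: a convergent sequence
    [z *+ m] has [z = 0]. *)
Lemma povm_set0 : M set0 = 0.
Proof.
have H := povm_additive M (F := fun=> set0) (fun=> measurable0).
have {}H := H ltac:(by move=> a b _ _ [x []]).
have K (f : nat -> R) (z : R) : (forall m, f m = z *+ m) ->
    f m @[m --> \oo] --> z -> z = 0.
  move=> fE fz; have f1 : f m.+1 @[m --> \oo] --> z by rewrite (cvg_shiftS f).
  have : (fun m => f m.+1 - f m) @ \oo --> z - z by exact: cvgB.
  rewrite subrr (_ : (fun _ => _) = fun=> z); last first.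
    by apply/funext => m; rewrite !fE mulrS addrK.
  by move=> /(cvg_lim (@norm_hausdorff _ _)); rewrite lim_cst//; exact: norm_hausdorff.
apply/matrixP => i j; rewrite [RHS]mxE; have [] := H i j.
rewrite bigcup0 => [|//] hr hi; apply/eqP; rewrite eq_complex; apply/andP; split.
  by apply/eqP; apply: K hr => m; rewrite sumr_const_nat subn0.
by apply/eqP; apply: K hi => m; rewrite sumr_const_nat subn0.
Qed.

Section charge.
Variable Q : 'M[C]_n.

Let charge0 : povm_charge Q set0 = 0%E.
Proof. by rewrite povm_chargeE// povm_set0 mul0mx rtr0. Qed.

Let charge_fin B : measurable B -> povm_charge Q B \is a fin_num.
Proof. by move=> mB; rewrite povm_chargeE. Qed.

Let charge_additive : semi_sigma_additive (povm_charge Q).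
Proof.
move=> F mF tF mUF; rewrite povm_chargeE//.
rewrite [X in X @ _ --> _](_ : _ = fun m =>
    (\sum_(0 <= k < m) rtr (M (F k) *m Q))%:E); last first.
  by apply/funext => m; rewrite -sumEFin; apply: eq_bigr => k _; rewrite povm_chargeE.
apply: cvg_EFin; first by near=> m.
rewrite (_ : fine \o _ = fun m => \sum_(0 <= k < m) rtr (M (F k) *m Q)) //.
rewrite (_ : (fun _ => _) = fun m => \sum_i \sum_j
   ((\sum_(0 <= k < m) complex.Re (M (F k) i j)) * complex.Re (Q j i)
  - (\sum_(0 <= k < m) complex.Im (M (F k) i j)) * complex.Im (Q j i))); last first.
  apply/funext => m; under eq_bigr do rewrite rtr_mulE.
  rewrite exchange_big; apply: eq_bigr => i _; rewrite exchange_big.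
  by apply: eq_bigr => j _; rewrite sumrB !mulr_suml.
rewrite rtr_mulE.
apply: cvg_big => [|i _]; first exact: add_continuous.
apply: cvg_big => [|j _]; first exact: add_continuous.
have [hr hi] := povm_additive M mF tF i j.
by apply: cvgB; apply: cvgMl.
Unshelve. all: by end_near. Qed.

HB.instance Definition _ := isCharge.Build _ _ _ (povm_charge Q)
  charge0 charge_fin charge_additive.

End charge.

Section measure.
Variables (Q : 'M[C]_n) (pQ : psdmx Q).

Definition povm_measure of psdmx Q := povm_charge Q.

Let mu := povm_measure pQ.

Let mu0 : mu set0 = 0%E. Proof. by rewrite /mu /povm_measure charge0. Qed.

Let mu_ge0 B : (0 <= mu B)%E.
Proof.
rewrite /mu /povm_measure /povm_charge; case: asboolP => // mB.
rewrite lee_fin; exact: rtr_psd_ge0 (povm_psd M mB) pQ.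
Qed.

Let mu_additive : semi_sigma_additive mu.
Proof. exact: charge_semi_sigma_additive. Qed.

HB.instance Definition _ := isMeasure.Build _ _ _ (povm_measure pQ) mu0 mu_ge0 mu_additive.

Let mu_fin : fin_num_fun (povm_measure pQ).
Proof. by move=> B mB; rewrite /povm_measure fin_num_measure. Qed.

HB.instance Definition _ := Measure_isFinite.Build _ _ _ (povm_measure pQ) mu_fin.

End measure.

End povm_measures.

Section povm_density.
Context {R : realType} {dX : measure_display} {X : measurableType dX} {n : nat}.
Variable (M : povm R X n).
Local Notation C := (R[i]).

Lemma rat_approx (x : R) : exists r : nat -> rat, ratr (r k) @[k --> \oo] --> x.
Proof.
have ex k : exists r : rat, x - harmonic k < ratr r < x + harmonic k.
  have [|r] := @rat_in_itvoo R (x - harmonic k) (x + harmonic k).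
    by rewrite ltrBlDr -addrA ltrDl addr_gt0 ?harmonic_gt0.
  by rewrite in_itv /= => ?; exists r.
exists (fun k => sval (cid (ex k))).
apply: (@squeeze_cvgr _ _ _ _ (fun k => x - harmonic k) (fun k => x + harmonic k)).
- by near=> k; case: cid => r /= /andP[/ltW -> /ltW ->].
- by rewrite -[X in _ --> X]subr0; apply: cvgB; [exact: cvg_cst|exact: cvg_harmonic].
- by rewrite -[X in _ --> X]addr0; apply: cvgD; [exact: cvg_cst|exact: cvg_harmonic].
Unshelve. all: by end_near. Qed.

Definition rat_vec (r : 'cV[rat * rat]_n) : 'cV[C]_n :=
  \col_i Complex (ratr (r i 0).1) (ratr (r i 0).2).

(** By density of the rational vectors. They are countable, so the criterion can be
    checked off one null set. *)
Lemma psd_rat (A : 'M[C]_n) : A^t* = A ->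
  (forall r, 0 <= rtr (A *m (rat_vec r *m (rat_vec r)^t*))) -> psdmx A.
Proof.
move=> hA A0; apply: (herm_psd hA) => v.
pose ra i := sval (cid (rat_approx (complex.Re (v i 0)))).
pose rb i := sval (cid (rat_approx (complex.Im (v i 0)))).
have ha i : ratr (ra i k) @[k --> \oo] --> complex.Re (v i 0).
  by rewrite /ra; case: cid.
have hb i : ratr (rb i k) @[k --> \oo] --> complex.Im (v i 0).
  by rewrite /rb; case: cid.
pose w k : 'cV[rat * rat]_n := \col_i (ra i k, rb i k).
have cw : rtr (A *m (rat_vec (w k) *m (rat_vec (w k))^t*)) @[k --> \oo] -->
    rtr (A *m (v *m v^t*)).
  rewrite rtr_mulE; under eq_fun do rewrite rtr_mulE.
  apply: cvg_big => [|i _]; first exact: add_continuous.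
  apply: cvg_big => [|j _]; first exact: add_continuous.
  rewrite mxE big_ord1 !mxE; under eq_fun do rewrite !mxE !big_ord1 !mxE /=.
  move: (ha i) (ha j) (hb i) (hb j); case: (v i 0) (v j 0) => [a b] [c e] /=.
  move: (ra i) (ra j) (rb i) (rb j) => fa fc fb fe ca cc cb ce.
  apply: cvgB; apply: cvgM; try exact: cvg_cst.
    by apply: cvgB; apply: cvgM => //; exact: cvgN.
  by apply: cvgD; apply: cvgM => //; exact: cvgN.
by rewrite -(cvg_lim (@norm_hausdorff _ _) cw); apply: limr_ge; [exact: cvgP cw|near=> k; exact: A0].
Unshelve. all: by end_near.
Qed.

Lemma psd_tr0 (A : 'M[C]_n) : psdmx A -> rtr A = 0 -> A = 0.
Proof. by move=> /psd_factor[F ->] /rtr_gram_eq0 ->; rewrite mul0mx. Qed.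

(* The measure [B |-> tr (M B)], which dominates every entry of [M]. *)
Let mu : {finite_measure set X -> \bar R} := povm_measure M (@psd1 R n).

Lemma povm_dominated Q : povm_charge M Q `<< mu.
Proof.
apply/null_content_dominatesP => B mB.
rewrite /mu /= /povm_measure !povm_chargeE// mulmx1 => -[] /(psd_tr0 (povm_psd M mB)) ->.
by rewrite mul0mx rtr0.
Qed.

Let dens Q x := fine (Radon_Nikodym (povm_charge M Q) mu x).

Let densE Q x : (dens Q x)%:E = Radon_Nikodym (povm_charge M Q) mu x.
Proof. by rewrite /dens fineK// Radon_Nikodym_fin_num//; exact: povm_dominated. Qed.

Let dens_int Q : mu.-integrable setT (fun x => (dens Q x)%:E).
Proof.
rewrite (_ : (fun _ => _) = Radon_Nikodym (povm_charge M Q) mu); last first.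
  by apply/funext => x; exact: densE.
exact/Radon_Nikodym_integrable/povm_dominated.
Qed.

Let densI Q B : measurable B ->
  (\int[mu]_(x in B) (dens Q x)%:E = (rtr (M B *m Q))%:E)%E.
Proof.
move=> mB; rewrite -povm_chargeE//.
rewrite (Radon_Nikodym_integral (povm_dominated Q) mB).
by apply: eq_integral => x _; exact: densE.
Qed.

Lemma rtr_unit (A : 'M[C]_n) i j (c : C) :
  rtr (A *m (c *: delta_mx j i)) = complex.Re (c * A i j).
Proof.
rewrite /rtr -scalemxAr mxtraceZ; congr (complex.Re (_ * _)).
rewrite /mxtrace (bigD1 i)//= big1 => [|k ki]; last first.
  by rewrite mxE big1// => l _; rewrite mxE (negbTE ki) andbF mulr0.
rewrite addr0 mxE (bigD1 j)//= big1 => [|k kj]; last first.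
  by rewrite mxE (negbTE kj) mulr0.
by rewrite mxE !eqxx mulr1 addr0.
Qed.

Let raw x : 'M[C]_n := \matrix_(i, j)
  Complex (dens (1 *: delta_mx j i) x) (dens (Complex 0 (-1) *: delta_mx j i) x).

Let raw_rtr Q x : (rtr (raw x *m Q))%:E = (\sum_i \sum_j
  ((complex.Re (Q j i))%:E * (dens (1 *: delta_mx j i) x)%:E +
  (- complex.Im (Q j i))%:E * (dens (Complex 0 (-1) *: delta_mx j i) x)%:E))%E.
Proof.
rewrite rtr_mulE -sumEFin; apply: eq_bigr => i _; rewrite -sumEFin.
apply: eq_bigr => j _; rewrite [raw x i j]mxE /= -!EFinM -EFinD.
by congr EFin; rewrite mulNr; congr (_ - _); exact: mulrC.
Qed.

Let raw_int Q : mu.-integrable setT (fun x => (rtr (raw x *m Q))%:E).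
Proof.
under eq_fun do rewrite raw_rtr.
apply: integrable_sum => // i _; apply: integrable_sum => // j _.
by apply: integrableD => //; apply: integrableZl => //; exact: dens_int.
Qed.

Let rawI Q B : measurable B ->
  (\int[mu]_(x in B) (rtr (raw x *m Q))%:E = (rtr (M B *m Q))%:E)%E.
Proof.
move=> mB.
have dI Q' : mu.-integrable B (fun x => (dens Q' x)%:E).
  by apply: integrableS (dens_int Q').
have zI Q' r : mu.-integrable B (fun x => r%:E * (dens Q' x)%:E)%E.
  by apply: integrableZl.
have tI i j : mu.-integrable B (fun x => (complex.Re (Q j i))%:E * (dens (1 *: delta_mx j i) x)%:E +
  (- complex.Im (Q j i))%:E * (dens (Complex 0 (-1) *: delta_mx j i) x)%:E)%E.
  by apply: integrableD.
under eq_integral do rewrite raw_rtr.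
rewrite integral_sum// => [|i]; last by apply: integrable_sum => // j _.
rewrite rtr_mulE -sumEFin; apply: eq_bigr => i _.
rewrite integral_sum// -sumEFin; apply: eq_bigr => j _.
have E := integralD mB (zI (1 *: delta_mx j i) (complex.Re (Q j i)))
  (zI (Complex 0 (-1) *: delta_mx j i) (- complex.Im (Q j i))).
have Z Q' r : (\int[mu]_(x in B) (r%:E * (dens Q' x)%:E) = (r * rtr (M B *m Q'))%:E)%E.
  by apply: (etrans (integralZl mB (dI Q') r)); rewrite EFinM; congr (_ * _)%E; exact: densI.
apply: (etrans E); apply: (etrans (congr2 _ (Z _ _) (Z _ _))).
rewrite -EFinD; congr EFin; rewrite !rtr_unit.
move: (M B i j) (Q j i) => [a b] [c e] /=.
by rewrite !mul0r !mul1r mulN1r; ring.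
Qed.

(* The hermitian part of [raw] has the same integrals, [M B] being hermitian. *)
Let sym x : 'M[C]_n := (2%:R^-1)%:C *: (raw x + (raw x)^t*).

Let sym_rtr Q x : rtr (sym x *m Q) = 2%:R^-1 * (rtr (raw x *m Q) + rtr (raw x *m Q^t*)).
Proof.
rewrite /sym -scalemxAl rtrZ mulmxDl rtrD; congr (_ * (_ + _)).
by rewrite -[in LHS]rtr_dag dagM trmxCK rtr_mulC.
Qed.

Let sym_rtrE Q : (fun x => (rtr (sym x *m Q))%:E) = (fun x => (2%:R^-1)%:E *
  ((rtr (raw x *m Q))%:E + (rtr (raw x *m Q^t*))%:E))%E.
Proof. by apply/funext => x; rewrite sym_rtr. Qed.

Let sym_int Q : mu.-integrable setT (fun x => (rtr (sym x *m Q))%:E).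
Proof.
rewrite sym_rtrE; apply: integrableZl => //.
by apply: integrableD => //; exact: raw_int.
Qed.

Let symI Q B : measurable B ->
  (\int[mu]_(x in B) (rtr (sym x *m Q))%:E = (rtr (M B *m Q))%:E)%E.
Proof.
move=> mB; rewrite sym_rtrE.
have rI Q' : mu.-integrable B (fun x => (rtr (raw x *m Q'))%:E).
  by apply: integrableS (raw_int Q').
rewrite integralZl//; last exact: integrableD.
rewrite integralD// !rawI// -EFinD -EFinM; congr EFin.
rewrite -[rtr (_ *m Q^t*)]rtr_dag dagM trmxCK (psdmxW (povm_psd M mB)) [rtr (Q *m _)]rtr_mulC.
by field.
Qed.

Let sym_rn S (pS : psdmx S) :
  ae_eq mu setT (fun x => (rtr (sym x *m S))%:E)
    (Radon_Nikodym_SigmaFinite.f (povm_measure M pS) mu).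
Proof.
have dom : povm_measure M pS `<< mu := povm_dominated S.
apply: (integral_ae_eq measurableT (sym_int S)).
  exact: (measurable_int mu (Radon_Nikodym_SigmaFinite.f_integrable dom)).
move=> E _ mE; rewrite symI//; apply: etrans (Radon_Nikodym_SigmaFinite.f_integral dom mE).
by apply/esym; exact: povm_chargeE.
Qed.

(** A measurement has a density with values in the positive matrices, relative to
    its trace. The entries are Radon-Nikodym derivatives; at almost every point
    the form of the density is nonnegative on the rational vectors, since for
    positive [Q] the derivative of [B |-> tr (M B Q)] is nonnegative. *)
Lemma povm_density : exists (nu : {finite_measure set X -> \bar R}) (m : X -> 'M[C]_n),
  [/\ forall x, psdmx (m x),
      forall Q, nu.-integrable setT (fun x => (rtr (m x *m Q))%:E),
      forall Q, (\int[nu]_x (rtr (m x *m Q))%:E = (rtr Q)%:E)%E &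
      forall S (f : X -> \bar R), psdmx S -> (forall x, 0 <= f x)%E -> measurable_fun setT f ->
        (\int[outcome_law S M]_x f x = \int[nu]_x (f x * (rtr (m x *m S))%:E))%E].
Proof.
pose Qr r := rat_vec r *m (rat_vec r)^t*.
have pQ r : psdmx (Qr r) := psd_gram (rat_vec r).
have ge0 : {ae mu, forall x, forall r, 0 <= rtr (sym x *m Qr r)}.
  suff : {ae mu, forall x, forall k : nat, if unpickle k is Some r then
      0 <= rtr (sym x *m Qr r) else true}.
    by apply: filterS => x h r; have := h (pickle r); rewrite pickleK.
  apply/ae_foralln => k; case: (unpickle k) => [r|]; last by near=> x.
  apply: filterS (sym_rn (pQ r)) => x /(_ I) e.
  rewrite -lee_fin e; apply: Radon_Nikodym_SigmaFinite.f_ge0.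
  exact: povm_dominated.
have sym_herm x : (sym x)^t* = sym x.
  by rewrite /sym dagZ conj_realC dagD trmxCK addrC.
have psd_ae : {ae mu, forall x, psdmx (sym x)}.
  by apply: filterS ge0 => x h; apply: psd_rat.
have [N [mN N0 subN]] := psd_ae.
have psdN x : ~ N x -> psdmx (sym x) by move=> Nx; apply: contrapT => h; exact: Nx (subN x h).
pose m x := if x \in N then 0 else sym x.
have mE Q x : rtr (m x *m Q) = if x \in N then 0 else rtr (sym x *m Q).
  by rewrite /m; case: ifP => // _; rewrite mul0mx rtr0.
have m_ae Q : ae_eq mu setT (fun x => (rtr (m x *m Q))%:E) (fun x => (rtr (sym x *m Q))%:E).
  exists N; split=> // x; apply: contra_notP => Nx _ /=.
  by rewrite mE; case: ifPn => // /set_mem.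
have m_int Q : mu.-integrable setT (fun x => (rtr (m x *m Q))%:E).
  rewrite (_ : (fun _ => _) = (fun x => (rtr (sym x *m Q))%:E) \_ (~` N)).
    apply/(integrable_mkcond _ (measurableC mN)).
    by apply: integrableS (sym_int Q) => //; exact: measurableC.
  by apply/funext => x; rewrite mE patchE in_setC; case: (x \in N).
have mmeas Q : measurable_fun setT (fun x => (rtr (m x *m Q))%:E).
  exact: measurable_int (m_int Q).
exists mu, m; split=> [x|//|Q|S f pS f0 mf].
- rewrite /m; case: ifPn => [_|/negP Nx]; first by rewrite -(scale0r 1%:M); apply: psdZ (psd1 _).
  by apply: psdN => ?; apply: Nx; exact: mem_set.
- rewrite (ae_eq_integral _ _ measurableT (mmeas Q) _ (m_ae Q)); last first.
    exact: measurable_int (sym_int Q).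
  by rewrite symI// povm_setT mul1mx.
- rewrite (eq_raw_integral (P' := povm_measure M pS)) => [|B mB]; last exact: povm_charge_outcome.
  have dom : povm_measure M pS `<< mu := povm_dominated S.
  rewrite -(Radon_Nikodym_SigmaFinite.change_of_variables dom f0 measurableT mf).
  have rnmeas := measurable_int mu (Radon_Nikodym_SigmaFinite.f_integrable dom).
  apply: ae_eq_integral => //.
  + exact: emeasurable_funM.
  + exact: emeasurable_funM.
  apply: filterS2 (m_ae S) (sym_rn pS) => x e1 e2 _.
  by rewrite -(e2 I) -(e1 I).
Unshelve. all: by end_near. Qed.

End povm_density.

(** * Integration by parts over an open set *)

Section line_integral.
Context {R : realType}.
Local Notation leb := (@lebesgue_measure R).

Lemma closure_inf (J : set R) : J !=set0 -> has_lbound J -> closure J (inf J).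
Proof.
move=> J0 lJ B /(@nbhs_ballP _ R)[e /= e0 Be].
have [z Jz ze] := inf_adherent e0 (conj J0 lJ).
exists z; split=> //; apply: Be; rewrite /ball /= distrC ger0_norm.
  by rewrite ltrBlDl.
by rewrite subr_ge0; apply: ge_inf.
Qed.

(** An open component that contains [x] would meet [J q], because [x] is in the
    closure of [J q]. *)
Lemma closure_component (J : nat -> set R) q (x : R) : (forall r, open (J r)) ->
  trivIset setT J -> closure (J q) x -> ~ J q x -> ~ (\bigcup_r J r) x.
Proof.
move=> oJ tJ clx nJ [r _ Jrx]; have rq : r != q by apply/eqP => e; apply: nJ; rewrite -e.
have [y [Jqy Jry]] := clx (J r) (open_nbhs_nbhs (conj (oJ r) Jrx)).
have /trivIsetP/(_ r q I I rq) := tJ.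
by rewrite -subset0 => /(_ y); apply; split.
Qed.

(** On each component [(a, b)] of [A] the integral is [f b - f a], and [f] is zero
    at the endpoints, which lie in [K] but not in [A]. *)
Lemma integral_derivative_eq0 (K A : set R) (f g : R -> R) :
  compact K -> open A -> A `<=` K -> (forall x, K x -> ~ A x -> f x = 0) ->
  (forall x, K x -> derivable f x 1 /\ 'D_1 f x = g x) ->
  (forall x, K x -> {for x, continuous g}) ->
  (\int[leb]_(x in A) (g x)%:E = 0)%E.
Proof.
move=> cK oA AK f0 df cg.
have clK : closed K by apply: compact_closed => //; exact: norm_hausdorff.
have wg : {within K, continuous g}.
  by apply: continuous_in_subspaceT => x /set_mem /cg.
have ig : leb.-integrable A (EFin \o g).
  have mK : measurable (K : set (measurableTypeR R)) := closed_measurable clK.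
  have mA : measurable (A : set (measurableTypeR R)) := open_measurable oA.
  apply: (@integrableS _ _ R leb K A (EFin \o g) mK mA AK).
  exact: continuous_compact_integrable cK wg.
have [B [_ KB]] := compact_bounded cK.
have {}KB x : K x -> `|x| <= B + 1 by apply: KB; rewrite ltrDl.
pose J := open_disjoint_itv oA.
have AE : A = \bigcup_q J q := @open_disjoint_itv_bigcup R A oA.
have oJ q : open (J q) := @open_disjoint_itv_open R A oA q.
have tJ : trivIset setT J := @open_disjoint_itv_trivIset R A oA.
have JA q : J q `<=` A by rewrite AE; exact: bigcup_sup.
have mJ q : measurable (J q) by exact: open_measurable.
have closureK q x : closure (J q) x -> K x.
  by move=> h; apply: clK; apply: closure_subset h => y /JA /AK.
rewrite AE integral_bigcup// -?AE// eseries0// => q _ _.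
have [->|/set0P J0] := eqVneq (J q) set0; first by rewrite integral_set0.
have lJ : has_lbound (J q).
  by exists (- (B + 1)) => x /JA /AK /KB; rewrite ler_norml => /andP[].
have uJ : has_ubound (J q).
  by exists (B + 1) => x /JA /AK /KB; rewrite ler_norml => /andP[].
set a := inf (J q); set b := sup (J q).
have JE : J q = `]a, b[%classic.
  have := oJ q; rewrite openE => sub.
  have <- : (J q)° = J q by apply/seteqP; split; [exact: interior_subset|exact: sub].
  rewrite (interval_bounded_interior (@open_disjoint_itv_is_interval R A oA q) lJ uJ).
  by apply/seteqP; split=> x /=; rewrite in_itv.
have ab : a < b.
  by case: J0 => x; rewrite JE /= in_itv /= => /andP[ax xb]; exact: lt_trans ax xb.
have cla : closure (J q) a by exact: closure_inf.
have clb : closure (J q) b by exact: closure_sup.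
have fa : f a = 0.
  apply: f0 (closureK _ _ cla) _; rewrite AE; apply: closure_component cla _ => //.
  by rewrite JE /= in_itv /= ltxx.
have fb : f b = 0.
  apply: f0 (closureK _ _ clb) _; rewrite AE; apply: closure_component clb _ => //.
  by rewrite JE /= in_itv /= ltxx andbF.
have itvK x : a <= x <= b -> K x.
  move=> /andP[]; rewrite le_eqVlt => /predU1P[<- _|ax]; first exact: closureK cla.
  rewrite le_eqVlt => /predU1P[->|xb]; first exact: closureK clb.
  by apply: AK; apply: (JA q); rewrite JE /= in_itv /= ax xb.
have cf x : K x -> {for x, continuous f}.
  by move=> /df[dfx _]; apply: differentiable_continuous; exact/derivable1_diffP.
rewrite JE.
have <- : (\int[leb]_(x in `[a, b]) (g x)%:E = \int[leb]_(x in `]a, b[) (g x)%:E)%E.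
  apply: integral_itv_bndoo; rewrite -JE.
  have mA : measurable (A : set (measurableTypeR R)) := open_measurable oA.
  have mJq : measurable (J q : set (measurableTypeR R)) := mJ q.
  exact: (measurable_int leb (@integrableS _ _ R leb A (J q) (EFin \o g) mA mJq (JA q) ig)).
rewrite (@continuous_FTC2 _ g f)// ?fa ?fb ?subee//.
- apply: continuous_in_subspaceT => x /set_mem /=; rewrite in_itv /= => xab.
  exact: cg (itvK _ xab).
- split.
  + move=> x; rewrite in_itv /= => /andP[ax xb].
    by have [] := df x (itvK x ltac:(by rewrite !ltW)).
  + by apply: cvg_at_right_filter; apply: cf; apply: closureK cla.
  + by apply: cvg_at_left_filter; apply: cf; apply: closureK clb.
- move=> x; rewrite in_itv /= derive1E => /andP[ax xb].
  by have [] := df x (itvK x ltac:(by rewrite !ltW)).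
Qed.

End line_integral.

Section cV_topology.
Context {R : realType} {p : nat}.
Local Notation V := 'cV[R]_p.

(* The open sets are unions of such boxes, which are countably many. *)
Let rbox (r : 'cV[rat]_p * rat) : set V :=
  [set w | forall i, `]ratr (r.1 i 0) - ratr r.2, ratr (r.1 i 0) + ratr r.2[%classic (w i 0)].

Lemma open_measurable_cV (U : set V) : open U -> measurable U.
Proof.
move=> oU; pose F k := if unpickle k is Some r then
  (if `[<rbox r `<=` U>] then rbox r else set0) else set0.
suff -> : U = \bigcup_k F k.
  apply: bigcupT_measurable => k; rewrite /F; case: unpickle => // r.
  by case: ifP => // _; exact: (measurable_box (fun i => measurable_itv _)).
apply/seteqP; split; last first.
  by move=> v [k _]; rewrite /F; case: unpickle => // r; case: asboolP => // sub /sub.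
move=> v Uv; have /nbhs_ballP[e /= e0 be] : nbhs v U by exact: open_nbhs_nbhs.
have [q] := @rat_in_itvoo R 0 (e / 2) ltac:(by rewrite divr_gt0).
rewrite in_itv /= => /andP[q0 qe].
have ex i : exists r : rat, v i 0 - ratr q < ratr r < v i 0 + ratr q.
  have [|r] := @rat_in_itvoo R (v i 0 - ratr q) (v i 0 + ratr q).
    by rewrite ltrBlDr -addrA ltrDl addr_gt0.
  by rewrite in_itv /= => ?; exists r.
pose r : 'cV[rat]_p * rat := (\col_i sval (cid (ex i)), q).
have rv : rbox r v.
  move=> i /=; rewrite mxE in_itv /=; case: cid => s /= /andP[s1 s2].
  by rewrite ltrBlDr s2 -ltrBlDr s1.
have sub : rbox r `<=` U.
  move=> w rw; apply: be; split=> // i j; rewrite ord1 /ball /=.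
  move: (rv i) (rw i) => /=; rewrite !in_itv /= => /andP[a1 a2] /andP[b1 b2].
  by rewrite ltr_norml; apply/andP; split; lra.
by exists (pickle r) => //; rewrite /F pickleK asboolT.
Qed.

Lemma compact_closed_cV (K : set V) : compact K -> closed K.
Proof. by apply: compact_closed; exact: norm_hausdorff. Qed.

Lemma compact_measurable_cV (K : set V) : compact K -> measurable K.
Proof.
move=> /compact_closed_cV cK; rewrite -[K]setCK; apply: measurableC.
by apply: open_measurable_cV; exact: closed_openC.
Qed.

Lemma continuous_measurable_cV (A : set V) (f : V -> R) : open A ->
  (forall x, A x -> {for x, continuous f}) -> measurable_fun A f.
Proof.
move=> oA cf; apply: (measurability _ (RGenOInfty.measurableE R)) => //.
move=> _ [_ [x ->] <-]; apply: open_measurable_cV.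
rewrite openE => v [Av] /=; rewrite in_itv /= andbT => xv.
apply: filterI; first exact: open_nbhs_nbhs.
by have := cf v Av; move=> /(cvgr_gt (f v)) /(_ x xv); apply: filterS => w; rewrite /= in_itv /= andbT.
Qed.

Lemma compact_bound (K : set V) (f : V -> R) : compact K ->
  (forall x, K x -> {for x, continuous f}) ->
  exists B : R, forall x, K x -> `|f x| <= B.
Proof.
move=> cK cf; have : compact (f @` K).
  by apply: continuous_compact => //; apply: continuous_in_subspaceT => x /set_mem /cf.
move=> /compact_bounded[B [_ hB]]; exists (B + 1) => x Kx.
by apply: (hB (B + 1)); [rewrite ltrDl|exists x].
Qed.

Lemma compact_box (K : set V) : compact K ->
  exists B : R, forall x i, K x -> `|x i 0| <= B.
Proof.
move=> cK; have ex i : exists B : R, forall x, K x -> `|x i 0| <= B.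
  by apply: compact_bound cK _ => x _; exact: coord_continuous.
exists (\sum_i `|sval (cid (ex i))|) => x i Kx; rewrite (bigD1 i)//=.
case: cid => B /= hB; apply: le_trans (hB _ Kx) _.
by rewrite (le_trans (ler_norm _))// lerDl sumr_ge0.
Qed.

End cV_topology.

Section slices.
Context {R : realType}.
Local Notation leb := (@lebesgue_measure R).

(** Bounded measurable functions supported in a cube. The conditions pass to the
    slices of [h] with the same constant, as an induction on [p] requires. *)
Definition tame p (h : 'cV[R]_p -> R) (B : R) := [/\ measurable_fun setT h,
  forall v, `|h v| <= B & forall (v : 'cV[R]_p) i, B < `|v i 0| -> h v = 0].

Lemma tame_integrable p (h : 'cV[R]_p -> R) B : tame h B ->
  (lebesgue_cV p).-integrable setT (EFin \o h).
Proof.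
move=> [mh hB h0].
pose I : set (measurableTypeR R) := `[- B, B]%classic.
pose E := [set v : 'cV[R]_p | forall i, I (v i 0)].
have mI : measurable I by exact: measurable_itv.
have mE : measurable E by exact: (measurable_box (fun=> mI)).
have Efin : (lebesgue_cV p E < +oo)%E.
  rewrite (lebesgue_cV_box (fun=> mI)) ltey_eq; apply/orP; left.
  apply: (big_ind (fun x : \bar R => x \is a fin_num)) => //.
    by move=> x y; exact: fin_numM.
  by move=> i _; rewrite /I lebesgue_measure_itv; case: ifP.
have iE : (lebesgue_cV p).-integrable E (EFin \o h).
  apply: measurable_bounded_integrable => //; first exact: measurable_funTS.
  exists B; split; first exact: num_real.
  by move=> M BM v _; exact: le_trans (hB v) (ltW BM).
rewrite (_ : EFin \o h = (EFin \o h) \_ E); first by apply/(integrable_mkcond (EFin \o h) mE).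
apply/funext => v; rewrite patchE; case: ifPn => // /negP nE /=.
have [i hi] : exists i, B < `|v i 0|.
  apply: contrapT => no; apply: nE; apply/mem_set => i.
  rewrite /I /= in_itv /= -ler_norml leNgt; apply/negP => hi; apply: no; by exists i.
by rewrite (h0 v i hi).
Qed.

Lemma cV_cons_add p (x s : R) (v w : 'cV[R]_p) :
  cV_cons (x, s *: v + w) = s *: cV_cons (0, v) + cV_cons (x, w) :> 'cV[R]_p.+1.
Proof.
apply/colP => i; rewrite !mxE; case: (unliftP 0 i) => [j _|_] /=; rewrite ?mxE //.
by rewrite mulr0 add0r.
Qed.

Lemma tame_slice p (h : 'cV[R]_p.+1 -> R) B x : tame h B ->
  tame (fun v => h (cV_cons (x, v))) B.
Proof.
move=> [mh hB h0]; split=> //.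
  apply: measurableT_comp => //; apply: measurableT_comp; last exact: pair1_measurable.
  exact: measurable_cV_cons.
move=> v i Bi; apply: (h0 _ (lift 0 i)).
by rewrite mxE liftK.
Qed.

(** By the theorem of Fubini, one coordinate being peeled off at each step until it
    is the [k]-th one. *)
Lemma integral_lines_eq0 p (h : 'cV[R]_p -> R) B k : tame h B ->
  (forall v, (\int[leb]_s (h (s *: delta_mx k 0 + v))%:E = 0)%E) ->
  (\int[lebesgue_cV p]_v (h v)%:E = 0)%E.
Proof.
elim: p h k => [h [] //|p IH] h k th line0.
have [mh _ _] := th.
have mcons := @measurable_cV_cons R p.
have mhE : measurable_fun setT (EFin \o h) by exact/measurable_EFinP.
have ih := tame_integrable th.
have iprod : (leb \x lebesgue_cV p)%E.-integrable setT ((EFin \o h) \o @cV_cons R p).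
  apply/integrableP; split; first exact: measurableT_comp.
  have [_ fin] := integrableP _ _ _ ih.
  apply: le_lt_trans fin; rewrite le_eqVlt; apply/orP; left; apply/eqP/esym.
  have := @ge0_integral_pushforward _ _ _ _ R _ mcons (leb \x lebesgue_cV p)%E setT
     (fun v => `|(EFin \o h) v|)%E measurableT.
  by rewrite preimage_setT; apply=> //; exact: measurableT_comp.
have -> : (\int[lebesgue_cV p.+1]_v (h v)%:E =
    \int[leb \x lebesgue_cV p]_z (h (cV_cons z))%:E)%E.
  have := @integral_pushforward _ _ _ _ R _ mcons (leb \x lebesgue_cV p)%E setT (EFin \o h).
  by rewrite preimage_setT; apply.
case: (unliftP 0 k) line0 => [j ->|->] line0.
  rewrite -(integral12_prod_meas1 iprod); apply: integral0_eq => x _.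
  apply: (IH _ j (tame_slice x th)) => v; rewrite -[RHS](line0 (cV_cons (x, v))).
  apply: eq_integral => s _; rewrite cV_cons_add; congr (h (_ *: _ + _))%:E.
  apply/colP => i; rewrite !mxE; case: (unliftP 0 i) => [l ->|->].
    by rewrite !mxE (inj_eq lift_inj).
  by rewrite eq_liftF.
rewrite -(integral21_prod_meas1 iprod); apply: integral0_eq => v _.
rewrite /fubini_G -[RHS](line0 (cV_cons (0, v))); apply: eq_integral => s _ /=.
congr (h _)%:E; apply/colP => i; rewrite !mxE.
case: (unliftP 0 i) => [l ->|->]; rewrite /= ?mulr0 ?add0r //.
by rewrite mulr1 addr0.
Qed.

End slices.

Section divergence.
Context {R : realType} {p : nat}.
Local Notation V := 'cV[R]_p.
Variables (K A : set V).
Hypotheses (cK : compact K) (oA : open A) (AK : A `<=` K).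

Lemma open_restrict_tame (g : V -> R) : (forall x, K x -> {for x, continuous g}) ->
  exists B, tame (g \_ A) B.
Proof.
move=> cg; have [B1 hB1] := compact_bound cK cg; have [B2 hB2] := compact_box cK.
have [B10 B1B] : 0 <= Num.max 0 (Num.max B1 B2) /\ B1 <= Num.max 0 (Num.max B1 B2).
  by rewrite !le_max !lexx orbT.
have B2B : B2 <= Num.max 0 (Num.max B1 B2) by rewrite !le_max !lexx !orbT.
exists (Num.max 0 (Num.max B1 B2)); split.
- apply/(measurable_restrictT g (open_measurable_cV oA)).
  by apply: continuous_measurable_cV => // x /AK; exact: cg.
- move=> v; rewrite patchE; case: ifPn => [/set_mem /AK /hB1 h|_]; last by rewrite normr0.
  exact: le_trans h B1B.
- move=> v i h; rewrite patchE; case: ifPn => // /set_mem /AK Kv.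
  by have := le_trans (hB2 v i Kv) B2B; rewrite leNgt h.
Qed.

Lemma open_continuous_integrable (g : V -> R) :
  (forall x, K x -> {for x, continuous g}) ->
  (lebesgue_cV p).-integrable A (EFin \o g).
Proof.
move=> cg; have [B tB] := open_restrict_tame cg.
apply/(integrable_mkcond _ (open_measurable_cV oA)); rewrite restrict_EFin.
exact: tame_integrable tB.
Qed.

(** Every line in the direction [k] meets [K] and [A] in sets which satisfy the
    hypotheses of the one-dimensional statement. *)
Lemma integral_partial_eq0 (f : V -> R) k : (forall x, K x -> C1_at f x) ->
  (forall x, K x -> ~ A x -> f x = 0) ->
  (\int[lebesgue_cV p]_(x in A) (partial k f x)%:E = 0)%E.
Proof.
move=> Cf f0.
have cg x : K x -> {for x, continuous (partial k f)} by move=> /Cf[].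
have [B tB] := open_restrict_tame cg.
rewrite integral_mkcond (restrict_EFin (partial k f) A); apply: (integral_lines_eq0 (k := k) tB) => v.
pose l (s : R) : V := s *: delta_mx k 0 + v.
have cl : continuous l.
  by move=> s; apply: cvgD; [apply: cvgZr_tmp; exact: cvg_id|exact: cvg_cst].
have cK' : compact (l @^-1` K).
  have [C hC] := compact_box cK.
  apply: (@subclosed_compact _ _ `[- (C + `|v k 0|), C + `|v k 0| ]%classic).
  - by apply: closed_comp => [s _|]; [exact: cl|exact: compact_closed_cV].
  - exact: segment_compact.
  - move=> s /= Ks; have := hC _ k Ks; rewrite !mxE !eqxx mulr1 in_itv /= -ler_norml => h.
    by rewrite -[s](addrK (v k 0)) (le_trans (ler_normB _ _))// lerD2r.
have oA' : open (l @^-1` A) by apply: open_comp => // s _; exact: cl.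
have := @integral_derivative_eq0 R _ _ (f \o l) (partial k f \o l) cK' oA' _ _ _ _.
rewrite integral_mkcond => <-.
- apply: eq_integral => s _; rewrite !patchE -/(l s).
  have -> : (s \in l @^-1` A) = (l s \in A) by apply/idP/idP => /set_mem h; exact/mem_set.
  by case: ifP.
- by move=> s /AK.
- by move=> s Ks nA; exact: f0.
- move=> s Ks; split; first by apply: line_derivable; exact: C1_derivable (Cf _ Ks).
  by rewrite [LHS]line_deriveE.
- by move=> s Ks; apply: continuous_comp; [exact: cl|exact: cg].
Qed.

End divergence.

(** * Mean square errors *)

Section measurability.
Context {R : realType} {d : measure_display} {T : measurableType d}.

Lemma measurable_det n (D : set T) (A : T -> 'M[R]_n) :
  (forall i j, measurable_fun D (fun t => A t i j)) ->
  measurable_fun D (fun t => \det (A t)).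
Proof.
move=> mA; rewrite /determinant; apply: measurable_sum => s.
apply: measurable_funM; first exact: measurable_cst.
exact: measurable_prod.
Qed.

Lemma measurable_inv (D : set T) (f : T -> R) : measurable_fun D f ->
  measurable_fun D (fun t => (f t)^-1).
Proof.
move=> mf; rewrite (_ : (fun _ => _) = fun t => f t * powR (f t ^+ 2) (-1)).
  apply: measurable_funM => //.
  apply: (measurableT_comp (measurable_powR (-1))).
  exact: measurable_funX.
apply/funext => t; rewrite powR_inv1 ?sqr_ge0//.
have [->|f0] := eqVneq (f t) 0; first by rewrite invr0 mul0r.
by rewrite expr2 invfM mulrA divff// mul1r.
Qed.

Lemma measurable_invmx n (D : set T) (A : T -> 'M[R]_n) :
  (forall t, D t -> A t \in unitmx) ->
  (forall i j, measurable_fun D (fun t => A t i j)) ->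
  forall i j, measurable_fun D (fun t => invmx (A t) i j).
Proof.
move=> uA mA i j.
apply: (eq_measurable_fun (fun t => (\det (A t))^-1 * \adj (A t) i j)).
  by move=> t /set_mem Dt; rewrite /invmx uA// [RHS]mxE.
apply: measurable_funM; first exact/measurable_inv/measurable_det.
rewrite (_ : (fun _ => _) = fun t => cofactor (A t) j i); last first.
  by apply/funext => t; rewrite mxE.
apply: measurable_funM; first exact: measurable_cst.
apply: measurable_det => k l.
by rewrite (_ : (fun _ => _) = fun t => A t (lift j k) (lift i l)) //; apply/funext => t; rewrite !mxE.
Qed.

Lemma measurable_rtr n (P Q : T -> 'M[R[i]]_n) :
  (forall i j, measurable_fun setT (fun t => complex.Re (P t i j)) /\
               measurable_fun setT (fun t => complex.Im (P t i j))) ->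
  (forall i j, measurable_fun setT (fun t => complex.Re (Q t i j)) /\
               measurable_fun setT (fun t => complex.Im (Q t i j))) ->
  measurable_fun setT (fun t => rtr (P t *m Q t)).
Proof.
move=> mP mQ; under eq_fun do rewrite rtr_mulE.
apply: measurable_sum => i; apply: measurable_sum => j.
have [[a b] [c e]] := (mP i j, mQ j i).
by apply: measurable_funB; apply: measurable_funM.
Qed.

End measurability.

Section mean_square_error.
Context {R : realType} {dX : measure_display} {X : measurableType dX} {q : nat}.

Lemma quadZ (W : 'M[R]_q) (c : R) (u : 'cV[R]_q) :
  ((c *: u)^T *m W *m (c *: u)) 0 0 = c ^+ 2 * (u^T *m W *m u) 0 0.
Proof.
rewrite !quadE mulr_sumr; apply: eq_bigr => i _; rewrite mulr_sumr.
by apply: eq_bigr => j _; rewrite !mxE; ring.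
Qed.

Lemma measurable_quad d (T : measurableType d) (D : set T) (W : T -> 'M[R]_q)
    (u : T -> 'cV[R]_q) :
  (forall i j, measurable_fun D (fun x => W x i j)) ->
  (forall i, measurable_fun D (fun x => u x i 0)) ->
  measurable_fun D (fun x => ((u x)^T *m W x *m u x) 0 0).
Proof.
move=> mW mu; under eq_fun do rewrite quadE.
apply: measurable_sum => i; apply: measurable_sum => j.
by apply: measurable_funM => //; exact: measurable_funM.
Qed.

Lemma measurable_shift_coord (est : X -> 'cV[R]_q) t i : measurable_fun setT est ->
  measurable_fun setT (fun x => (est x - t) i 0).
Proof.
move=> /measurable_fun_cVP mest.
rewrite (_ : (fun _ => _) = fun x => est x i 0 - t i 0); first exact: measurable_funB.
by apply/funext => x; rewrite !mxE.
Qed.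

(** The trace of the weighted error matrix is the mean of the quadratic loss. When a
    coordinate has infinite mean square both are infinite, since a positive
    definite form dominates the square of each coordinate. *)
Lemma weighted_mseE (P : {measure set X -> \bar R}) (W : 'M[R]_q) est t :
  posdefmx W -> measurable_fun setT est -> weighted_mse W P est t =
  (\int[P]_x (((est x - t)^T *m W *m (est x - t)) 0 0)%:E)%E.
Proof.
move=> pW mest.
pose u x := est x - t.
have mu i : measurable_fun setT (fun x => u x i 0).
  exact: measurable_shift_coord.
have mQ : measurable_fun setT (fun x => ((u x)^T *m W *m u x) 0 0).
  by apply: measurable_quad => // i j; exact: measurable_cst.
have [c c0 Wc] := posdef_dominates pW.
have Q0 x : 0 <= ((u x)^T *m W *m u x) 0 0 by exact: posdef_ge0.
have muu i j : measurable_fun setT (fun x => u x i 0 * u x j 0) by exact: measurable_funM.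
rewrite /weighted_mse; case: asboolP => [fin|nfin]; last first.
  apply/esym; apply: contrapT => /eqP Qfin; apply: nfin => i.
  have uQ x : u x i 0 ^+ 2 <= c * ((u x)^T *m W *m u x) 0 0.
    apply: le_trans (Wc (u x)); move: (u x) => v.
    rewrite [leRHS]mxE (bigD1 i)//= [v^T _ _]mxE expr2 lerDl.
    by apply: sumr_ge0 => j _; rewrite mxE -expr2 sqr_ge0.
  apply: (@le_lt_trans _ _ (\int[P]_x (c%:E * (((u x)^T *m W *m u x) 0 0)%:E)))%E.
    apply: ge0_le_integral => //.
    - by move=> x _; rewrite lee_fin sqr_ge0.
    - by apply/measurable_EFinP; exact: muu.
    - by apply: measurable_funeM; exact/measurable_EFinP.
    - by move=> x _; rewrite -EFinM lee_fin; exact: uQ.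
  have mQE : measurable_fun setT (fun x => (((u x)^T *m W *m u x) 0 0)%:E).
    exact/measurable_EFinP.
  rewrite (ge0_integralZl _ measurableT mQE) ?lee_fin//; last by move=> x _; rewrite lee_fin.
  by rewrite lte_mul_pinfty// ltey.
have iu i : P.-integrable setT (fun x => (u x i 0 ^+ 2)%:E).
  apply/integrableP; split; first by apply/measurable_EFinP; exact: muu.
  apply: le_lt_trans (fin i); rewrite le_eqVlt; apply/orP; left; apply/eqP.
  by apply: eq_integral => x _; rewrite gee0_abs// lee_fin sqr_ge0.
have iuu i j : P.-integrable setT (fun x => (u x i 0 * u x j 0)%:E).
  apply: (le_integrable measurableT _ _ (integrableD measurableT (iu i) (iu j))).
    exact/measurable_EFinP.
  move=> x _; rewrite -EFinD /= lee_fin [leRHS]ger0_norm ?addr_ge0 ?sqr_ge0//.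
  move: (u x i 0) (u x j 0) => a b; rewrite ler_norml.
  have := sqr_ge0 (a + b); have := sqr_ge0 (a - b); have := sqr_ge0 a; have := sqr_ge0 b.
  by rewrite sqrrB sqrrD => *; apply/andP; split; lra.
have iz i j : P.-integrable setT (fun x => ((W i j)%:E * (u x i 0 * u x j 0)%:E)%E).
  exact: integrableZl.
transitivity (\int[P]_x (\sum_i \sum_j (W i j)%:E * (u x i 0 * u x j 0)%:E))%E; last first.
  apply: eq_integral => x _; rewrite quadE -sumEFin; apply: eq_bigr => i _.
  by rewrite -sumEFin; apply: eq_bigr => j _; rewrite -mulrA.
rewrite integral_sum// => [|i]; last exact: integrable_sum.
rewrite /mxtrace -sumEFin; apply: eq_bigr => i _.
rewrite integral_sum// mxE -sumEFin; apply: eq_bigr => j _.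
rewrite integralZl// EFinM; congr (_ * _)%E; rewrite mxE.
transitivity (fine (\int[P]_x (u x i 0 * u x j 0)%:E)%E)%:E.
  congr (fine _)%:E; apply: eq_integral => x _.
  by rewrite mxE big_ord1 [X in _ * X]mxE mulrC.
by rewrite fineK//; exact: integrable_fin_num.
Qed.

End mean_square_error.

Section limit.
Context {R : realType}.

Lemma limn_einf_ge (u : nat -> \bar R) (c J : R) :
  (forall n, (0 < n)%N -> ((c - J / n%:R)%:E <= u n)%E) ->
  (c%:E <= limn_einf u)%E.
Proof.
move=> h; pose v n : \bar R := (c - J / n%:R)%:E.
have cv : v n @[n --> \oo] --> c%:E.
  apply: cvg_EFin; first by near=> n.
  rewrite -[X in _ --> X]subr0 -[X in c - X](mulr0 J).
  apply: cvgB; first exact: cvg_cst.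
  apply: cvgMr; rewrite -(cvg_shiftS (fun n => n%:R^-1 : R)); exact: cvg_harmonic.
rewrite -(cvg_limn_einf_sup cv).1 !limn_einf_lim.
apply: lee_lim; [exact: is_cvg_einfs|exact: is_cvg_einfs|].
near=> n; apply: le_ereal_inf_tmp => _ [k /= nk <-].
apply: (@le_trans _ _ (v k)); first by apply: ereal_inf_lbound; exists k.
apply: h; apply: leq_trans nk; near: n; exact: nbhs_infty_gt.
Unshelve. all: by end_near. Qed.

End limit.

(** * The inequality at one parameter value *)

Section point.
Context {R : realType} {d p q : nat}.
Local Notation C := R[i].
Local Notation V := 'cV[R]_p.
Variables (rho : V -> 'M[C]_d) (psi : V -> 'cV[R]_q) (Gt : V -> 'M[R]_q).
Variables (prior : V -> R) (g : 'I_q -> 'I_p -> V -> R).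

(** The vector [(C pi)' / pi], with [g] a smooth extension of [C pi]: it is the
    contribution of the prior to the logarithmic derivative. *)
Definition score (x : V) : 'cV[R]_q :=
  (prior x)^-1 *: \col_i \sum_k partial k (g i k) x.

Definition prior_information (x : V) : R :=
  prior x * ((score x)^T *m invmx (Gt x) *m score x) 0 0.

(** This is [pi] times the Holevo bound, in a form that is evidently continuous. *)
Definition prior_holevo (x : V) : R := \sum_i \sum_k jacobian_cV psi x i k * g i k x.

Variable x : V.
Hypotheses (Crho : C1m_at rho x) (drho_near : \forall y \near x, density_mx (rho y)).
Hypothesis feasible : exists X, locally_unbiased rho X x.
Hypotheses (pGt : posdefmx (Gt x)) (pG : posdefmx (G0 psi Gt x)).
Hypothesis prior0 : 0 < prior x.
Hypothesis g_near : forall i k,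
  \forall y \near x, Cmx rho psi Gt y i k * prior y = g i k y.

Let gE i k : Cmx rho psi Gt x i k * prior x = g i k x.
Proof. exact: (nbhs_singleton (g_near i k)). Qed.

Let D := jacobian_cV psi x.
Let V0 := holevo_argmin rho (G0 psi Gt x) x.

Lemma score_div_Cprior : score x = (prior x)^-1 *: div_Cprior prior rho psi Gt x.
Proof.
congr (_ *: _); apply/colP => i; rewrite !mxE; apply: eq_bigr => k _.
by apply/esym; apply: near_eq_derive; exact: g_near.
Qed.

Lemma prior_informationE :
  ((div_Cprior prior rho psi Gt x)^T *m invmx (Gt x) *m
    div_Cprior prior rho psi Gt x) 0 0 / prior x ^+ 2 * prior x = prior_information x.
Proof.
rewrite /prior_information score_div_Cprior; move: (div_Cprior _ _ _ _ _) => v.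
have p0 := lt0r_neq0 prior0.
rewrite -scalemxAr linearZ /= -!scalemxAl scalerA.
set A := v^T *m _ *m _; rewrite [in RHS]mxE; move: (A 0 0) => a.
by field.
Qed.

Lemma prior_information_ge0 : 0 <= prior_information x.
Proof.
rewrite mulr_ge0 ?(ltW prior0)//; have [sG _] := pGt.
pose a := invmx (Gt x) *m score x.
have -> : score x = Gt x *m a by rewrite mulKVmx ?posdef_unit.
by rewrite trmx_mul sG -mulmxA mulKmx ?posdef_unit//; exact: posdef_ge0.
Qed.

Lemma prior_holevoE : prior_holevo x = prior x * \tr (G0 psi Gt x *m V0).
Proof.
have -> : G0 psi Gt x *m V0 = D^T *m Cmx rho psi Gt x by rewrite /G0 /Cmx !mulmxA.
rewrite /prior_holevo /mxtrace exchange_big mulr_sumr; apply: eq_bigr => k _.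
rewrite mxE mulr_sumr; apply: eq_bigr => i _.
by rewrite -gE [D^T _ _]mxE mulrA mulrC.
Qed.

Lemma holevo_prior : (holevo_bound rho (G0 psi Gt x) x * (prior x)%:E = (prior_holevo x)%:E)%E.
Proof.
have [_ _ optV0] := holevo_argminP Crho drho_near feasible pG.
by rewrite (holevo_boundE Crho drho_near feasible pG) -optV0 prior_holevoE mulrC EFinM.
Qed.

Lemma prior_holevo_ge0 : 0 <= prior_holevo x.
Proof.
rewrite prior_holevoE mulr_ge0 ?(ltW prior0)//; have [prho _] := model_state drho_near.
have [W [Y [[pW _ hY _ WY] _]]] := model_kkt Crho drho_near feasible pG.
apply: le_trans WY; apply: rtr_psd_ge0 pW _; exact: obs_cov_psd prho _ hY.
Qed.

(** The operator inequality for [N + 1] copies, times the prior. On the left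
    the product rule has united the derivatives of [C pi] and of the state; on the
    right the trace of [op] splits into the information of the prior and the
    covariance of the copies. *)
Lemma point_ineq N : exists op : 'M[C]_(d ^ N.+1),
  (forall m (u : 'cV[R]_q), psdmx m ->
    2%:R * \sum_i u i 0 * \sum_k
      (partial k (g i k) x * rtr (ntensmx (rho x) N.+1 *m m) +
       g i k x * rtr (mpartial k (fun t => ntensmx (rho t) N.+1) x *m m)) <=
    prior x * ((u^T *m Gt x *m u) 0 0 * rtr (ntensmx (rho x) N.+1 *m m)) +
    prior x * rtr (op *m m)) /\
  prior x * rtr op <= prior_information x + N.+1%:R * prior_holevo x.
Proof.
have [prho trho] := model_state drho_near.
have [W [X [[pW hW hX eqX WX] cX]]] := model_kkt Crho drho_near feasible pG.
have psig := psd_ntens N prho.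
have tsig := mxtrace_ntens N trho.
have hY i : (copies_obs X N i)^t* = copies_obs X N i by exact: copies_obs_herm.
have cY i := copies_obs_centered N i trho cX.
have eqY := copies_logderiv N eqX.
pose op := van_trees_op W (Gt x) D (ntensmx_rec (rho x) N) (copies_obs X N) (score x).
exists op; split=> [m u pm|].
  have := van_trees_op_ineq pGt pG pW hW erefl psig hY eqY (score x) u pm.
  rewrite -(ler_pM2l prior0) mulrDr; apply: le_trans.
  rewrite [leRHS]mulrCA le_eqVlt; apply/orP; left; apply/eqP; congr (_ * _).
  rewrite mulr_sumr; apply: eq_bigr => i _; rewrite [RHS]mulrCA; congr (_ * _).
  rewrite mulrDr mulr_sumr mulrA [in RHS]mxE mulrA divff ?lt0r_neq0// mul1r.
  rewrite [in RHS]mxE mulr_suml -big_split; apply: eq_bigr => k _ /=.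
  by rewrite mulrA [prior x * _]mulrC gE (mpartial_ntens N k Crho).
have -> : rtr op = ((score x)^T *m invmx (Gt x) *m score x) 0 0 +
    N.+1%:R * rtr (W *m obs_cov (rho x) X).
  rewrite /rtr (van_trees_op_tr pGt pG hW tsig cY) raddfD /=; congr (_ + _).
  rewrite (_ : \sum_i _ = (N.+1%:R)%:C * \tr (W *m obs_cov (rho x) X)) ?Re_realM//.
  rewrite [in RHS]/mxtrace mulr_sumr; apply: eq_bigr => i _; rewrite mxE mulr_sumr.
  apply: eq_bigr => j _; rewrite copies_obs_cov// [obs_cov _ _ _ _]mxE mulrCA; congr (_ * _).
  by rewrite rmorph_nat.
rewrite mulrDr lerD2l prior_holevoE mulrCA ler_pM2l ?ltr0n// ler_pM2l//.
Qed.

End point.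

(** * The integrated inequality *)

Section ibp.
Context {R : realType} {p q n : nat}.
Local Notation C := R[i].
Local Notation V := 'cV[R]_p.
Variables (K A : set V) (S : V -> 'M[C]_n) (psi : V -> 'cV[R]_q).
Variable g : 'I_q -> 'I_p -> V -> R.
Hypotheses (cK : compact K) (oA : open A) (AK : A `<=` K).
Hypothesis CS : forall x, K x -> C1m_at S x.
Hypothesis Cpsi : forall x i, K x -> C1_at (fun t => psi t i 0) x.
Hypothesis Cg : forall x i k, K x -> C1_at (g i k) x.
Hypothesis g0 : forall x i k, K x -> ~ A x -> g i k x = 0.

Lemma prior_holevo_continuous x : K x -> {for x, continuous (prior_holevo psi g)}.
Proof.
move=> Kx; have F : Filter (nbhs x) := nbhs_filter x.
rewrite /prop_for /continuous_at /prior_holevo.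
apply: (@cvg_big _ _ _ _ _ _ _ _ _ (fun i y => \sum_k jacobian_cV psi y i k * g i k y)) => [|i _].
  exact: add_continuous.
apply: (@cvg_big _ _ _ _ _ _ _ _ _ (fun k y => jacobian_cV psi y i k * g i k y)) => [|k _].
  exact: add_continuous.
apply: cvgM; last exact: (C1_continuous (Cg i k Kx)).
rewrite (_ : (fun y => jacobian_cV psi y i k) = partial k (fun t => psi t i 0)).
  by rewrite mxE; have [_] := Cpsi i Kx; exact.
by apply/funext => y; rewrite mxE.
Qed.

(** The divergence theorem for the fields [(e - psi)_i tr (S m) g_i], which vanish
    outside [A]; the derivative of [psi] produces the right-hand side. *)
Lemma integral_div_field (e : 'cV[R]_q) (m : 'M[C]_n) :
  (\int[lebesgue_cV p]_(x in A)
     (\sum_i (e i 0 - psi x i 0) * \sum_k (partial k (g i k) x * rtr (S x *m m) +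
        g i k x * rtr (mpartial k S x *m m)))%:E =
   \int[lebesgue_cV p]_(x in A) (prior_holevo psi g x * rtr (S x *m m))%:E)%E.
Proof.
pose h i k (x : V) := (e i 0 - psi x i 0) * (g i k x * rtr (S x *m m)).
have Cr x : K x -> C1_at (fun t => rtr (S t *m m)) x by move=> /CS; exact: C1_rtr.
have Cgr i k x : K x -> C1_at (fun t => g i k t * rtr (S t *m m)) x.
  by move=> Kx; apply: C1M; [exact: Cg|exact: Cr].
have Ce i x : K x -> C1_at (fun t => e i 0 - psi t i 0) x.
  by move=> Kx; apply: C1D; [exact: C1_cst|apply: C1N; exact: Cpsi].
have Ch i k x : K x -> C1_at (h i k) x.
  by move=> Kx; apply: C1M; [exact: Ce|exact: Cgr].
have dh i k x : K x -> partial k (h i k) x =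
    (e i 0 - psi x i 0) * (partial k (g i k) x * rtr (S x *m m) +
      g i k x * rtr (mpartial k S x *m m)) -
    jacobian_cV psi x i k * (g i k x * rtr (S x *m m)).
  move=> Kx; have D f : C1_at f x -> derivable f x (delta_mx k 0) := @C1_derivable _ _ f x _.
  rewrite partialM; [|exact/D/Ce|exact/D/Cgr].
  rewrite partialM; [|exact/D/Cg|exact/D/Cr].
  rewrite partial_rtr; last exact: CS.
  rewrite (partialD (f := fun=> e i 0) (g := fun t => - psi t i 0)); first last.
  - exact/D/C1N/Cpsi.
  - exact/D/C1_cst.
  rewrite partial_cst (partialN (f := fun t => psi t i 0)); last exact/D/Cpsi.
  have -> : jacobian_cV psi x i k = partial k (fun t => psi t i 0) x by rewrite mxE.
  by rewrite add0r mulrN [in LHS]addrC [rtr _ * partial _ _ _]mulrC; ring.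
have int0 i k := integral_partial_eq0 cK oA AK k (Ch i k)
  (fun x Kx nA => ltac:(by rewrite /h g0// mul0r mulr0)).
have inth i k : (lebesgue_cV p).-integrable A (EFin \o partial k (h i k)).
  exact: (open_continuous_integrable cK oA AK (fun x Kx => (Ch i k x Kx).2 k)).
have intc : (lebesgue_cV p).-integrable A
    (EFin \o (fun x => prior_holevo psi g x * rtr (S x *m m))).
  refine (open_continuous_integrable cK oA AK _) => x Kx.
  exact: (continuousM (prior_holevo_continuous Kx) (C1_continuous (Cr x Kx))).
have mA := open_measurable_cV oA.
transitivity (\int[lebesgue_cV p]_(x in A)
   ((prior_holevo psi g x * rtr (S x *m m))%:E + \sum_i \sum_k (partial k (h i k) x)%:E))%E.
  apply: eq_integral => x /set_mem /AK Kx.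
  under [in RHS]eq_bigr do rewrite sumEFin.
  rewrite sumEFin -EFinD; congr EFin.
  rewrite /prior_holevo mulr_suml -big_split /=; apply: eq_bigr => i _.
  rewrite mulr_sumr mulr_suml -big_split /=; apply: eq_bigr => k _.
  by rewrite dh// -mulrA [RHS]addrC subrK.
rewrite integralD//; last first.
  by apply: integrable_sum => // i _; apply: integrable_sum => // k _; exact: inth.
rewrite [X in (_ + X)%E](_ : _ = 0%E) ?adde0//.
rewrite integral_sum// => [|i]; last by apply: integrable_sum => // k _; exact: inth.
rewrite big1// => i _; rewrite integral_sum// => [|k]; last exact: inth.
by rewrite big1// => k _; exact: int0.
Qed.

End ibp.

Lemma scale_bound (R : realType) (N c j r : R) : 0 < N ->
  2%:R * N * c <= N ^+ 2 * r + (j + N * c) -> c - j / N <= N * r.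
Proof.
move=> N0 h; rewrite -(ler_pM2l N0).
have -> : N * (c - j / N) = N * c - j by field; exact: lt0r_neq0.
rewrite [N * (N * r)]mulrA; move: h; rewrite expr2 -[2%:R * N * c]mulrA.
by move: (N * c) (N * N * r) => a b; lra.
Qed.

Section van_trees.
Context {R : realType} {d p q N : nat} {dX : measure_display} {X : measurableType dX}.
Local Notation C := R[i].
Local Notation V := 'cV[R]_p.
Local Notation L := (lebesgue_cV p).
Variables (K A : set V) (rho : V -> 'M[C]_d) (psi : V -> 'cV[R]_q) (Gt : V -> 'M[R]_q).
Variables (prior : V -> R) (g : 'I_q -> 'I_p -> V -> R).
Hypotheses (cK : compact K) (oA : open A) (AK : A `<=` K).
Hypothesis Crho : forall x, K x -> C1m_at rho x.
Hypothesis Cpsi : forall x i, K x -> C1_at (fun t => psi t i 0) x.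
Hypothesis Cg : forall x i k, K x -> C1_at (g i k) x.
Hypothesis g0 : forall x i k, K x -> ~ A x -> g i k x = 0.
Hypothesis drho : forall x, A x -> \forall y \near x, density_mx (rho y).
Hypothesis feasible : forall x, A x -> exists X, locally_unbiased rho X x.
Hypothesis pGt : forall x, A x -> posdefmx (Gt x).
Hypothesis pG : forall x, A x -> posdefmx (G0 psi Gt x).
Hypothesis prior0 : forall x, A x -> 0 < prior x.
Hypothesis gE : forall x i k, A x ->
  \forall y \near x, Cmx rho psi Gt y i k * prior y = g i k y.
Hypothesis mGt : forall i j, measurable_fun A (fun t => Gt t i j).
Hypothesis cprior : forall x, A x -> {for x, continuous prior}.

Let S t := ntensmx (rho t) N.+1.

Variables (nu : {finite_measure set X -> \bar R}) (m : X -> 'M[C]_(d ^ N.+1)).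
Hypothesis m_psd : forall x, psdmx (m x).
Hypothesis m_int : forall Q, nu.-integrable setT (fun x => (rtr (m x *m Q))%:E).
Hypothesis m_one : forall Q, (\int[nu]_x (rtr (m x *m Q))%:E = (rtr Q)%:E)%E.
Variable est : X -> 'cV[R]_q.
Hypothesis mest : measurable_fun setT est.

Let CS x : K x -> C1m_at S x. Proof. by move=> /Crho; exact: C1m_ntens. Qed.
Let mA : measurable A. Proof. exact: open_measurable_cV. Qed.

Let u (z : V * X) : 'cV[R]_q := est z.2 - (if z.1 \in A then psi z.1 else 0).
Let SA t := if t \in A then S t else 0.
Let dSA k t := if t \in A then mpartial k S t else 0.
Let GA t := if t \in A then Gt t else 0.
(* The divergence term, the loss and the product of the Holevo bound with the
   density of the outcome, as functions of parameter and outcome. Cutting off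
   outside [A] makes them measurable on the whole product. *)
Let F z := \sum_i u z i 0 * \sum_k
  ((partial k (g i k) \_ A) z.1 * rtr (SA z.1 *m m z.2) +
   (g i k \_ A) z.1 * rtr (dSA k z.1 *m m z.2)).
Let B z := (prior \_ A) z.1 *
  (((u z)^T *m GA z.1 *m u z) 0 0 * rtr (SA z.1 *m m z.2)).
Let H z := (prior_holevo psi g \_ A) z.1 * rtr (SA z.1 *m m z.2).

Let mres (f : V -> R) : measurable_fun A f ->
  measurable_fun setT (fun z : V * X => (f \_ A) z.1).
Proof.
move=> mf; apply: (measurableT_comp (f := f \_ A)); last exact: measurable_fst.
exact/(measurable_restrictT f mA).
Qed.

Let cont_meas (f : V -> R) : (forall x, K x -> {for x, continuous f}) -> measurable_fun A f.
Proof. by move=> cf; apply: continuous_measurable_cV oA _ => x /AK; exact: cf. Qed.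

Let mu_ i : measurable_fun setT (fun z => u z i 0).
Proof.
rewrite (_ : (fun _ => _) = fun z : V * X => est z.2 i 0 - ((fun t => psi t i 0) \_ A) z.1).
  apply: measurable_funB.
    apply: (measurableT_comp (f := fun x => est x i 0)); last exact: measurable_snd.
    by move/measurable_fun_cVP : mest; exact.
  by apply: mres; apply: cont_meas => x Kx; exact: (C1_continuous (Cpsi i Kx)).
by apply/funext => z; rewrite /u patchE !mxE; case: ifP => // _; rewrite mxE.
Qed.

Let mmat (P : V -> 'M[C]_(d ^ N.+1)) :
  (forall i j, measurable_fun A (fun t => complex.Re (P t i j)) /\
               measurable_fun A (fun t => complex.Im (P t i j))) ->
  measurable_fun setT (fun z : V * X => rtr ((if z.1 \in A then P z.1 else 0) *m m z.2)).
Proof.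
move=> mP; apply: measurable_rtr => i j; have [mr mi] := mP i j.
  split.
    rewrite (_ : (fun _ => _) = fun z : V * X => ((fun t => complex.Re (P t i j)) \_ A) z.1).
      exact: mres.
    by apply/funext => z; rewrite patchE; case: ifP => // _; rewrite mxE.
  rewrite (_ : (fun _ => _) = fun z : V * X => ((fun t => complex.Im (P t i j)) \_ A) z.1).
    exact: mres.
  by apply/funext => z; rewrite patchE; case: ifP => // _; rewrite mxE.
have mm Q : measurable_fun setT (fun z : V * X => rtr (m z.2 *m Q)).
  apply: (measurableT_comp (f := fun x => rtr (m x *m Q))); last exact: measurable_snd.
  by apply/measurable_EFinP; exact: measurable_int (m_int Q).
split.
  rewrite (_ : (fun _ => _) = fun z : V * X => rtr (m z.2 *m (1 *: delta_mx j i))) //.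
  by apply/funext => z; rewrite rtr_unit mul1r.
rewrite (_ : (fun _ => _) = fun z : V * X => rtr (m z.2 *m (Complex 0 (-1) *: delta_mx j i))) //.
apply/funext => z; rewrite rtr_unit; case: (m z.2 i j) => a b /=.
by rewrite mul0r sub0r mulN1r opprK.
Qed.

Let mSm : measurable_fun setT (fun z : V * X => rtr (SA z.1 *m m z.2)).
Proof.
apply: mmat => i j; split; apply: cont_meas => x /CS CSx; apply: C1_continuous.
  by have [] := CSx i j.
by have [] := CSx i j.
Qed.

Let mdSm k : measurable_fun setT (fun z : V * X => rtr (dSA k z.1 *m m z.2)).
Proof.
apply: mmat => i j; split; apply: cont_meas => x /CS CSx.
  rewrite (_ : (fun _ => _) = partial k (fun t => complex.Re (S t i j))).
    by have [[_ h] _] := CSx i j; exact: h.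
  by apply/funext => t; rewrite mxE.
rewrite (_ : (fun _ => _) = partial k (fun t => complex.Im (S t i j))).
  by have [_ [_ h]] := CSx i j; exact: h.
by apply/funext => t; rewrite mxE.
Qed.

Let mF : measurable_fun setT F.
Proof.
apply: measurable_sum => i; apply: measurable_funM => //.
apply: measurable_sum => k; apply: measurable_funD; apply: measurable_funM => //; apply: mres;
  apply: cont_meas => x Kx.
  by have [_] := Cg i k Kx; exact.
exact: (C1_continuous (Cg i k Kx)).
Qed.

Let mprior : measurable_fun A prior.
Proof. exact: continuous_measurable_cV. Qed.

Let mB : measurable_fun setT B.
Proof.
apply: measurable_funM; first exact: mres.
apply: measurable_funM => //; apply: measurable_quad => // i j.
rewrite (_ : (fun _ => _) = fun z : V * X => ((fun t => Gt t i j) \_ A) z.1); first exact: mres.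
by apply/funext => z; rewrite patchE /GA; case: ifP => // _; rewrite mxE.
Qed.

Let mH : measurable_fun setT H.
Proof.
apply: measurable_funM => //; apply: mres; apply: cont_meas => x Kx.
exact: (@prior_holevo_continuous _ _ _ _ _ _ Cpsi Cg x Kx).
Qed.

Let FA t x : A t -> F (t, x) = \sum_i (est x - psi t) i 0 * \sum_k
  (partial k (g i k) t * rtr (S t *m m x) + g i k t * rtr (mpartial k S t *m m x)).
Proof.
move=> At; rewrite /F /u /SA /= mem_set//; apply: eq_bigr => i _; congr (_ * _).
by apply: eq_bigr => k _; rewrite /dSA !patchE mem_set.
Qed.

Let FnA t x : ~ A t -> F (t, x) = 0.
Proof.
move=> nA; rewrite /F big1// => i _; rewrite big1 ?mulr0// => k _.
by rewrite !patchE memNset// !mul0r addr0.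
Qed.

Let BA t x : A t -> B (t, x) = prior t *
  (((est x - psi t)^T *m Gt t *m (est x - psi t)) 0 0 * rtr (S t *m m x)).
Proof. by move=> At; rewrite /B /u /GA /SA /= patchE mem_set. Qed.

Let BnA t x : ~ A t -> B (t, x) = 0.
Proof. by move=> nA; rewrite /B patchE memNset// mul0r. Qed.

Let HA t x : A t -> H (t, x) = prior_holevo psi g t * rtr (S t *m m x).
Proof. by move=> At; rewrite /H /SA /= patchE mem_set. Qed.

Let HnA t x : ~ A t -> H (t, x) = 0.
Proof. by move=> nA; rewrite /H patchE memNset// mul0r. Qed.

Let psdS t : A t -> psdmx (S t) /\ rtr (S t) = 1.
Proof.
move=> At; have [pr tr] := model_state (drho At).
by split; [exact: psd_ntens|rewrite /rtr mxtrace_ntens].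
Qed.

Let B_ge0 z : 0 <= B z.
Proof.
case: z => t x; have [At|nA] := pselect (A t); last by rewrite BnA.
rewrite BA// mulr_ge0 ?(ltW (prior0 At))// mulr_ge0//; first exact: posdef_ge0 _ (pGt At).
exact: rtr_psd_ge0 (psdS At).1 (m_psd x).
Qed.

Let H_ge0 z : 0 <= H z.
Proof.
case: z => t x; have [At|nA] := pselect (A t); last by rewrite HnA.
rewrite HA// mulr_ge0//; last exact: rtr_psd_ge0 (psdS At).1 (m_psd x).
exact: (prior_holevo_ge0 (Crho (AK At)) (drho At) (feasible At) (pG At) (prior0 At)
  (fun i k => gE i k At)).
Qed.

Let r t := (\int[nu]_x (B (t, x))%:E)%E.
Let jA := prior_information Gt prior g \_ A.
Let hA := prior_holevo psi g \_ A.
Let N1 : R := N.+1%:R.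

Let mEB : measurable_fun setT (EFin \o B). Proof. exact/measurable_EFinP. Qed.
Let mEF : measurable_fun setT (EFin \o F). Proof. exact/measurable_EFinP. Qed.
Let mEH : measurable_fun setT (EFin \o H). Proof. exact/measurable_EFinP. Qed.

Let mr : measurable_fun setT r.
Proof. by apply: (measurable_fun_fubini_tonelli_F _ mEB) => z; rewrite lee_fin. Qed.

Let r_ge0 t : (0 <= r t)%E.
Proof. by apply: integral_ge0 => x _; rewrite lee_fin. Qed.

Let mFt t : measurable_fun setT (fun x => F (t, x)).
Proof. exact: measurableT_comp mF (pair1_measurable t). Qed.

Let mBt t : measurable_fun setT (fun x => B (t, x)).
Proof. exact: measurableT_comp mB (pair1_measurable t). Qed.

(* The error of the estimate is scaled by [c], to be chosen below. *)
Let point t : A t -> exists op, (forall c x,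
    2%:R * (c * F (t, x)) <= c ^+ 2 * B (t, x) + prior t * rtr (m x *m op)) /\
  prior t * rtr op <= jA t + N1 * hA t.
Proof.
move=> At; have [op [ineq tr]] := point_ineq (Crho (AK At)) (drho At) (feasible At) (pGt At)
  (pG At) (prior0 At) (fun i k => gE i k At) N.
exists op; split=> [c x|]; last by rewrite /jA /hA !patchE mem_set.
have := ineq (m x) (c *: (est x - psi t)) (m_psd x).
rewrite FA// BA// quadZ [rtr (op *m _)]rtr_mulC => h.
apply: le_trans (le_trans _ h) _; rewrite le_eqVlt; apply/orP; left; apply/eqP.
  congr (_ * _); rewrite mulr_sumr; apply: eq_bigr => i _.
  by rewrite [in RHS]mxE mulrA.
by congr (_ + _); rewrite -mulrA mulrCA.
Qed.

Let Bint t : (r t < +oo)%E -> nu.-integrable setT (fun x => (B (t, x))%:E).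
Proof.
move=> rt; apply/integrableP; split; first exact/measurable_EFinP.
apply: le_lt_trans rt; rewrite le_eqVlt; apply/orP; left; apply/eqP.
by apply: eq_integral => x _; rewrite gee0_abs ?lee_fin.
Qed.

(* [c = 1] and [c = -1] *)
Let abs_F t : (\int[nu]_x `|(F (t, x))%:E| <= r t + (jA t + N1 * hA t)%:E)%E.
Proof.
have [At|nA] := pselect (A t); last first.
  rewrite integral0_eq => [|x _]; last by rewrite FnA// abse0.
  by rewrite /jA /hA !patchE memNset// mulr0 addr0 adde0.
have [rt|] := ltP (r t) +oo%E; last by rewrite leye_eq => /eqP ->; rewrite addye// leey.
have [op [ineq tr]] := point At.
have le x : `|F (t, x)| <= B (t, x) + prior t * rtr (m x *m op).
  have := ineq 1 x; have := ineq (-1) x; rewrite sqrrN expr1n !mul1r mulN1r.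
  move: (F _) (B _) (prior t * _) => a b k h1 h2.
  by rewrite ler_norml; apply/andP; split; lra.
have iB := Bint rt.
have ik : nu.-integrable setT (fun x => (prior t)%:E * (rtr (m x *m op))%:E)%E.
  exact: integrableZl.
apply: (@le_trans _ _ (\int[nu]_x ((B (t, x))%:E + (prior t)%:E * (rtr (m x *m op))%:E))%E).
  apply: ge0_le_integral => //.
  - by apply: measurableT_comp => //; exact/measurable_EFinP.
  - by apply: emeasurable_funD; [exact: measurable_int iB|exact: measurable_int ik].
  - by move=> x _; rewrite /= lee_fin.
by rewrite integralD// integralZl// m_one; apply: leeD.
Qed.

(* [c = N1] balances the loss against the covariance of the copies *)
Let le_F t : ((2%:R * N1)%:E * (\int[nu]_x (F (t, x))%:E) <=
  (N1 ^+ 2)%:E * r t + (jA t + N1 * hA t)%:E)%E.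
Proof.
have N0 : 0 < N1 by rewrite ltr0n.
have [At|nA] := pselect (A t); last first.
  rewrite integral0_eq => [|x _]; last by rewrite FnA.
  rewrite mule0 /jA /hA !patchE memNset// mulr0 addr0 adde0.
  by rewrite mule_ge0// lee_fin sqr_ge0.
have [rt|] := ltP (r t) +oo%E; last first.
  rewrite leye_eq => /eqP ->; rewrite mulry gtr0_sg ?exprn_gt0// mul1e.
  by rewrite addye// leey.
have [op [ineq tr]] := point At.
have iB := Bint rt.
have iF : nu.-integrable setT (fun x => (F (t, x))%:E).
  apply/integrableP; split; first exact/measurable_EFinP.
  apply: le_lt_trans (abs_F t) _; move: rt (r_ge0 t); case: (r t) => //= a _ _.
  by rewrite -EFinD ltey.
have iNB : nu.-integrable setT (fun x => (N1 ^+ 2)%:E * (B (t, x))%:E)%E by exact: integrableZl.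
have ik : nu.-integrable setT (fun x => (prior t)%:E * (rtr (m x *m op))%:E)%E.
  exact: integrableZl.
rewrite -integralZl//.
apply: (@le_trans _ _ (\int[nu]_x ((N1 ^+ 2)%:E * (B (t, x))%:E +
    (prior t)%:E * (rtr (m x *m op))%:E))%E).
  apply: le_integral => //; [exact: integrableZl|exact: integrableD|].
  by move=> x _; rewrite -!EFinM -EFinD lee_fin -mulrA.
by rewrite integralD// !integralZl// m_one; apply: leeD.
Qed.

Let ih : L.-integrable setT (EFin \o hA).
Proof.
rewrite -restrict_EFin; apply/(integrable_mkcond _ mA).
apply: (open_continuous_integrable cK oA AK) => x Kx.
exact: (@prior_holevo_continuous _ _ _ _ _ _ Cpsi Cg x Kx).
Qed.

Let mj : measurable_fun A (prior_information Gt prior g).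
Proof.
apply: measurable_funM => //; apply: measurable_quad.
  by apply: measurable_invmx => // t /pGt /posdef_unit.
move=> i; rewrite (_ : (fun _ => _) = fun x => (prior x)^-1 * \sum_k partial k (g i k) x).
  apply: measurable_funM; first exact: measurable_inv.
  apply: measurable_sum => k; apply: cont_meas => x Kx.
  by have [_] := Cg i k Kx; exact.
by apply/funext => x; rewrite !mxE.
Qed.

Hypothesis J_fin : (\int[L]_(t in A) (prior_information Gt prior g t)%:E < +oo)%E.

Let ij : L.-integrable setT (EFin \o jA).
Proof.
rewrite -restrict_EFin; apply/(integrable_mkcond _ mA).
apply/integrableP; split; first exact/measurable_EFinP.
apply: le_lt_trans J_fin; rewrite le_eqVlt; apply/orP; left; apply/eqP.
apply: eq_integral => t /set_mem At /=; rewrite ger0_norm//.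
exact: prior_information_ge0 (pGt At) (prior0 At).
Qed.

Let ijh : L.-integrable setT (fun t => (jA t + N1 * hA t)%:E).
Proof.
rewrite (_ : (fun _ => _) = fun t => ((jA t)%:E + N1%:E * (hA t)%:E)%E) //.
by apply: integrableD; [by []|exact: ij|apply: integrableZl; [by []|exact: ih]].
Qed.

Let rint : (\int[L]_t r t < +oo)%E -> L.-integrable setT r.
Proof.
move=> Rfin; apply/integrableP; split=> //; apply: le_lt_trans Rfin.
by rewrite le_eqVlt; apply/orP; left; apply/eqP; apply: eq_integral => t _; rewrite gee0_abs.
Qed.

Let int_F : (\int[L]_t r t < +oo)%E ->
  (L \x nu)%E.-integrable setT (EFin \o F) /\
  (\int[L]_t \int[nu]_x (F (t, x))%:E = \int[L]_t (hA t)%:E)%E.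
Proof.
move=> Rfin.
have ir := rint Rfin.
have irhs := integrableD measurableT ir ijh.
have iF : (L \x nu)%E.-integrable setT (EFin \o F).
  apply: (@integrable12ltyP _ _ _ _ _ L nu _ mEF).2.
  have [mrhs] := integrableP _ _ _ irhs; apply: le_lt_trans.
  apply: ge0_le_integral => //.
  - by move=> t _; exact: integral_ge0.
  - apply: (measurable_fun_fubini_tonelli_F (fun z => `|(EFin \o F) z|)%E) => //.
    exact: measurableT_comp.
  - exact: measurableT_comp.
  - by move=> t _; apply: le_trans (abs_F t) _; exact: lee_abs.
split=> //; rewrite (Fubini iF).
transitivity (\int[nu]_x \int[L]_t (H (t, x))%:E)%E.
  apply: eq_integral => x _.
  transitivity (\int[L]_(t in A) (F (t, x))%:E)%E.
    rewrite [RHS]integral_mkcond; apply: eq_integral => t _; rewrite patchE.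
    by case: ifPn => [//|/negP nA]; rewrite /= FnA// => At; apply: nA; exact: mem_set.
  transitivity (\int[L]_(t in A) (H (t, x))%:E)%E; last first.
    rewrite [LHS]integral_mkcond; apply: eq_integral => t _; rewrite patchE.
    by case: ifPn => [//|/negP nA]; rewrite /= HnA// => At; apply: nA; exact: mem_set.
  under [RHS]eq_integral => t /set_mem At do rewrite HA//.
  rewrite -(integral_div_field cK oA AK CS Cpsi Cg g0 (est x) (m x)).
  apply: eq_integral => t /set_mem At; rewrite FA//; congr EFin.
  by apply: eq_bigr => i _; rewrite !mxE.
rewrite -(@fubini_tonelli _ _ _ _ _ L nu (EFin \o H) mEH) => [|z]; last by rewrite lee_fin.
apply: eq_integral => t _ /=; rewrite /hA patchE; case: ifPn => [/set_mem At|/negP nA].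
  under eq_integral => x _ do rewrite HA// EFinM rtr_mulC.
  by rewrite integralZl// m_one (psdS At).2 mule1.
rewrite integral0_eq// => x _; rewrite HnA// => At; apply: nA; exact: mem_set.
Qed.

(** Integrating the inequality with [c = N1] over outcomes and parameters gives
    [2 N1 c <= N1 ^+ 2 r + (j + N1 c)], where [r] is the risk, [j] the
    information of the prior and [c] the mean Holevo bound. The absolute bound
    justifies the exchange of the integrals when the risk is finite. *)
Lemma van_trees_core :
  ((fine (\int[L]_(t in A) (prior_holevo psi g t)%:E) -
    fine (\int[L]_(t in A) (prior_information Gt prior g t)%:E) / N1)%:E <=
   N1%:E * \int[L]_(t in A) \int[nu]_x (prior t *
     (((est x - psi t)^T *m Gt t *m (est x - psi t)) 0 0 * rtr (S t *m m x)))%:E)%E.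
Proof.
have N0 : 0 < N1 by rewrite ltr0n.
have -> : (\int[L]_(t in A) \int[nu]_x (prior t *
     (((est x - psi t)^T *m Gt t *m (est x - psi t)) 0 0 * rtr (S t *m m x)))%:E =
     \int[L]_t r t)%E.
  rewrite integral_mkcond; apply: eq_integral => t _; rewrite patchE.
  case: ifPn => [/set_mem At|/negP nA]; first by apply: eq_integral => x _; rewrite BA.
  by apply/esym; apply: integral0_eq => x _; rewrite BnA// => At; apply: nA; exact: mem_set.
have [Rfin|] := ltP (\int[L]_t r t)%E +oo%E; last first.
  by rewrite leye_eq => /eqP ->; rewrite mulry gtr0_sg// mul1e leey.
have [iF FH] := int_F Rfin.
have ir := rint Rfin.
have ifF : L.-integrable setT (fun t => \int[nu]_x (F (t, x))%:E)%E.
  exact: (integrable_fubini_F iF).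
have iNh : L.-integrable setT (fun t => N1%:E * (hA t)%:E)%E by exact: integrableZl.
have iNr : L.-integrable setT (fun t => (N1 ^+ 2)%:E * r t)%E by exact: integrableZl.
have : (\int[L]_t ((2%:R * N1)%:E * \int[nu]_x (F (t, x))%:E) <=
    \int[L]_t ((N1 ^+ 2)%:E * r t + (jA t + N1 * hA t)%:E))%E.
  by apply: le_integral => //; [exact: integrableZl|exact: integrableD].
rewrite integralZl// FH integralD// integralZl//.
have -> : (\int[L]_t (jA t + N1 * hA t)%:E = \int[L]_t (jA t)%:E + N1%:E * \int[L]_t (hA t)%:E)%E.
  rewrite -[in RHS]integralZl// -integralD//; by apply: eq_integral.
have EA (f : V -> R) : (\int[L]_(t in A) (f t)%:E = \int[L]_t ((f \_ A) t)%:E)%E.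
  by rewrite integral_mkcond -/(EFin \o f) restrict_EFin.
rewrite !EA -/jA -/hA.
rewrite -(fineK (integrable_fin_num measurableT ih)) -(fineK (integrable_fin_num measurableT ij)).
rewrite -(fineK (integrable_fin_num measurableT ir)).
set c := fine _; set jr := fine _; set rr := fine _.
rewrite -!EFinM -!EFinD !lee_fin => h; exact: scale_bound N0 h.
Qed.

End van_trees.

(** * The asymptotic bound *)

Section outcome_mse.
Context {R : realType} {dX : measure_display} {X : measurableType dX} {q n : nat}.

Lemma eq_weighted_mse (P P' : set X -> \bar R) (W : 'M[R]_q) est t :
  (forall B, measurable B -> P B = P' B) ->
  weighted_mse W P est t = weighted_mse W P' est t.
Proof.
move=> PP'; have e f := eq_raw_integral f PP'.
rewrite /weighted_mse; have -> : mse_mx P est t = mse_mx P' est t.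
  by apply/matrixP => i j; rewrite !mxE e.
congr (if `[< _ >] then _ else _).
by apply/propext; split=> h i; [rewrite -e|rewrite e].
Qed.

Lemma weighted_mse_density (M : povm R X n) (S : 'M[R[i]]_n) (W : 'M[R]_q) est t
    (nu : {finite_measure set X -> \bar R}) m :
  psdmx S -> posdefmx W -> measurable_fun setT est ->
  (forall (f : X -> \bar R), (forall x, 0 <= f x)%E -> measurable_fun setT f ->
     (\int[outcome_law S M]_x f x = \int[nu]_x (f x * (rtr (m x *m S))%:E))%E) ->
  weighted_mse W (outcome_law S M) est t = (\int[nu]_x
    (((est x - t)^T *m W *m (est x - t)) 0 0 * rtr (S *m m x))%:E)%E.
Proof.
move=> pS pW mest law.
rewrite (@eq_weighted_mse _ (povm_measure M pS)); last first.
  by move=> B mB; exact: povm_charge_outcome.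
rewrite weighted_mseE// -(@eq_raw_integral _ _ _ (outcome_law S M)); last first.
  by move=> B mB; exact: povm_charge_outcome.
rewrite law.
- by apply: eq_integral => x _; rewrite EFinM rtr_mulC.
- by move=> x; rewrite lee_fin; exact: posdef_ge0 _ pW.
- apply/measurable_EFinP; apply: measurable_quad => i; first by move=> j; exact: measurable_cst.
  exact: measurable_shift_coord.
Qed.

End outcome_mse.

Theorem theorem1 (R : realType) (d p q : nat)
    (Theta Theta0 : set 'cV[R]_p)
    (rho : 'cV[R]_p -> 'M[R[i]]_d)
    (psi : 'cV[R]_p -> 'cV[R]_q)
    (Gt : 'cV[R]_p -> 'M[R]_q)
    (prior : 'cV[R]_p -> R)
    (rho_smooth : smooth_model rho Theta)
    (rho_feasible : forall theta, Theta theta ->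
       exists X : 'I_p -> 'M[R[i]]_d, locally_unbiased rho X theta)
    (psi_smooth : forall i, smooth_near Theta (fun t => psi t i 0))
    (Gt_posdef : forall theta, Theta theta -> posdefmx (Gt theta))
    (Gt_measurable : forall i j, measurable_fun Theta0 (fun t => Gt t i j))
    (G0_posdef : forall theta, Theta theta -> posdefmx (G0 psi Gt theta))
    (Theta0_compact : compact Theta0)
    (Theta0_sub : Theta0 `<=` Theta)
    (Theta0_boundary : piecewise_smooth (boundary Theta0))
    (prior_smooth : smooth_prior Theta0 prior)
    (Cprior_smooth : forall i j,
       smooth_on Theta0 (fun t => Cmx rho psi Gt t i j * prior t))
    (J_finite : (J_prior Theta0 prior rho psi Gt < +oo)%E)
    (disp : nat -> measure_display)
    (X : forall N, measurableType (disp N))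
    (M : forall N, povm R (X N) (d ^ N))
    (psihat : forall N, X N -> 'cV[R]_q)
    (psihat_measurable : forall N, measurable_fun setT (psihat N)) :
  (prior_mean Theta0 prior (fun theta => holevo_bound rho (G0 psi Gt theta) theta)
   <= limn_einf (fun N => N%:R%:E *
        bayes_risk Theta0 prior rho psi Gt (M N) (psihat N)))%E.
Proof.
have [[pr [U [oU KU dU cU]] prE] prior_ge0 _ prior_bd] := prior_smooth.
have Cpr x : Theta0 x -> C1_at pr x.
  by apply: smooth_near_C1; exists U; split.
(* [A] is defined by the smooth extension [pr] of the prior, to make it open. *)
pose A := interior Theta0 `&` [set x | 0 < pr x].
have AK : A `<=` Theta0 by move=> x [/interior_subset].
have oA : open A.
  rewrite openE => x [Ix prx]; apply: filterI.
    exact: open_nbhs_nbhs (conj (@open_interior _ Theta0) Ix).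
  by have := C1_continuous (Cpr x (interior_subset Ix)); move=> /(cvgr_gt (pr x)) /(_ 0 prx).
have nearK x : A x -> \forall y \near x, Theta0 y by case.
have prior0 x : A x -> 0 < prior x by move=> Ax; rewrite prE; [case: Ax|exact: AK].
have prior_out x : Theta0 x -> ~ A x -> prior x = 0.
  move=> Kx nA; have [Ix|nI] := pselect (interior Theta0 x); last first.
    by apply: prior_bd; split=> //; exact: subset_closure.
  apply/eqP; rewrite eq_le prior_ge0// andbT prE// leNgt; apply/negP => prx.
  by apply: nA.
have cprior x : A x -> {for x, continuous prior}.
  move=> Ax; apply: (near_continuous (h' := pr)).
    by apply: filterS (nearK x Ax) => y; exact: prE.
  exact: C1_continuous (Cpr x (AK x Ax)).
pose g i k := s2val (cid2 (Cprior_smooth i k)).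
have Cg x i k : Theta0 x -> C1_at (g i k) x.
  by apply: smooth_near_C1; rewrite /g; case: cid2.
have gK x i k : Theta0 x -> Cmx rho psi Gt x i k * prior x = g i k x.
  by rewrite /g; case: cid2 => h /= _ hE; exact: hE.
have g0 x i k : Theta0 x -> ~ A x -> g i k x = 0.
  by move=> Kx nA; rewrite -gK// prior_out// mulr0.
have gE x i k : A x -> \forall y \near x, Cmx rho psi Gt y i k * prior y = g i k y.
  by move=> /nearK; apply: filterS => y; exact: gK.
have [rho_density rho_C1] := rho_smooth.
have Crho x : Theta0 x -> C1m_at rho x.
  move=> /Theta0_sub Tx i j; have [sr si] := rho_C1 i j.
  by split; [exact: smooth_near_C1 sr _ Tx|exact: smooth_near_C1 si _ Tx].
have drho x : A x -> \forall y \near x, density_mx (rho y).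
  by move=> /nearK; apply: filterS => y /Theta0_sub; exact: rho_density.
have AT x : A x -> Theta x by move=> /AK /Theta0_sub.
have Cpsi x i : Theta0 x -> C1_at (fun t => psi t i 0) x.
  by move=> /Theta0_sub; exact: smooth_near_C1 (psi_smooth i) _.
have mK := compact_measurable_cV Theta0_compact.
have mGt i j : measurable_fun A (fun t => Gt t i j).
  exact: measurable_funS mK AK (Gt_measurable i j).
(* The prior vanishes on [Theta0] outside [A], so prior means are integrals
   over [A]. *)
have meanE (f : 'cV[R]_p -> \bar R) (h : 'cV[R]_p -> \bar R) :
    (forall x, A x -> (f x * (prior x)%:E = h x)%E) ->
    prior_mean Theta0 prior f = (\int[lebesgue_cV p]_(x in A) h x)%E.
  move=> fh; rewrite /prior_mean integral_mkcond [RHS]integral_mkcond.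
  apply: eq_integral => x _; rewrite !patchE; case: ifPn => [/set_mem Kx|/negP nK].
    case: ifPn => [/set_mem Ax|/negP nA]; first exact: fh.
    by rewrite prior_out ?mule0// => Ax; apply: nA; exact: mem_set.
  by case: ifPn => // /set_mem Ax; exfalso; apply: nK; apply: mem_set; exact: AK.
have -> : prior_mean Theta0 prior (fun theta => holevo_bound rho (G0 psi Gt theta) theta) =
    (\int[lebesgue_cV p]_(x in A) (prior_holevo psi g x)%:E)%E.
  apply: meanE => x Ax; have Tx := AT x Ax.
  exact: (holevo_prior (Crho x (AK x Ax)) (drho x Ax) (rho_feasible x Tx) (G0_posdef x Tx)
    (fun i k => gE x i k Ax)).
have JE : J_prior Theta0 prior rho psi Gt =
    (\int[lebesgue_cV p]_(x in A) (prior_information Gt prior g x)%:E)%E.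
  apply: meanE => x Ax; rewrite -EFinM; congr EFin.
  exact: (prior_informationE (prior0 x Ax) (fun i k => gE x i k Ax)).
rewrite JE in J_finite.
have ih : (lebesgue_cV p).-integrable A (EFin \o prior_holevo psi g).
  apply: (open_continuous_integrable Theta0_compact oA AK) => x Kx.
  exact: (@prior_holevo_continuous _ _ _ _ _ _ Cpsi Cg x Kx).
rewrite -(fineK (integrable_fin_num (open_measurable_cV oA) ih)).
apply: (@limn_einf_ge _ _ _ (fine (\int[lebesgue_cV p]_(x in A) (prior_information Gt prior g x)%:E)%E)).
case=> // N _.
have [nu [m [m_psd m_int m_one law]]] := povm_density (M N.+1).
have -> : bayes_risk Theta0 prior rho psi Gt (M N.+1) (psihat N.+1) =
    (\int[lebesgue_cV p]_(t in A) \int[nu]_x (prior t *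
     (((psihat N.+1 x - psi t)^T *m Gt t *m (psihat N.+1 x - psi t)) 0 0 *
       rtr (ntensmx (rho t) N.+1 *m m x)))%:E)%E.
  apply: meanE => t At; have [prt _] := model_state (drho t At).
  have pS : psdmx (ntensmx (rho t) N.+1) by exact: psd_ntens.
  have pGt := Gt_posdef t (AT t At).
  rewrite (weighted_mse_density _ pS pGt (psihat_measurable N.+1) (fun f => law _ f pS)).
  rewrite muleC -ge0_integralZl//.
  - apply/measurable_EFinP; apply: measurable_funM.
      apply: measurable_quad => i; first by move=> j; exact: measurable_cst.
      exact: measurable_shift_coord.
    under eq_fun do rewrite rtr_mulC; apply/measurable_EFinP.
    exact: measurable_int (m_int _).
  - move=> x _; rewrite lee_fin mulr_ge0//; first exact: posdef_ge0 _ pGt.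
    exact: rtr_psd_ge0 pS (m_psd x).
  - by rewrite lee_fin ltW// prior0.
exact: (van_trees_core Theta0_compact oA AK Crho Cpsi Cg g0 drho
  (fun x Ax => rho_feasible x (AT x Ax)) (fun x Ax => Gt_posdef x (AT x Ax))
  (fun x Ax => G0_posdef x (AT x Ax)) prior0 gE mGt cprior m_psd m_int m_one
  (psihat_measurable N.+1) J_finite).
Qed.
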